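(* The monodromy matrices of $\mathcal{L}(0)$ satisfy $M_1=M_2=-I_2$.
   Context: Let $\tau\in\mathbb{C}$ with $\mathrm{Im}\,\tau>0$, $\Lambda_\tau=\mathbb{Z}+\mathbb{Z}\tau$; $\wp(z)=\wp(z;\tau)$ is the Weierstrass function of $\Lambda_\tau$. Put $\omega_0=0,\omega_1=1,\omega_2=\tau,\omega_3=1+\tau$. $\mathcal{L}(0)$ is the equation $$y''(z)=q(z)y(z),\qquad q(z)=\tfrac34\sum_{k=0}^3\wp(z-\tfrac{\omega_k}{2}),\quad z\in\mathbb{C},$$ all of whose solutions are free of logarithmic singularities. Monodromy matrices: fix $z_0\in\mathbb{C}$ such that $z_0+\mathbb{R}$ and $z_0+\tau\mathbb{R}$ contain no singularities of $q$, and let $y_1,y_2$ be linearly independent solutions near $z_0$. Then $M_1,M_2$ are the $2\times2$ matrices with $(y_1,y_2)^t(z+1)=M_1(y_1,y_2)^t(z)$ near $z_0+\mathbb{R}$ and $(y_1,y_2)^t(z+\tau)=M_2(y_1,y_2)^t(z)$ near $z_0+\tau\mathbb{R}$ (analytic continuation along these lines). *)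

(* Defs.v *)
(* Stdlib reals and Coquelicot; complex numbers are Coquelicot's [C]. *)
From Stdlib Require Import Reals ZArith.
From Coquelicot Require Import Coquelicot.

Set Implicit Arguments.
Open Scope C_scope.

Definition C_is_derive (f : C -> C) (z l : C) : Prop :=
  @is_derive C_AbsRing C_NormedModule f z l.

Definition lattice_pt (tau : C) (m n : Z) : C :=
  RtoC (IZR m) + RtoC (IZR n) * tau.

Definition wp_term (tau z : C) (m n : Z) : C :=
  if (Z.eqb m 0 && Z.eqb n 0)%bool then / (z * z)
  else / ((z - lattice_pt tau m n) * (z - lattice_pt tau m n))
       - / (lattice_pt tau m n * lattice_pt tau m n).

Definition wp_partial (tau z : C) (N : nat) : C :=
  sum_n (G := C_AbelianMonoid) (fun i =>
    sum_n (G := C_AbelianMonoid) (fun j =>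
      wp_term tau z (Z.of_nat i - Z.of_nat N) (Z.of_nat j - Z.of_nat N))
      (2 * N))
    (2 * N).

(* The lattice series converges absolutely for z off the lattice, so summing it
   over the squares -N <= m, n <= N involves no choice.  The value at a lattice
   point, where wp has a pole, is meaningless. *)
Definition wp (tau z : C) : C :=
  iota (T := C_CompleteNormedModule)
    (fun l : C => filterlim (fun N => wp_partial tau z N) eventually
                            (locally (T := C_UniformSpace) l)).

Definition omega (tau : C) (k : nat) : C :=
  match k with
  | 0%nat => 0
  | 1%nat => 1
  | 2%nat => tau
  | _ => 1 + tau
  end.

Definition qL0 (tau z : C) : C :=
  (RtoC 3 / RtoC 4)
  * sum_n (G := C_AbelianMonoid) (fun k => wp tau (z - omega tau k / RtoC 2)) 3.

Definition singularity (q : C -> C) (z : C) : Prop :=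
  ~ locally (T := C_UniformSpace) z (fun u => exists l, C_is_derive q u l).

(* [y] solves y'' = q y at [z], [dy] being its first derivative. *)
Definition ode_at (q y dy : C -> C) (z : C) : Prop :=
  C_is_derive y z (dy z) /\ C_is_derive dy z (q z * y z).

Definition solution_near (q : C -> C) (z0 : C) (y : C -> C) : Prop :=
  exists dy, locally (T := C_UniformSpace) z0 (ode_at q y dy).

Definition lin_indep_near (z0 : C) (y1 y2 : C -> C) : Prop :=
  forall c1 c2 : C,
    locally (T := C_UniformSpace) z0 (fun z => c1 * y1 z + c2 * y2 z = 0) ->
    c1 = 0 /\ c2 = 0.

(* [P] holds on some open set containing the line z0 + R w. *)
Definition near_line (z0 w : C) (P : C -> Prop) : Prop :=
  forall t : R, locally (T := C_UniformSpace) (z0 + RtoC t * w) P.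

(* The line is simply connected, so the continuation of the germ of [y] at [z0]
   along it is a single-valued solution near the whole line. *)
Definition continuation_along (q : C -> C) (z0 w : C) (y Y : C -> C) : Prop :=
  locally (T := C_UniformSpace) z0 (fun z => Y z = y z) /\
  exists dY, near_line z0 w (ode_at q Y dY).

Definition col2 (a b : C) : @matrix C 2 1 :=
  mk_matrix 2 1 (fun i _ => match i with 0%nat => a | _ => b end).

(* [M] is the matrix with (y1,y2)^t(z + w) = M (y1,y2)^t(z) near z0 + R w. *)
Definition is_monodromy (q : C -> C) (z0 w : C) (y1 y2 : C -> C)
    (M : @matrix C 2 2) : Prop :=
  exists Y1 Y2 : C -> C,
    continuation_along q z0 w y1 Y1 /\ continuation_along q z0 w y2 Y2 /\
    near_line z0 w (fun z =>
      col2 (Y1 (z + w)) (Y2 (z + w))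
      = @Mmult C_Ring 2 2 1 M (col2 (Y1 z) (Y2 z))).

Definition I2 : @matrix C 2 2 := @Mone C_Ring 2.

(* Main.v *)
Require Import Defs.
From Stdlib Require Import Reals ZArith Lra Lia Classical ClassicalEpsilon.
From Coquelicot Require Import Coquelicot.
Open Scope C_scope.

(** The equation has an explicit basis of solutions.  For any function f, the
    functions f'^(-1/2) and f * f'^(-1/2) solve y'' = -(1/2) S(f) y, where S is the
    Schwarzian derivative, and their Wronskian is 1.  The potential of L(0) is
    -(1/2) S(wp), so 1/g and wp/g with g^2 = wp' are solutions
    ([qL0_schwarzian], [line_basis]).  As wp has periods 1 and tau, the whole
    monodromy is carried by the sign picked up by g = sqrt(wp') along a period.

    The sign comes from translation by half a period h, with e = wp(h) and
    c = wp''(h)/2.  The function (wp(z) - e)(wp(z+h) - e) is elliptic without poles,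
    hence equal to c ([wp_half_shift]).  Differentiating,
    wp'(z+h) = -c wp'(z)/(wp(z) - e)^2, so that on a line of direction 2h
    g(z+h) = k g(z)/(wp(z) - e) with k^2 = -c, where k is constant because it is
    continuous and has a constant nonzero square.  Applying this twice,
    g(z+2h) = k^2 g(z)/((wp(z) - e)(wp(z+h) - e)) = (-c/c) g(z) = -g(z)
    ([line_sqrt_antiperiodic]).  No winding number is computed, and the argument is the
    same for every line off the half lattice.  Both solutions therefore change sign, and
    so does every solution along the line; linear independence of y1 and y2 then leaves
    -I as the only possible matrix ([monodromy_iff_opp_I2]).

    The rest is the theory of wp that these steps rely on.  The series is summed over
    squares, with the pole at 0 split off; its regular part is differentiable because
    each term has a second order remainder bound and the bounds are summable
    ([wp_reg_derive]).  Liouville's theorem for doubly periodic functions follows from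
    the mean value property on circles: the maximum of the real part propagates from a
    maximum point to a pole that has been filled in ([liouville]).  It yields the half
    shift relation and wp'' = 6 wp^2 + const ([wp_ode]); from these two, algebra gives
    wp'^2 = 4 (wp - e1)(wp - e2)(wp - e3) with e1 + e2 + e3 = 0 and the value of the
    potential.  The nonvanishing of c is a uniqueness argument for the ordinary
    differential equation: if c were 0, wp would be constant on the segment from the
    half period to the pole at 0 ([wp2_half_period_nonzero]).

    Finally, a line that meets no singularity of the potential avoids the half lattice,
    because (z - a)^2 q(z) tends to 3/4 at each of its points a
    ([half_lattice_singular]). *)

(** * Limits and complex derivatives *)


(** Limits along an arbitrary filter, so that one set of rules serves sequences of
    partial sums, complex neighbourhoods and real parameters of paths. *)
Definition tends {T : Type} (F : (T -> Prop) -> Prop) (f : T -> C) (l : C) : Prop :=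
  forall e : R, (0 < e)%R -> F (fun y => (Cmod (f y - l) < e)%R).

Definition nbhd (z : C) : (C -> Prop) -> Prop := locally (T := C_UniformSpace) z.

(** The uniform structure of C is that of the product R * R, whose balls are squares;
    every estimate below is about discs. *)
Lemma nbhd_Cmod (z : C) (P : C -> Prop) :
  nbhd z P <-> exists d : R, (0 < d)%R /\ forall y, (Cmod (y - z) < d)%R -> P y.
Proof.
  split.
  - intros [d Hd]. exists d. split; [apply cond_pos|].
    intros y Hy. apply Hd. apply C_NormedModule_mixin_compat1. exact Hy.
  - intros [d [Hd H]].
    assert (H2 : (0 < sqrt 2)%R) by (apply sqrt_lt_R0; lra).
    assert (Hp : (0 < d / sqrt 2)%R) by (apply Rdiv_lt_0_compat; assumption).
    exists (mkposreal _ Hp). intros y Hy. apply H.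
    apply C_NormedModule_mixin_compat2 in Hy. simpl in Hy.
    replace (sqrt 2 * (d / sqrt 2))%R with d in Hy by (field; lra). exact Hy.
Qed.

Global Instance nbhd_filter (z : C) : ProperFilter (nbhd z).
Proof. unfold nbhd. apply locally_filter. Qed.

Lemma nbhd_self (z : C) (P : C -> Prop) : nbhd z P -> P z.
Proof. apply locally_singleton. Qed.

Lemma nbhd_nbhd (z : C) (P : C -> Prop) : nbhd z P -> nbhd z (fun y => nbhd y P).
Proof. apply locally_locally. Qed.

Lemma nbhd_ball (z : C) (d : R) : (0 < d)%R -> nbhd z (fun y => (Cmod (y - z) < d)%R).
Proof. intros Hd. apply nbhd_Cmod. exists d. auto. Qed.

Section Tends.
Context {T : Type} {F : (T -> Prop) -> Prop} {FF : Filter F}.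

Lemma tends_const (c : C) : tends F (fun _ => c) c.
Proof.
  intros e He. apply filter_forall. intros _.
  replace (c - c) with (RtoC 0) by ring. rewrite Cmod_0. exact He.
Qed.

Lemma tends_val (f : T -> C) (l m : C) : l = m -> tends F f l -> tends F f m.
Proof. intros <-. auto. Qed.

Lemma tends_ext (f g : T -> C) (l : C) :
  F (fun x => f x = g x) -> tends F f l -> tends F g l.
Proof.
  intros H Hf e He. generalize (filter_and _ _ H (Hf e He)).
  apply filter_imp. intros x [E Hx]. rewrite <- E. exact Hx.
Qed.

Lemma tends_plus (f g : T -> C) (l m : C) :
  tends F f l -> tends F g m -> tends F (fun x => f x + g x) (l + m).
Proof.
  intros Hf Hg e He.
  assert (He2 : (0 < e / 2)%R) by lra.
  generalize (filter_and _ _ (Hf _ He2) (Hg _ He2)). apply filter_imp.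
  intros x [H1 H2]. replace (f x + g x - (l + m)) with ((f x - l) + (g x - m)) by ring.
  eapply Rle_lt_trans; [apply Cmod_triangle|]. lra.
Qed.

Lemma tends_mult (f g : T -> C) (l m : C) :
  tends F f l -> tends F g m -> tends F (fun x => f x * g x) (l * m).
Proof.
  intros Hf Hg e He.
  set (A := (Cmod l + Cmod m + 1)%R).
  pose proof (Cmod_ge_0 l) as Hl. pose proof (Cmod_ge_0 m) as Hm.
  assert (HA : (1 <= A)%R) by (unfold A; lra).
  set (d := Rmin 1 (e / (2 * A))).
  assert (Hd : (0 < d)%R).
  { unfold d. apply Rmin_pos; [lra|]. apply Rdiv_lt_0_compat; lra. }
  assert (Hd1 : (d <= 1)%R) by apply Rmin_l.
  assert (HdA : (d * A <= e / 2)%R).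
  { apply Rle_trans with (e / (2 * A) * A)%R.
    - apply Rmult_le_compat_r; [lra|]. apply Rmin_r.
    - right. field. lra. }
  generalize (filter_and _ _ (Hf _ Hd) (Hg _ Hd)). apply filter_imp.
  intros x [H1 H2].
  replace (f x * g x - l * m) with ((f x - l) * (g x - m) + (l * (g x - m) + (f x - l) * m)) by ring.
  eapply Rle_lt_trans; [apply Cmod_triangle|].
  eapply Rle_lt_trans; [apply Rplus_le_compat_l, Cmod_triangle|].
  rewrite !Cmod_mult.
  pose proof (Cmod_ge_0 (f x - l)). pose proof (Cmod_ge_0 (g x - m)).
  assert (Cmod (f x - l) * Cmod (g x - m) <= d * 1)%R by (apply Rmult_le_compat; lra).
  assert (Cmod l * Cmod (g x - m) <= Cmod l * d)%R by (apply Rmult_le_compat_l; lra).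
  assert (Cmod (f x - l) * Cmod m <= d * Cmod m)%R by (apply Rmult_le_compat_r; lra).
  apply Rle_lt_trans with (d * A)%R; [unfold A; lra|lra].
Qed.

Lemma tends_opp (f : T -> C) (l : C) : tends F f l -> tends F (fun x => - f x) (- l).
Proof.
  intros Hf e He. generalize (Hf e He). apply filter_imp. intros x Hx.
  replace (- f x - - l) with (- (f x - l)) by ring. rewrite Cmod_opp. exact Hx.
Qed.

Lemma tends_minus (f g : T -> C) (l m : C) :
  tends F f l -> tends F g m -> tends F (fun x => f x - g x) (l - m).
Proof. intros Hf Hg. apply tends_plus; [exact Hf|]. apply tends_opp. exact Hg. Qed.

Lemma tends_nonzero (f : T -> C) (l : C) : l <> 0 -> tends F f l -> F (fun x => f x <> 0).
Proof.
  intros Hl Hf. apply Cmod_gt_0 in Hl. generalize (Hf _ Hl). apply filter_imp.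
  intros x Hx E. rewrite E in Hx. replace (0 - l) with (- l) in Hx by ring.
  rewrite Cmod_opp in Hx. lra.
Qed.

Lemma tends_inv (f : T -> C) (l : C) : l <> 0 -> tends F f l -> tends F (fun x => / f x) (/ l).
Proof.
  intros Hl Hf e He. pose proof Hl as Hl'. apply Cmod_gt_0 in Hl'.
  set (d := Rmin (Cmod l / 2) (e * (Cmod l * Cmod l) / 2)).
  assert (Hd : (0 < d)%R).
  { unfold d. apply Rmin_pos; [lra|].
    assert (0 < e * (Cmod l * Cmod l))%R by (repeat apply Rmult_lt_0_compat; assumption). lra. }
  generalize (filter_and _ _ (Hf _ Hd) (tends_nonzero f l Hl Hf)). apply filter_imp.
  intros x [Hx Hn].
  assert (Hx1 : (Cmod (f x - l) < Cmod l / 2)%R) by (eapply Rlt_le_trans; [exact Hx|apply Rmin_l]).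
  assert (Hx2 : (Cmod (f x - l) < e * (Cmod l * Cmod l) / 2)%R)
    by (eapply Rlt_le_trans; [exact Hx|apply Rmin_r]).
  replace (/ f x - / l) with ((- (f x - l)) * / (f x * l)) by (field; split; assumption).
  assert (Hb : (Cmod l / 2 <= Cmod (f x))%R).
  { pose proof (Cmod_triangle (f x) (- (f x - l))) as Ht. rewrite Cmod_opp in Ht.
    replace (f x + - (f x - l)) with l in Ht by ring. lra. }
  rewrite Cmod_mult, Cmod_opp, Cmod_inv by (apply Cmult_neq_0; assumption).
  rewrite Cmod_mult.
  apply Rmult_lt_reg_r with (Cmod (f x) * Cmod l)%R; [apply Rmult_lt_0_compat; lra|].
  rewrite Rmult_assoc, Rinv_l, Rmult_1_r by (apply Rgt_not_eq, Rmult_lt_0_compat; lra).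
  eapply Rlt_le_trans; [exact Hx2|].
  replace (e * (Cmod l * Cmod l) / 2)%R with (e * ((Cmod l / 2) * Cmod l))%R by field.
  apply Rmult_le_compat_l; [lra|]. apply Rmult_le_compat_r; lra.
Qed.

End Tends.

Lemma tends_unique {T : Type} (F : (T -> Prop) -> Prop) {FF : ProperFilter F} (f : T -> C) (l m : C) :
  tends F f l -> tends F f m -> l = m.
Proof.
  intros Hl Hm. destruct (classic (l = m)) as [E|E]; [exact E|exfalso].
  assert (Hp : (0 < Cmod (l - m))%R).
  { apply Cmod_gt_0. intros H. apply E. replace l with (l - m + m) by ring. rewrite H. ring. }
  assert (Hp2 : (0 < Cmod (l - m) / 2)%R) by lra.
  destruct (filter_ex _ (filter_and _ _ (Hl _ Hp2) (Hm _ Hp2))) as [x [H1 H2]].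
  assert (Ht := Cmod_triangle (- (f x - l)) (f x - m)). rewrite Cmod_opp in Ht.
  replace (- (f x - l) + (f x - m)) with (l - m) in Ht by ring. lra.
Qed.

Lemma tends_filterlim {T : Type} (F : (T -> Prop) -> Prop) {FF : Filter F} (f : T -> C) (l : C) :
  tends F f l <-> filterlim f F (locally (T := C_UniformSpace) l).
Proof.
  split.
  - intros H P HP. apply nbhd_Cmod in HP. destruct HP as [d [Hd HP]].
    unfold filtermap. generalize (H d Hd). apply filter_imp. intros x Hx. apply HP. exact Hx.
  - intros H e He. apply (H (fun y => (Cmod (y - l) < e)%R)). apply nbhd_ball. exact He.
Qed.

Definition cont (f : C -> C) (z : C) : Prop := tends (nbhd z) f (f z).

Lemma tends_comp {T : Type} (F : (T -> Prop) -> Prop) {FF : Filter F} (g : T -> C) (f : C -> C) (l : C) :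
  tends F g l -> cont f l -> tends F (fun x => f (g x)) (f l).
Proof.
  intros Hg Hf e He. specialize (Hf e He). apply nbhd_Cmod in Hf.
  destruct Hf as [d [Hd Hf]]. generalize (Hg d Hd). apply filter_imp.
  intros x Hx. apply Hf. exact Hx.
Qed.

Lemma cont_id (z : C) : cont (fun y => y) z.
Proof. intros e He. apply nbhd_ball. exact He. Qed.

Lemma cont_comp (f g : C -> C) (z : C) : cont g z -> cont f (g z) -> cont (fun y => f (g y)) z.
Proof. intros Hg Hf. exact (tends_comp (nbhd z) g f (g z) Hg Hf). Qed.

Lemma cont_ext (f g : C -> C) (z : C) : nbhd z (fun y => f y = g y) -> cont f z -> cont g z.
Proof.
  intros H Hf. unfold cont. rewrite <- (nbhd_self _ _ H). exact (tends_ext _ _ _ H Hf).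
Qed.

Lemma cont_shift (f : C -> C) (a z : C) : cont f (z + a) -> cont (fun y => f (y + a)) z.
Proof.
  intros H. apply (cont_comp f (fun y => y + a)); [|exact H].
  apply tends_plus; [apply cont_id|apply tends_const].
Qed.

Lemma nbhd_cont (f : C -> C) (z : C) (P : C -> Prop) :
  cont f z -> nbhd (f z) P -> nbhd z (fun y => P (f y)).
Proof.
  intros Hf HP. apply nbhd_Cmod in HP. destruct HP as [d [Hd HP]].
  generalize (Hf d Hd). apply filter_imp. intros x Hx. apply HP. exact Hx.
Qed.

(** The derivative takes its filter from the absolute ring C, the rest of the
    development from the product structure; the two have the same neighbourhoods. *)
Lemma C_is_derive_eps (f : C -> C) (z l : C) :
  C_is_derive f z l <-> forall e : R, (0 < e)%R ->
    nbhd z (fun y => (Cmod (f y - f z - (y - z) * l) <= e * Cmod (y - z))%R).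
Proof.
  split.
  - intros [_ H] e He. apply (proj2 (locally_C z _)).
    exact (H z (fun P HP => HP) (mkposreal e He)).
  - intros H. split; [apply is_linear_scal_l|]. intros x Hx.
    assert (x = z).
    { symmetry. apply (is_filter_lim_locally_unique (K := C_AbsRing)
        (V := AbsRing_NormedModule C_AbsRing) z x Hx). }
    subst x. intros eps. apply (proj1 (locally_C z _)). exact (H eps (cond_pos eps)).
Qed.

(** In this form every differentiation rule reduces to a rule for limits and an algebraic
    identity. *)
Lemma C_is_derive_caratheodory (f : C -> C) (z l : C) :
  C_is_derive f z l <->
  exists phi, phi z = l /\ cont phi z /\ forall y, f y - f z = phi y * (y - z).
Proof.
  rewrite C_is_derive_eps. split.
  - intros H.
    exists (fun y => if excluded_middle_informative (y = z) then l else (f y - f z) / (y - z)).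
    assert (Hn : forall y, y <> z -> y - z <> 0).
    { intros y E H0. apply E. replace y with (y - z + z) by ring. rewrite H0. ring. }
    split; [destruct (excluded_middle_informative (z = z)); tauto|]. split.
    + unfold cont. destruct (excluded_middle_informative (z = z)) as [_|n]; [|tauto].
      intros e He. assert (He2 : (0 < e / 2)%R) by lra.
      generalize (H _ He2). apply filter_imp. intros y Hy.
      destruct (excluded_middle_informative (y = z)) as [E|E].
      * replace (l - l) with (RtoC 0) by ring. rewrite Cmod_0. exact He.
      * specialize (Hn y E).
        replace ((f y - f z) / (y - z) - l) with ((f y - f z - (y - z) * l) * / (y - z)) by (field; exact Hn).
        rewrite Cmod_mult, Cmod_inv by exact Hn. apply Cmod_gt_0 in Hn.
        apply Rle_lt_trans with (e / 2)%R; [|lra].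
        apply Rmult_le_reg_r with (Cmod (y - z)); [exact Hn|].
        rewrite Rmult_assoc, Rinv_l by lra. lra.
    + intros y. destruct (excluded_middle_informative (y = z)) as [E|E].
      * subst. ring.
      * field. exact (Hn y E).
  - intros [phi [E [Hc Hf]]] e He. generalize (Hc e He). apply filter_imp. intros y Hy. rewrite E in Hy.
    rewrite Hf. replace (phi y * (y - z) - (y - z) * l) with ((phi y - l) * (y - z)) by ring.
    rewrite Cmod_mult. apply Rmult_le_compat_r; [apply Cmod_ge_0|]. lra.
Qed.

(** A quadratic remainder bound, unlike a limit of difference quotients, survives passage
    to the limit in a series. *)
Lemma C_is_derive_quadratic (f : C -> C) (z l : C) (K d : R) : (0 < d)%R -> (0 <= K)%R ->
  (forall h, (Cmod h <= d)%R -> (Cmod (f (z + h)%C - f z - h * l) <= K * Cmod h * Cmod h)%R) ->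
  C_is_derive f z l.
Proof.
  intros Hd HK H. apply C_is_derive_eps. intros e He. apply nbhd_Cmod.
  exists (Rmin d (e / (K + 1))).
  split; [apply Rmin_pos; [exact Hd|apply Rdiv_lt_0_compat; lra]|]. intros y Hy.
  assert (H1 : (Cmod (y - z) <= d)%R) by (eapply Rle_trans; [apply Rlt_le, Hy|apply Rmin_l]).
  assert (H2 : (Cmod (y - z) < e / (K + 1))%R) by (eapply Rlt_le_trans; [exact Hy|apply Rmin_r]).
  specialize (H _ H1). replace (z + (y - z)) with y in H by ring.
  eapply Rle_trans; [exact H|]. apply Rmult_le_compat_r; [apply Cmod_ge_0|].
  apply Rle_trans with ((K + 1) * (e / (K + 1)))%R; [|right; field; lra].
  pose proof (Cmod_ge_0 (y - z)). apply Rmult_le_compat; lra.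
Qed.

Lemma C_is_derive_cont (f : C -> C) (z l : C) : C_is_derive f z l -> cont f z.
Proof.
  intros H. apply C_is_derive_caratheodory in H. destruct H as [phi [E [Hc Hf]]].
  unfold cont. apply tends_ext with (f := fun y => f z + phi y * (y - z)).
  - apply filter_forall. intros y. rewrite <- Hf. ring.
  - apply tends_val with (f z + phi z * (z - z)); [ring|].
    apply tends_plus; [apply tends_const|]. apply tends_mult; [exact Hc|].
    apply tends_minus; [apply cont_id|apply tends_const].
Qed.

Lemma C_is_derive_const (c z : C) : C_is_derive (fun _ => c) z 0.
Proof.
  apply C_is_derive_caratheodory. exists (fun _ => 0). split; [reflexivity|].
  split; [apply tends_const|]. intros y. ring.
Qed.

Lemma C_is_derive_id (z : C) : C_is_derive (fun y => y) z 1.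
Proof.
  apply C_is_derive_caratheodory. exists (fun _ => 1). split; [reflexivity|].
  split; [apply tends_const|]. intros y. ring.
Qed.

Lemma C_is_derive_val (f : C -> C) (z l m : C) : l = m -> C_is_derive f z l -> C_is_derive f z m.
Proof. intros <-. auto. Qed.

Lemma C_is_derive_plus (f g : C -> C) (z l m : C) :
  C_is_derive f z l -> C_is_derive g z m -> C_is_derive (fun y => f y + g y) z (l + m).
Proof.
  intros H1 H2. apply C_is_derive_caratheodory in H1, H2. apply C_is_derive_caratheodory.
  destruct H1 as [p [Ep [Cp Hp]]], H2 as [r [Er [Cr Hr]]].
  exists (fun y => p y + r y). split; [rewrite Ep, Er; reflexivity|].
  split; [apply tends_plus; assumption|]. intros y.
  replace (f y + g y - (f z + g z)) with ((f y - f z) + (g y - g z)) by ring.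
  rewrite Hp, Hr. ring.
Qed.

Lemma C_is_derive_mult (f g : C -> C) (z l m : C) :
  C_is_derive f z l -> C_is_derive g z m ->
  C_is_derive (fun y => f y * g y) z (l * g z + f z * m).
Proof.
  intros H1 H2. pose proof (C_is_derive_cont _ _ _ H2) as Cg.
  apply C_is_derive_caratheodory in H1, H2. apply C_is_derive_caratheodory.
  destruct H1 as [p [Ep [Cp Hp]]], H2 as [r [Er [Cr Hr]]].
  exists (fun y => p y * g y + f z * r y). split; [rewrite Ep, Er; reflexivity|].
  split.
  - apply tends_plus; apply tends_mult; try assumption. apply tends_const.
  - intros y.
    replace (f y * g y - f z * g z) with ((f y - f z) * g y + f z * (g y - g z)) by ring.
    rewrite Hp, Hr. ring.
Qed.

Lemma C_is_derive_opp (f : C -> C) (z l : C) :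
  C_is_derive f z l -> C_is_derive (fun y => - f y) z (- l).
Proof.
  intros H1. apply C_is_derive_caratheodory in H1. apply C_is_derive_caratheodory.
  destruct H1 as [p [Ep [Cp Hp]]].
  exists (fun y => - p y). split; [rewrite Ep; reflexivity|].
  split; [apply tends_opp; assumption|]. intros y.
  replace (- f y - - f z) with (- (f y - f z)) by ring. rewrite Hp. ring.
Qed.

Lemma C_is_derive_minus (f g : C -> C) (z l m : C) :
  C_is_derive f z l -> C_is_derive g z m -> C_is_derive (fun y => f y - g y) z (l - m).
Proof. intros H1 H2. apply C_is_derive_plus; [exact H1|]. apply C_is_derive_opp, H2. Qed.

Lemma C_is_derive_comp (f g : C -> C) (z l m : C) :
  C_is_derive f (g z) l -> C_is_derive g z m -> C_is_derive (fun y => f (g y)) z (l * m).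
Proof.
  intros H1 H2. pose proof (C_is_derive_cont _ _ _ H2) as Cg.
  apply C_is_derive_caratheodory in H1, H2. apply C_is_derive_caratheodory.
  destruct H1 as [p [Ep [Cp Hp]]], H2 as [r [Er [Cr Hr]]].
  exists (fun y => p (g y) * r y). split; [rewrite Ep, Er; reflexivity|].
  split.
  - apply tends_mult; [|assumption]. apply (cont_comp p g z); assumption.
  - intros y. rewrite Hp, Hr. ring.
Qed.

Lemma C_is_derive_ext_loc (f g : C -> C) (z l : C) :
  nbhd z (fun y => f y = g y) -> C_is_derive f z l -> C_is_derive g z l.
Proof.
  intros H. unfold C_is_derive. apply is_derive_ext_loc. apply (proj1 (locally_C z _)).
  exact H.
Qed.

Lemma C_is_derive_inv (f : C -> C) (z l : C) :
  f z <> 0 -> C_is_derive f z l -> C_is_derive (fun y => / f y) z (- l / (f z * f z)).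
Proof.
  intros Hn H1. pose proof (C_is_derive_cont _ _ _ H1) as Cf.
  apply C_is_derive_ext_loc with
    (f := fun y => if excluded_middle_informative (f y = RtoC 0) then RtoC 0 else / f y).
  { generalize (tends_nonzero f (f z) Hn Cf). apply filter_imp. intros y Hy.
    destruct (excluded_middle_informative (f y = RtoC 0)); tauto. }
  apply C_is_derive_caratheodory in H1. apply C_is_derive_caratheodory.
  destruct H1 as [p [Ep [Cp Hp]]].
  exists (fun y => if excluded_middle_informative (f y = RtoC 0)
     then RtoC 0 - / f z * / (y - z) else - (p y * / (f y * f z))).
  split; [|split].
  - destruct (excluded_middle_informative (f z = RtoC 0)); [tauto|]. rewrite Ep. field. exact Hn.
  - apply cont_ext with (f := fun y => - (p y * / (f y * f z))).
    + generalize (tends_nonzero f (f z) Hn Cf). apply filter_imp. intros y Hy.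
      destruct (excluded_middle_informative (f y = RtoC 0)); tauto.
    + apply tends_opp, tends_mult; [exact Cp|]. apply tends_inv.
      * apply Cmult_neq_0; exact Hn.
      * apply tends_mult; [exact Cf|apply tends_const].
  - intros y. destruct (excluded_middle_informative (f z = RtoC 0)) as [E|E]; [tauto|].
    destruct (excluded_middle_informative (f y = RtoC 0)) as [E'|E'].
    + assert (y - z <> 0).
      { intros H0. apply E. rewrite <- E'. f_equal. replace y with (y - z + z) by ring.
        rewrite H0. ring. }
      field. split; assumption.
    + replace (/ f y - / f z) with (- (f y - f z) * / (f y * f z)) by (field; split; assumption).
      rewrite Hp. ring.
Qed.

Lemma C_is_derive_unique (f : C -> C) (z l m : C) :
  C_is_derive f z l -> C_is_derive f z m -> l = m.
Proof.
  unfold C_is_derive. intros H1 H2.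
  transitivity (C_derive f z); [symmetry|]; apply is_C_derive_unique; assumption.
Qed.

Lemma C_is_derive_shift (f : C -> C) (a z l : C) :
  C_is_derive f (z + a) l -> C_is_derive (fun y => f (y + a)) z l.
Proof.
  intros H. apply C_is_derive_val with (l * (1 + 0)); [ring|].
  apply (C_is_derive_comp f (fun y => y + a)); [exact H|].
  apply C_is_derive_plus; [apply C_is_derive_id|apply C_is_derive_const].
Qed.

(** Differentiates by the shape of the function; leaves that are neither constant nor the
    variable are looked up in the context. *)
Ltac cder := cbv beta; lazymatch goal with
  | |- C_is_derive (fun y => y) _ _ => apply C_is_derive_id
  | |- C_is_derive (fun _ => ?c) _ _ => apply (C_is_derive_const c)
  | |- C_is_derive (fun y => @?f y + @?g y) _ _ => apply (C_is_derive_plus f g); cder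
  | |- C_is_derive (fun y => @?f y * @?g y) _ _ => apply (C_is_derive_mult f g); cder
  | |- C_is_derive (fun y => @?f y - @?g y) _ _ => apply (C_is_derive_minus f g); cder
  | |- C_is_derive (fun y => - @?f y) _ _ => apply (C_is_derive_opp f); cder
  | |- C_is_derive (fun y => / @?f y) _ _ =>
      apply (C_is_derive_inv f); [cbv beta; repeat apply Cmult_neq_0; eauto|cder]
  | |- _ => eauto
  end.

(** * Paths *)

Lemma tends_Cmod {T : Type} (F : (T -> Prop) -> Prop) {FF : Filter F} (f : T -> C) (l : C) :
  tends F f l -> filterlim (fun x => Cmod (f x)) F (locally (Cmod l)).
Proof.
  intros H. apply filterlim_locally. intros eps. generalize (H eps (cond_pos eps)). apply filter_imp.
  intros x Hx. change (Rabs (Cmod (f x) - Cmod l) < eps)%R.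
  pose proof (Cmod_triangle (f x - l) l) as T1. pose proof (Cmod_triangle (- (f x - l)) (f x)) as T2.
  rewrite Cmod_opp in T2. replace (f x - l + l) with (f x) in T1 by ring.
  replace (- (f x - l) + f x) with l in T2 by ring. apply Rabs_lt_between. lra.
Qed.

(** Derivative of a path in C, again in Caratheodory's form: the scalars change from R to C
    in the chain rule with a holomorphic function, which becomes a mere product. *)
Definition rder (g : R -> C) (t : R) (v : C) : Prop :=
  exists phi : R -> C, phi t = v /\ tends (locally t) phi v /\
    forall s, g s - g t = phi s * RtoC (s - t).

Lemma rder_comp (f : C -> C) (g : R -> C) (t : R) (l v : C) :
  C_is_derive f (g t) l -> rder g t v -> rder (fun s => f (g s)) t (l * v).
Proof.
  intros H1 [r [Er [Cr Hr]]]. apply C_is_derive_caratheodory in H1.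
  destruct H1 as [p [Ep [Cp Hp]]].
  assert (Cg : tends (locally t) g (g t)).
  { apply tends_ext with (f := fun s => g t + r s * RtoC (s - t)).
    - apply filter_forall. intros s. rewrite <- Hr. ring.
    - apply tends_val with (g t + v * 0); [ring|].
      apply tends_plus; [apply tends_const|]. apply tends_mult; [exact Cr|].
      intros e He. exists (mkposreal e He). intros y Hy.
      replace (RtoC (y - t) - 0) with (RtoC (y - t)) by ring. rewrite Cmod_R. exact Hy. }
  exists (fun s => p (g s) * r s). split; [rewrite Ep, Er; reflexivity|]. split.
  - apply tends_mult; [|exact Cr]. rewrite <- Ep. apply (tends_comp (locally t) g p); assumption.
  - intros s. rewrite Hp, Hr. ring.
Qed.

Lemma Cmod_Rabs_le (z : C) : (Cmod z <= Rabs (Re z) + Rabs (Im z))%R.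
Proof.
  replace z with ((RtoC (Re z)) + (0, Im z)) at 1 by (destruct z; unfold RtoC, Cplus; simpl; f_equal; ring).
  eapply Rle_trans; [apply Cmod_triangle|]. rewrite Cmod_R. apply Rplus_le_compat_l.
  unfold Cmod; simpl. right. rewrite <- sqrt_Rsqr_abs. f_equal. unfold Rsqr. ring.
Qed.

Lemma im_le_Cmod (z : C) : (Rabs (Im z) <= Cmod z)%R.
Proof. eapply Rle_trans; [apply Rmax_r|]. apply Rmax_Cmod. Qed.

Lemma tends_Re_Im {T : Type} (F : (T -> Prop) -> Prop) {FF : Filter F} (f : T -> C) (l : C) :
  tends F f l <-> filterlim (fun x => Re (f x)) F (locally (Re l)) /\
                  filterlim (fun x => Im (f x)) F (locally (Im l)).
Proof.
  split.
  - intros H. split; apply filterlim_locally; intros e; generalize (H e (cond_pos e));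
      apply filter_imp; intros x Hx; (eapply Rle_lt_trans; [|exact Hx]).
    + apply (re_le_Cmod (f x - l)).
    + apply (im_le_Cmod (f x - l)).
  - intros [H1 H2] e He. assert (He2 : (0 < e / 2)%R) by lra.
    rewrite filterlim_locally in H1, H2.
    generalize (filter_and _ _ (H1 (mkposreal _ He2)) (H2 (mkposreal _ He2))). apply filter_imp.
    intros x [B1 B2]. eapply Rle_lt_trans; [apply Cmod_Rabs_le|].
    change (Rabs (Re (f x) - Re l) < e / 2)%R in B1. change (Rabs (Im (f x) - Im l) < e / 2)%R in B2.
    change (Re (f x - l)) with (Re (f x) - Re l)%R. change (Im (f x - l)) with (Im (f x) - Im l)%R.
    lra.
Qed.

Lemma is_derive_R_cara (f : R -> R) (t l : R) :
  is_derive f t l <-> exists phi : R -> R, phi t = l /\ filterlim phi (locally t) (locally l) /\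
     forall s, (f s - f t = phi s * (s - t))%R.
Proof.
  split.
  - intros [_ H]. specialize (H t (fun P HP => HP)).
    exists (fun s => if Req_EM_T s t then l else (f s - f t) / (s - t))%R.
    split; [destruct (Req_EM_T t t); tauto|]. split.
    + apply filterlim_locally. intros e.
      assert (He2 : (0 < e / 2)%R) by (destruct e; simpl; lra).
      generalize (H (mkposreal _ He2)). apply filter_imp. intros s Hs.
      destruct (Req_EM_T s t) as [E|E]; [apply ball_center|].
      change (Rabs (f s - f t - (s - t) * l) <= e / 2 * Rabs (s - t))%R in Hs.
      change (Rabs ((f s - f t) / (s - t) - l) < e)%R.
      replace ((f s - f t) / (s - t) - l)%R with ((f s - f t - (s - t) * l) / (s - t))%R
        by (field; lra).
      unfold Rdiv. rewrite Rabs_mult, Rabs_inv.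
      assert (0 < Rabs (s - t))%R by (apply Rabs_pos_lt; lra).
      apply Rle_lt_trans with (e / 2)%R; [|destruct e; simpl; lra].
      apply Rmult_le_reg_r with (Rabs (s - t)); [assumption|].
      rewrite Rmult_assoc, Rinv_l by lra. lra.
    + intros s. destruct (Req_EM_T s t); [subst; ring|field; lra].
  - intros [phi [E [Hc Hf]]]. split; [apply is_linear_scal_l|].
    intros x Hx. assert (x = t) by (symmetry; apply (is_filter_lim_locally_unique (K := R_AbsRing) (V := R_NormedModule) t x Hx)).
    subst x. intros e. rewrite filterlim_locally in Hc. generalize (Hc e). apply filter_imp.
    intros s Hs. change (Rabs (phi s - l) < e)%R in Hs.
    change (Rabs (f s - f t - (s - t) * l) <= e * Rabs (s - t))%R. rewrite Hf.
    replace (phi s * (s - t) - (s - t) * l)%R with ((phi s - l) * (s - t))%R by ring.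
    rewrite Rabs_mult. apply Rmult_le_compat_r; [apply Rabs_pos|lra].
Qed.

Lemma rder_Re_Im (g : R -> C) (t : R) (v : C) :
  rder g t v <-> is_derive (fun s => Re (g s)) t (Re v) /\ is_derive (fun s => Im (g s)) t (Im v).
Proof.
  rewrite !is_derive_R_cara. split.
  - intros [phi [E [Hc Hf]]]. apply (tends_Re_Im (locally t)) in Hc.
    split; [exists (fun s => Re (phi s))|exists (fun s => Im (phi s))];
      (split; [rewrite E; reflexivity|split; [apply Hc|]]); intros s; specialize (Hf s).
    + apply (f_equal Re) in Hf. destruct (g s), (g t), (phi s).
      unfold RtoC, Cmult, Cminus, Cplus, Copp, Re in *; simpl in *. lra.
    + apply (f_equal Im) in Hf. destruct (g s), (g t), (phi s).
      unfold RtoC, Cmult, Cminus, Cplus, Copp, Im in *; simpl in *. lra.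
  - intros [[p [Ep [Cp Hp]]] [r [Er [Cr Hr]]]].
    exists (fun s => (p s, r s)). split; [rewrite Ep, Er; destruct v; reflexivity|]. split.
    + apply (tends_Re_Im (locally t)). split; assumption.
    + intros s. specialize (Hp s). specialize (Hr s). destruct (g s), (g t).
      unfold RtoC, Cmult, Cminus, Cplus, Copp, Re, Im in *; simpl in *. f_equal; lra.
Qed.

Lemma rder_line (z w : C) (t : R) : rder (fun s => z + RtoC s * w) t w.
Proof.
  exists (fun _ => w). split; [reflexivity|]. split; [apply tends_const|].
  intros s. rewrite RtoC_minus. ring.
Qed.

(** The mean value theorem holds for the real and the imaginary part separately, whence
    the factor 2. *)
Lemma Cmod_increment_le (f df : C -> C) (a b : C) (K : R) :
  (forall t, (0 <= t <= 1)%R ->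
     C_is_derive f (a + RtoC t * (b - a)) (df (a + RtoC t * (b - a))) /\
     (Cmod (df (a + RtoC t * (b - a))%C) <= K)%R) ->
  (Cmod (f b - f a) <= 2 * K * Cmod (b - a))%R.
Proof.
  intros H.
  set (g := fun t => a + RtoC t * (b - a)).
  set (v := fun t => df (g t) * (b - a)).
  assert (Hd : forall t, (0 <= t <= 1)%R -> rder (fun s => f (g s)) t (v t)).
  { intros t Ht. apply rder_comp; [apply H; exact Ht|apply rder_line]. }
  assert (Hv : forall t, (0 <= t <= 1)%R -> (Cmod (v t) <= K * Cmod (b - a))%R).
  { intros t Ht. unfold v. rewrite Cmod_mult. apply Rmult_le_compat_r; [apply Cmod_ge_0|].
    apply H; exact Ht. }
  assert (Eb : g 1%R = b) by (unfold g; ring). assert (Ea : g 0%R = a) by (unfold g; ring).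
  assert (Hmv : forall F dF : R -> R, (forall t, (0 <= t <= 1)%R -> is_derive F t (dF t)) ->
    exists c, (0 <= c <= 1)%R /\ (F 1 - F 0 = dF c)%R).
  { intros F dF HF. destruct (MVT_gen F 0 1 dF) as [c [Hc Ec]].
    - intros t Ht. rewrite Rmin_left, Rmax_right in Ht by lra. apply HF; lra.
    - intros t Ht. rewrite Rmin_left, Rmax_right in Ht by lra. apply continuity_pt_filterlim.
      apply (ex_derive_continuous F). exists (dF t). apply HF, Ht.
    - rewrite Rmin_left, Rmax_right in Hc by lra. exists c. split; [exact Hc|lra]. }
  destruct (Hmv (fun s => Re (f (g s))) (fun s => Re (v s))) as [c [Hc Ec]].
  { intros t Ht. apply rder_Re_Im, Hd, Ht. }
  destruct (Hmv (fun s => Im (f (g s))) (fun s => Im (v s))) as [c' [Hc' Ec']].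
  { intros t Ht. apply rder_Re_Im, Hd, Ht. }
  rewrite Ea, Eb in Ec, Ec'.
  eapply Rle_trans; [apply Cmod_Rabs_le|].
  change (Re (f b - f a)) with (Re (f b) - Re (f a))%R.
  change (Im (f b - f a)) with (Im (f b) - Im (f a))%R.
  rewrite Ec, Ec'.
  pose proof (re_le_Cmod (v c)). pose proof (im_le_Cmod (v c')).
  pose proof (Hv c Hc). pose proof (Hv c' Hc'). lra.
Qed.

(** A double zero divided out: what removes the double poles of wp, both at 0 and where a
    critical point of wp meets a pole of its translate. *)
Lemma taylor_critical_zero (f f1 : C -> C) (a l : C) :
  f a = 0 -> f1 a = 0 -> nbhd a (fun z => C_is_derive f z (f1 z)) -> C_is_derive f1 a l ->
  exists psi, cont psi 0 /\ psi 0 = l / 2 /\ forall h, f (a + h) = h * h * psi h.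
Proof.
  intros Ha Ha1 Hd Hl.
  exists (fun h : C => if excluded_middle_informative (h = RtoC 0) then l / 2 else f (a + h) / (h * h)).
  split; [|split].
  - unfold cont. destruct (excluded_middle_informative (RtoC 0 = 0)) as [_|n]; [|tauto].
    intros e He. apply C_is_derive_caratheodory in Hl. destruct Hl as [phi [E [Hc Hf]]].
    assert (He4 : (0 < e / 4)%R) by lra.
    generalize (filter_and _ _ Hd (Hc _ He4)). intros H. apply nbhd_Cmod in H.
    destruct H as [d [Hd0 H]]. apply nbhd_Cmod. exists d. split; [exact Hd0|]. intros h Hh.
    replace (h - 0) with h in Hh by ring.
    destruct (excluded_middle_informative (h = RtoC 0)) as [E0|E0].
    { replace (l / 2 - l / 2) with (RtoC 0) by ring. rewrite Cmod_0. exact He. }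
    (* the derivative of [F] is [o(h)], hence [F (a + h)] is [o(h^2)] *)
    pose (F := fun z => f z - l / 2 * ((z - a) * (z - a))).
    assert (HF : (Cmod (F (a + h)%C - F a) <= 2 * (e / 4 * Cmod h) * Cmod (a + h - a))%R).
    { apply Cmod_increment_le with (df := fun z => f1 z - l * (z - a)). intros t Ht.
      replace (a + h - a) with h by ring.
      assert (Hb : (Cmod (RtoC t * h) <= Cmod h)%R).
      { rewrite Cmod_mult, Cmod_R, Rabs_pos_eq by lra. rewrite <- (Rmult_1_l (Cmod h)) at 2.
        apply Rmult_le_compat_r; [apply Cmod_ge_0|lra]. }
      destruct (H (a + RtoC t * h)) as [D1 D2].
      { replace (a + RtoC t * h - a) with (RtoC t * h) by ring. lra. }
      split.
      - unfold F. apply C_is_derive_minus; [exact D1|].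
        eapply C_is_derive_val; [|apply C_is_derive_mult; [apply C_is_derive_const|apply C_is_derive_mult;
          (apply C_is_derive_minus; [apply C_is_derive_id|apply C_is_derive_const])]].
        cbv beta. field.
      - specialize (Hf (a + RtoC t * h)). rewrite Ha1 in Hf.
        replace (f1 (a + RtoC t * h) - 0) with (f1 (a + RtoC t * h)) in Hf by ring. rewrite Hf.
        rewrite E in D2.
        replace (phi (a + RtoC t * h) * (a + RtoC t * h - a) - l * (a + RtoC t * h - a))
          with ((phi (a + RtoC t * h) - l) * (RtoC t * h)) by ring.
        rewrite Cmod_mult. apply Rmult_le_compat; try apply Cmod_ge_0; lra. }
    replace (a + h - a) with h in HF by ring. unfold F in HF. rewrite Ha in HF.
    replace (f (a + h) - l / 2 * ((a + h - a) * (a + h - a)) - (0 - l / 2 * ((a - a) * (a - a))))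
      with (f (a + h) - l / 2 * (h * h)) in HF by ring.
    replace (f (a + h) / (h * h) - l / 2) with ((f (a + h) - l / 2 * (h * h)) * / (h * h))
      by (field; exact E0).
    rewrite Cmod_mult, Cmod_inv by (apply Cmult_neq_0; exact E0). rewrite Cmod_mult.
    apply Cmod_gt_0 in E0. assert (Hc2 : (0 < Cmod h * Cmod h)%R) by (apply Rmult_lt_0_compat; exact E0).
    apply Rmult_lt_reg_r with (Cmod h * Cmod h)%R; [exact Hc2|].
    rewrite Rmult_assoc, Rinv_l by lra.
    apply Rle_lt_trans with (e / 2 * (Cmod h * Cmod h))%R; [lra|].
    apply Rmult_lt_compat_r; lra.
  - destruct (excluded_middle_informative (RtoC 0 = 0)); tauto.
  - intros h. destruct (excluded_middle_informative (h = RtoC 0)) as [E0|E0].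
    + subst h. replace (a + 0) with a by ring. rewrite Ha. ring.
    + field. exact E0.
Qed.


(** * Sums over squares *)

(** Indexed in the same way as the partial sums of wp, which are thereby convertible to a [box]. *)
Definition zsum {G : AbelianMonoid} (N : nat) (g : Z -> G) : G :=
  sum_n (fun i => g (Z.of_nat i - Z.of_nat N)%Z) (2 * N).

Definition box {G : AbelianMonoid} (N : nat) (f : Z -> Z -> G) : G :=
  zsum N (fun m => zsum N (f m)).

Section Zsum.
Context {G : AbelianMonoid}.

Lemma zsum_ext (N : nat) (f g : Z -> G) : (forall m, f m = g m) -> zsum N f = zsum N g.
Proof. intros H. apply sum_n_ext. intros i. apply H. Qed.

Lemma zsum_0 (g : Z -> G) : zsum 0 g = g 0%Z.
Proof. unfold zsum. simpl. rewrite sum_O. reflexivity. Qed.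

Lemma zsum_S (N : nat) (g : Z -> G) :
  zsum (S N) g = plus (g (- Z.of_nat N - 1)%Z) (plus (zsum N g) (g (Z.of_nat N + 1)%Z)).
Proof.
  unfold zsum. replace (2 * S N)%nat with (S (S (2 * N))) by lia.
  unfold sum_n. rewrite sum_Sn_m by lia. f_equal; [f_equal; lia|].
  rewrite sum_n_Sm by lia. f_equal; [|f_equal; lia].
  rewrite <- sum_n_m_S. apply sum_n_m_ext. intros i. f_equal. lia.
Qed.

Lemma zsum_plus (N : nat) (f g : Z -> G) :
  zsum N (fun m => plus (f m) (g m)) = plus (zsum N f) (zsum N g).
Proof. apply sum_n_plus. Qed.

Lemma zsum_opp_index (N : nat) (g : Z -> G) : zsum N (fun m => g (- m)%Z) = zsum N g.
Proof.
  induction N as [|N IH]; [rewrite !zsum_0; reflexivity|].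
  rewrite !zsum_S, IH.
  replace (- (- Z.of_nat N - 1))%Z with (Z.of_nat N + 1)%Z by lia.
  replace (- (Z.of_nat N + 1))%Z with (- Z.of_nat N - 1)%Z by lia.
  rewrite plus_assoc, plus_comm. f_equal. apply plus_comm.
Qed.

Lemma zsum_zero (N : nat) : zsum N (fun _ => @zero G) = zero.
Proof.
  induction N as [|N IH]; [apply zsum_0|]. rewrite zsum_S, IH, !plus_zero_l. reflexivity.
Qed.

Lemma zsum_delta (N : nat) (a : G) : zsum N (fun m => if Z.eqb m 0 then a else zero) = a.
Proof.
  induction N as [|N IH]; [apply zsum_0|]. rewrite zsum_S, IH.
  destruct (Z.eqb_spec (- Z.of_nat N - 1) 0); [lia|].
  destruct (Z.eqb_spec (Z.of_nat N + 1) 0); [lia|].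
  rewrite plus_zero_l, plus_zero_r. reflexivity.
Qed.

Lemma box_ext (N : nat) (f g : Z -> Z -> G) : (forall m n, f m n = g m n) -> box N f = box N g.
Proof. intros H. apply zsum_ext. intros m. apply zsum_ext. apply H. Qed.

Lemma box_plus (N : nat) (f g : Z -> Z -> G) :
  box N (fun m n => plus (f m n) (g m n)) = plus (box N f) (box N g).
Proof.
  unfold box. rewrite <- zsum_plus. apply zsum_ext. intros m. apply zsum_plus.
Qed.

Lemma box_opp_index (N : nat) (f : Z -> Z -> G) :
  box N (fun m n => f (- m)%Z (- n)%Z) = box N f.
Proof.
  unfold box. rewrite <- (zsum_opp_index N (fun m => zsum N (f m))).
  apply zsum_ext. intros m. apply (zsum_opp_index N (f (- m)%Z)).
Qed.

Lemma box_delta (N : nat) (a : G) :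
  box N (fun m n => if (Z.eqb m 0 && Z.eqb n 0)%bool then a else zero) = a.
Proof.
  unfold box. transitivity (zsum N (fun m => if Z.eqb m 0 then a else zero)); [|apply zsum_delta].
  apply zsum_ext. intros m. destruct (Z.eqb m 0); simpl; [apply zsum_delta|apply zsum_zero].
Qed.

End Zsum.

Lemma zsum_morph {G H : AbelianMonoid} (phi : G -> H) (N : nat) (g : Z -> G) :
  (forall x y, phi (plus x y) = plus (phi x) (phi y)) ->
  phi (zsum N g) = zsum N (fun m => phi (g m)).
Proof.
  intros Hp. induction N as [|N IH]; [rewrite !zsum_0; reflexivity|].
  rewrite !zsum_S, !Hp, IH. reflexivity.
Qed.

Lemma box_morph {G H : AbelianMonoid} (phi : G -> H) (N : nat) (f : Z -> Z -> G) :
  (forall x y, phi (plus x y) = plus (phi x) (phi y)) ->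
  phi (box N f) = box N (fun m n => phi (f m n)).
Proof.
  intros Hp. unfold box. rewrite (zsum_morph phi) by exact Hp. apply zsum_ext.
  intros m. apply zsum_morph, Hp.
Qed.

Notation zsumR := (@zsum R_AbelianMonoid).
Notation boxR := (@box R_AbelianMonoid).
Notation zsumC := (@zsum C_AbelianMonoid).
Notation boxC := (@box C_AbelianMonoid).

Lemma zsumR_le (N : nat) (f g : Z -> R) : (forall m, f m <= g m)%R -> (zsumR N f <= zsumR N g)%R.
Proof.
  intros H. induction N as [|N IH]; [rewrite !zsum_0; apply H|].
  rewrite !zsum_S. change (@plus R_AbelianMonoid) with Rplus.
  pose proof (H (- Z.of_nat N - 1)%Z). pose proof (H (Z.of_nat N + 1)%Z). lra.
Qed.

Lemma boxR_le (N : nat) (f g : Z -> Z -> R) :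
  (forall m n, f m n <= g m n)%R -> (boxR N f <= boxR N g)%R.
Proof. intros H. apply zsumR_le. intros m. apply zsumR_le, H. Qed.

Lemma zsumR_incr (N : nat) (g : Z -> R) : (forall m, 0 <= g m)%R -> (zsumR N g <= zsumR (S N) g)%R.
Proof.
  intros H. rewrite zsum_S. change (@plus R_AbelianMonoid) with Rplus.
  pose proof (H (- Z.of_nat N - 1)%Z). pose proof (H (Z.of_nat N + 1)%Z). lra.
Qed.

Lemma zsumR_nonneg (N : nat) (g : Z -> R) : (forall m, 0 <= g m)%R -> (0 <= zsumR N g)%R.
Proof.
  intros H. induction N as [|N IH]; [rewrite zsum_0; apply H|].
  eapply Rle_trans; [exact IH|apply zsumR_incr, H].
Qed.

Lemma boxR_incr (N : nat) (f : Z -> Z -> R) :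
  (forall m n, 0 <= f m n)%R -> (boxR N f <= boxR (S N) f)%R.
Proof.
  intros H. unfold box. eapply Rle_trans.
  - apply zsumR_incr. intros m. apply zsumR_nonneg, H.
  - apply zsumR_le. intros m. apply zsumR_incr, H.
Qed.

Lemma zsumR_scal (N : nat) (k : R) (g : Z -> R) : zsumR N (fun m => k * g m)%R = (k * zsumR N g)%R.
Proof.
  symmetry. apply (zsum_morph (G := R_AbelianMonoid) (H := R_AbelianMonoid) (Rmult k)).
  intros x y. apply Rmult_plus_distr_l.
Qed.

Lemma boxR_scal (N : nat) (k : R) (g : Z -> Z -> R) :
  boxR N (fun m n => k * g m n)%R = (k * boxR N g)%R.
Proof.
  symmetry. apply (box_morph (G := R_AbelianMonoid) (H := R_AbelianMonoid) (Rmult k)).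
  intros x y. apply Rmult_plus_distr_l.
Qed.

Lemma zsumC_scal (N : nat) (k : C) (g : Z -> C) : zsumC N (fun m => k * g m) = k * zsumC N g.
Proof.
  symmetry. apply (zsum_morph (G := C_AbelianMonoid) (H := C_AbelianMonoid) (Cmult k)).
  intros x y. change (k * (x + y) = k * x + k * y). ring.
Qed.

Lemma boxC_scal (N : nat) (k : C) (g : Z -> Z -> C) :
  boxC N (fun m n => k * g m n) = k * boxC N g.
Proof.
  symmetry. apply (box_morph (G := C_AbelianMonoid) (H := C_AbelianMonoid) (Cmult k)).
  intros x y. change (k * (x + y) = k * x + k * y). ring.
Qed.

Lemma zsumC_minus (N : nat) (f g : Z -> C) :
  zsumC N (fun m => f m - g m) = zsumC N f - zsumC N g.
Proof.
  replace (zsumC N f - zsumC N g) with (zsumC N f + (- (1)) * zsumC N g) by ring.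
  rewrite <- zsumC_scal. rewrite <- (zsum_plus (G := C_AbelianMonoid)). apply zsum_ext. intros m.
  change (f m - g m = f m + - (1) * g m). ring.
Qed.

Lemma boxC_plus (N : nat) (f g : Z -> Z -> C) :
  boxC N (fun m n => f m n + g m n) = boxC N f + boxC N g.
Proof. apply (box_plus (G := C_AbelianMonoid)). Qed.

Lemma boxC_minus (N : nat) (f g : Z -> Z -> C) :
  boxC N (fun m n => f m n - g m n) = boxC N f - boxC N g.
Proof.
  replace (boxC N f - boxC N g) with (boxC N f + (- (1)) * boxC N g) by ring.
  rewrite <- boxC_scal, <- boxC_plus. apply box_ext. intros m n.
  change (f m n - g m n = f m n + - (1) * g m n). ring.
Qed.

Lemma Cmod_zsum_le (N : nat) (g : Z -> C) : (Cmod (zsumC N g) <= zsumR N (fun m => Cmod (g m)))%R.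
Proof.
  induction N as [|N IH]; [rewrite !zsum_0; apply Rle_refl|].
  rewrite !zsum_S. change (@plus R_AbelianMonoid) with Rplus. change (@plus C_AbelianMonoid) with Cplus.
  eapply Rle_trans; [apply Cmod_triangle|]. apply Rplus_le_compat_l.
  eapply Rle_trans; [apply Cmod_triangle|]. apply Rplus_le_compat_r. exact IH.
Qed.

Lemma Cmod_box_le (N : nat) (f : Z -> Z -> C) :
  (Cmod (boxC N f) <= boxR N (fun m n => Cmod (f m n)))%R.
Proof.
  unfold box. eapply Rle_trans; [apply Cmod_zsum_le|]. apply zsumR_le. intros m. apply Cmod_zsum_le.
Qed.

Lemma zsumC_telescope (N : nat) (a : Z -> C) :
  zsumC N (fun m => a (m - 1)%Z - a m) = a (- Z.of_nat N - 1)%Z - a (Z.of_nat N).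
Proof.
  induction N as [|N IH]; [rewrite !zsum_0; reflexivity|].
  rewrite zsum_S, IH. change (@plus C_AbelianMonoid) with Cplus.
  replace (- Z.of_nat (S N) - 1)%Z with (- Z.of_nat N - 1 - 1)%Z by lia.
  replace (Z.of_nat (S N)) with (Z.of_nat N + 1)%Z by lia.
  replace (Z.of_nat N + 1 - 1)%Z with (Z.of_nat N) by lia.
  match goal with |- ?x = ?y => change (@eq C x y) end. ring.
Qed.

(** Lattice terms decay like the cube of the distance, and
    [(1 + |m|) (1 + |n|) <= (1 + |m| + |n|)^2].  The exponent 3/2 in each variable is thus
    dominated by a product, and it exceeds 1. *)
Definition weight1 (m : Z) : R := (/ ((1 + Rabs (IZR m)) * sqrt (1 + Rabs (IZR m))))%R.
Definition weight (m n : Z) : R := (weight1 m * weight1 n)%R.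

Lemma weight1_pos (m : Z) : (0 < weight1 m)%R.
Proof.
  unfold weight1. pose proof (Rabs_pos (IZR m)). apply Rinv_0_lt_compat, Rmult_lt_0_compat; [lra|].
  apply sqrt_lt_R0. lra.
Qed.

Lemma weight_pos (m n : Z) : (0 < weight m n)%R.
Proof. apply Rmult_lt_0_compat; apply weight1_pos. Qed.

(** Telescoping: [1 / (k sqrt k) <= 2 (1 / sqrt (k - 1) - 1 / sqrt k)]. *)
Lemma zsum_weight1_le (N : nat) : (zsumR N weight1 <= 5 - 4 / sqrt (1 + INR N))%R.
Proof.
  induction N as [|N IH].
  - rewrite zsum_0. unfold weight1. rewrite Rabs_R0. simpl INR.
    replace (1 + 0)%R with 1%R by ring. rewrite sqrt_1. lra.
  - rewrite zsum_S. change (@plus R_AbelianMonoid) with Rplus.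
    assert (E1 : weight1 (- Z.of_nat N - 1) = weight1 (Z.of_nat N + 1)).
    { unfold weight1. f_equal. replace (- Z.of_nat N - 1)%Z with (- (Z.of_nat N + 1))%Z by lia.
      rewrite opp_IZR, Rabs_Ropp. reflexivity. }
    rewrite E1.
    assert (E2 : weight1 (Z.of_nat N + 1) = (/ ((1 + INR (S N)) * sqrt (1 + INR (S N))))%R).
    { unfold weight1. rewrite plus_IZR, <- INR_IZR_INZ, S_INR.
      pose proof (pos_INR N). rewrite Rabs_pos_eq by lra. reflexivity. }
    rewrite E2. rewrite S_INR in *. pose proof (pos_INR N) as HN.
    set (p := sqrt (1 + INR N)) in *. set (q := sqrt (1 + (INR N + 1))).
    assert (Hp : (0 < p)%R) by (apply sqrt_lt_R0; lra).
    assert (Hq : (0 < q)%R) by (apply sqrt_lt_R0; lra).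
    assert (Hpp : (p * p = 1 + INR N)%R) by (apply sqrt_sqrt; lra).
    assert (Hqq : (q * q = 1 + (INR N + 1))%R) by (apply sqrt_sqrt; lra).
    assert (Hpq : (p <= q)%R) by (apply sqrt_le_1; lra).
    rewrite <- Hqq.
    assert (Hk : (/ (q * q * q) <= 2 * (1 / p - 1 / q))%R).
    { replace (2 * (1 / p - 1 / q))%R with (2 * (q * q - p * p) / (p * q * (p + q)))%R
        by (field; lra).
      replace (q * q - p * p)%R with 1%R by lra.
      unfold Rdiv. rewrite Rmult_1_r.
      apply Rmult_le_reg_l with (q * q * q)%R; [repeat apply Rmult_lt_0_compat; assumption|].
      rewrite Rinv_r by (apply Rgt_not_eq; repeat apply Rmult_lt_0_compat; assumption).
      assert (Hpos : (0 < p * q * (p + q))%R) by (repeat apply Rmult_lt_0_compat; lra).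
      apply Rmult_le_reg_r with (p * q * (p + q))%R; [exact Hpos|].
      replace (q * q * q * (2 * / (p * q * (p + q))) * (p * q * (p + q)))%R
        with (2 * (q * q * q))%R by (field; lra).
      nra. }
    lra.
Qed.

Lemma box_weight_le (N : nat) : (boxR N weight <= 25)%R.
Proof.
  assert (E : boxR N weight = (zsumR N weight1 * zsumR N weight1)%R).
  { unfold box, weight. rewrite <- zsumR_scal. apply zsum_ext. intros m. rewrite zsumR_scal. apply Rmult_comm. }
  rewrite E. pose proof (zsum_weight1_le N) as H.
  assert (H0 : (0 <= zsumR N weight1)%R) by (apply zsumR_nonneg; intros; apply Rlt_le, weight1_pos).
  assert (0 < / sqrt (1 + INR N))%R.
  { apply Rinv_0_lt_compat, sqrt_lt_R0. pose proof (pos_INR N). lra. }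
  assert (zsumR N weight1 <= 5)%R by lra. nra.
Qed.

Lemma weight_ge_cube (m n : Z) (s : R) :
  s = (1 + Rabs (IZR m) + Rabs (IZR n))%R -> (/ (s * s * s) <= weight m n)%R.
Proof.
  intros ->. unfold weight, weight1.
  set (a := Rabs (IZR m)). set (b := Rabs (IZR n)).
  assert (Ha : (0 <= a)%R) by apply Rabs_pos. assert (Hb : (0 <= b)%R) by apply Rabs_pos.
  rewrite <- Rinv_mult. apply Rinv_le_contravar.
  - repeat apply Rmult_lt_0_compat; try lra; apply sqrt_lt_R0; lra.
  - replace ((1 + a) * sqrt (1 + a) * ((1 + b) * sqrt (1 + b)))%R
      with (((1 + a) * (1 + b)) * (sqrt (1 + a) * sqrt (1 + b)))%R by ring.
    rewrite <- sqrt_mult by lra.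
    assert (Hle : ((1 + a) * (1 + b) <= (1 + a + b) * (1 + a + b))%R) by nra.
    assert (Hs : (sqrt ((1 + a) * (1 + b)) <= 1 + a + b)%R).
    { rewrite <- (sqrt_square (1 + a + b)) by lra. apply sqrt_le_1_alt. exact Hle. }
    apply Rmult_le_compat; try assumption; [nra|apply sqrt_pos].
Qed.

(** Adding the dominating weight makes the terms nonnegative, and then the sums over
    growing squares are monotone and bounded. *)
Lemma boxR_dominated_cv (f : Z -> Z -> R) (K : R) :
  (forall m n, Rabs (f m n) <= K * weight m n)%R -> ex_finite_lim_seq (fun N => boxR N f).
Proof.
  intros H.
  assert (Hcv : forall g : Z -> Z -> R, (forall m n, 0 <= g m n <= 2 * K * weight m n)%R ->
    ex_finite_lim_seq (fun N => boxR N g)).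
  { intros g Hg. apply ex_finite_lim_seq_incr with (2 * K * 25)%R.
    - intros N. apply boxR_incr. intros m n. apply Hg.
    - intros N. apply Rle_trans with (boxR N (fun m n => 2 * K * weight m n))%R.
      + apply boxR_le. intros m n. apply Hg.
      + rewrite boxR_scal. apply Rmult_le_compat_l; [|apply box_weight_le].
        pose proof (Hg 0%Z 0%Z). pose proof (weight_pos 0 0). nra. }
  destruct (Hcv (fun m n => K * weight m n + f m n)%R) as [l1 H1].
  { intros m n. specialize (H m n). apply Rabs_le_between in H. lra. }
  destruct (Hcv (fun m n => K * weight m n)%R) as [l2 H2].
  { intros m n. specialize (H m n). pose proof (Rabs_pos (f m n)). lra. }
  exists (l1 - l2)%R.
  apply is_lim_seq_ext with (fun N => boxR N (fun m n => K * weight m n + f m n)%R - boxR N (fun m n => K * weight m n)%R)%R.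
  - intros N. pose proof (box_plus (G := R_AbelianMonoid) N (fun m n => K * weight m n)%R f) as E.
    change (@plus R_AbelianMonoid) with Rplus in E. rewrite E. ring.
  - apply is_lim_seq_minus'; assumption.
Qed.

Lemma boxC_dominated_cv (f : Z -> Z -> C) (K : R) :
  (forall m n, Cmod (f m n) <= K * weight m n)%R -> exists l, tends eventually (fun N => boxC N f) l.
Proof.
  intros H.
  destruct (boxR_dominated_cv (fun m n => Re (f m n)) K) as [a Ha].
  { intros m n. eapply Rle_trans; [apply re_le_Cmod|apply H]. }
  destruct (boxR_dominated_cv (fun m n => Im (f m n)) K) as [b Hb].
  { intros m n. eapply Rle_trans; [apply im_le_Cmod|apply H]. }
  exists (a, b). apply (tends_Re_Im eventually). split.
  - apply filterlim_ext with (2 := Ha). intros N. symmetry.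
    apply (box_morph (G := C_AbelianMonoid) (H := R_AbelianMonoid) Re). reflexivity.
  - apply filterlim_ext with (2 := Hb). intros N. symmetry.
    apply (box_morph (G := C_AbelianMonoid) (H := R_AbelianMonoid) Im). reflexivity.
Qed.

Lemma boxC_dominated_le (N : nat) (f : Z -> Z -> C) (K : R) :
  (forall m n, Cmod (f m n) <= K * weight m n)%R -> (Cmod (boxC N f) <= 25 * K)%R.
Proof.
  intros H. eapply Rle_trans; [apply Cmod_box_le|].
  apply Rle_trans with (boxR N (fun m n => K * weight m n))%R; [apply boxR_le, H|].
  rewrite boxR_scal, Rmult_comm. apply Rmult_le_compat_r; [|apply box_weight_le].
  pose proof (H 0%Z 0%Z). pose proof (Cmod_ge_0 (f 0%Z 0%Z)). pose proof (weight_pos 0 0). nra.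
Qed.

Lemma tends_Cmod_le {T : Type} (F : (T -> Prop) -> Prop) {FF : ProperFilter F} (f : T -> C) (l : C) (K : R) :
  (forall x, Cmod (f x) <= K)%R -> tends F f l -> (Cmod l <= K)%R.
Proof.
  intros H Hl. apply Rnot_lt_le. intros Hlt.
  assert (He : (0 < Cmod l - K)%R) by lra.
  destruct (filter_ex _ (Hl _ He)) as [x Hx].
  pose proof (Cmod_triangle (f x) (- (f x - l))) as Ht. rewrite Cmod_opp in Ht.
  replace (f x + - (f x - l)) with l in Ht by ring. specialize (H x). lra.
Qed.


(** * The lattice *)

Definition in_lattice (tau z : C) : Prop := exists m n : Z, z = lattice_pt tau m n.

Lemma tau_coordinates (tau z : C) : (0 < Im tau)%R ->
  exists a b : R, z = RtoC a + RtoC b * tau.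
Proof.
  intros H. exists (Re z - Im z / Im tau * Re tau)%R, (Im z / Im tau)%R.
  destruct z as [x y], tau as [p q]. unfold RtoC, Cplus, Cmult, Re, Im in *; simpl in *.
  f_equal; field; lra.
Qed.

(** The real coordinates in the basis 1, tau are controlled by the modulus. *)
Lemma tau_norm_lower (tau : C) : (0 < Im tau)%R ->
  exists c : R, (0 < c)%R /\
    forall x y : R, (c * (Rabs x + Rabs y) <= Cmod (RtoC x + RtoC y * tau))%R.
Proof.
  intros H. set (A := (1 + (1 + Rabs (Re tau)) / Im tau)%R).
  pose proof (Rabs_pos (Re tau)) as Hr.
  assert (Hq : (0 < (1 + Rabs (Re tau)) / Im tau)%R) by (apply Rdiv_lt_0_compat; lra).
  assert (HA : (0 < A)%R) by (unfold A; lra).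
  exists (/ A)%R. split; [apply Rinv_0_lt_compat, HA|].
  intros x y. set (v := RtoC x + RtoC y * tau).
  assert (Hy : (Rabs y * Im tau <= Cmod v)%R).
  { rewrite <- (Rabs_pos_eq (Im tau)) at 1 by lra. rewrite <- Rabs_mult.
    eapply Rle_trans; [|apply im_le_Cmod]. right. f_equal. unfold v.
    destruct tau; unfold RtoC, Cplus, Cmult, Im; simpl. ring. }
  assert (Hx : (Rabs x <= Cmod v + Rabs y * Rabs (Re tau))%R).
  { pose proof (re_le_Cmod v) as Hv. rewrite <- Rabs_mult.
    replace x with (Re v + - (y * Re tau))%R.
    - eapply Rle_trans; [apply Rabs_triang|]. rewrite Rabs_Ropp. lra.
    - unfold v. destruct tau; unfold RtoC, Cplus, Cmult, Re; simpl. ring. }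
  assert (Hy' : (Rabs y <= Cmod v / Im tau)%R).
  { apply Rmult_le_reg_r with (Im tau); [exact H|]. unfold Rdiv. rewrite Rmult_assoc, Rinv_l by lra. lra. }
  apply Rmult_le_reg_l with A; [exact HA|]. rewrite <- Rmult_assoc, Rinv_r, Rmult_1_l by lra.
  replace (A * Cmod v)%R with (Cmod v + Cmod v / Im tau * Rabs (Re tau) + Cmod v / Im tau)%R
    by (unfold A; field; lra).
  pose proof (Rmult_le_compat_r _ _ _ Hr Hy'). lra.
Qed.

(** The bound grows with the index, so that it serves at once for the terms near [z] and for
    the decay of the tail; [D] selects the lattice points that count. *)
Definition separated (tau : C) (D : Z -> Z -> Prop) (z : C) : Prop :=
  exists c : R, (0 < c)%R /\ forall m n, D m n ->
    (c * (1 + Rabs (IZR m) + Rabs (IZR n)) <= Cmod (z - lattice_pt tau m n))%R.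

Definition all_index (m n : Z) : Prop := True.
Definition nonzero_index (m n : Z) : Prop := (m, n) <> (0, 0)%Z.

Lemma separated_open (tau : C) (D : Z -> Z -> Prop) (z : C) (c : R) : (0 < c)%R ->
  (forall m n, D m n ->
    (c * (1 + Rabs (IZR m) + Rabs (IZR n)) <= Cmod (z - lattice_pt tau m n))%R) ->
  forall y, (Cmod (y - z) <= c / 2)%R -> forall m n, D m n ->
    (c / 2 * (1 + Rabs (IZR m) + Rabs (IZR n)) <= Cmod (y - lattice_pt tau m n))%R.
Proof.
  intros Hc H y Hy m n Hmn. specialize (H m n Hmn).
  pose proof (Cmod_triangle (y - lattice_pt tau m n) (- (y - z))) as Ht.
  rewrite Cmod_opp in Ht.
  replace (y - lattice_pt tau m n + - (y - z)) with (z - lattice_pt tau m n) in Ht by ring.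
  pose proof (Rabs_pos (IZR m)). pose proof (Rabs_pos (IZR n)). nra.
Qed.

Lemma separated_nbhd (tau : C) (D : Z -> Z -> Prop) (z : C) :
  separated tau D z -> nbhd z (separated tau D).
Proof.
  intros [c [Hc H]]. apply nbhd_Cmod. exists (c / 2)%R. split; [lra|].
  intros y Hy. exists (c / 2)%R. split; [lra|].
  apply separated_open with z; [exact Hc|exact H|lra].
Qed.

(** A fixed gap decides for the small indices, linear growth for the large ones; the
    constant interpolates between them. *)
Lemma separated_from_gap (tau : C) (D : Z -> Z -> Prop) (a b d : R) : (0 < Im tau)%R -> (0 < d)%R ->
  (forall m n, D m n -> (d <= Rabs (a - IZR m) + Rabs (b - IZR n))%R) ->
  separated tau D (RtoC a + RtoC b * tau).
Proof.
  intros Htau Hd H. destruct (tau_norm_lower tau Htau) as [c0 [Hc0 Hlow]].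
  set (A := (Rabs a + Rabs b)%R).
  assert (HA : (0 <= A)%R) by (unfold A; pose proof (Rabs_pos a); pose proof (Rabs_pos b); lra).
  exists (c0 * (d / (1 + A + d)))%R.
  assert (Hq : (0 < d / (1 + A + d))%R) by (apply Rdiv_lt_0_compat; lra).
  split; [apply Rmult_lt_0_compat; assumption|].
  intros m n Hmn. specialize (H m n Hmn).
  replace (RtoC a + RtoC b * tau - lattice_pt tau m n)
    with (RtoC (a - IZR m) + RtoC (b - IZR n) * tau)
    by (unfold lattice_pt; rewrite !RtoC_minus; ring).
  eapply Rle_trans; [|apply Hlow]. rewrite Rmult_assoc. apply Rmult_le_compat_l; [lra|].
  set (L := (Rabs (a - IZR m) + Rabs (b - IZR n))%R) in *.
  assert (HL : (Rabs (IZR m) + Rabs (IZR n) <= L + A)%R).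
  { unfold L, A. pose proof (Rabs_triang a (- (a - IZR m))) as T1.
    pose proof (Rabs_triang b (- (b - IZR n))) as T2. rewrite !Rabs_Ropp in T1, T2.
    replace (a + - (a - IZR m))%R with (IZR m) in T1 by ring.
    replace (b + - (b - IZR n))%R with (IZR n) in T2 by ring. lra. }
  apply Rmult_le_reg_r with (1 + A + d)%R; [lra|].
  replace (d / (1 + A + d) * (1 + Rabs (IZR m) + Rabs (IZR n)) * (1 + A + d))%R
    with (d * (1 + (Rabs (IZR m) + Rabs (IZR n))))%R by (field; lra).
  nra.
Qed.

Lemma IZR_gap (a : R) : (forall m : Z, a <> IZR m) ->
  exists d : R, (0 < d)%R /\ forall m, (d <= Rabs (a - IZR m))%R.
Proof.
  intros H. destruct (archimed a) as [H1 H2]. set (k := up a) in *.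
  pose proof (H (k - 1)%Z) as H3. rewrite minus_IZR in H3.
  exists (Rmin (IZR k - a) (a - (IZR k - 1))). split; [apply Rmin_pos; lra|].
  intros m. destruct (Z_lt_le_dec m k) as [L|L].
  - assert (m <= k - 1)%Z as L' by lia. apply IZR_le in L'. rewrite minus_IZR in L'.
    eapply Rle_trans; [apply Rmin_r|]. rewrite Rabs_pos_eq; lra.
  - apply IZR_le in L. eapply Rle_trans; [apply Rmin_l|]. rewrite Rabs_left1; lra.
Qed.

Lemma separated_off_lattice (tau z : C) : (0 < Im tau)%R ->
  ~ in_lattice tau z -> separated tau all_index z.
Proof.
  intros Htau Hz. destruct (tau_coordinates tau z Htau) as [a [b E]]. subst z.
  destruct (classic (exists m, a = IZR m)) as [[m Em]|Ha].
  - destruct (classic (exists n, b = IZR n)) as [[n En]|Hb].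
    + exfalso. apply Hz. exists m, n. subst. reflexivity.
    + destruct (IZR_gap b) as [d [Hd H]]. { intros n En. apply Hb. exists n. exact En. }
      apply separated_from_gap with d; try assumption. intros m' n _. specialize (H n).
      pose proof (Rabs_pos (a - IZR m')). lra.
  - destruct (IZR_gap a) as [d [Hd H]]. { intros n En. apply Ha. exists n. exact En. }
    apply separated_from_gap with d; try assumption. intros m n _. specialize (H m).
    pose proof (Rabs_pos (b - IZR n)). lra.
Qed.

Lemma separated_off_not_in (tau z : C) : separated tau all_index z -> ~ in_lattice tau z.
Proof.
  intros [c [Hc H]] [m [n E]]. specialize (H m n I). subst z.
  replace (lattice_pt tau m n - lattice_pt tau m n) with (RtoC 0) in H by ring. rewrite Cmod_0 in H.
  pose proof (Rabs_pos (IZR m)). pose proof (Rabs_pos (IZR n)). nra.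
Qed.

Lemma separated_zero (tau : C) : (0 < Im tau)%R -> separated tau nonzero_index 0.
Proof.
  intros Htau. replace (RtoC 0) with (RtoC 0 + RtoC 0 * tau) by ring.
  apply separated_from_gap with 1%R; [exact Htau|lra|].
  intros m n Hmn.
  assert (Hz : forall k : Z, k <> 0%Z -> (1 <= Rabs (0 - IZR k))%R).
  { intros k Hk. rewrite Rminus_0_l, Rabs_Ropp, <- abs_IZR. apply IZR_le. lia. }
  pose proof (Rabs_pos (0 - IZR m)). pose proof (Rabs_pos (0 - IZR n)).
  destruct (Z.eq_dec m 0) as [Em|Em].
  - destruct (Z.eq_dec n 0) as [En|En]; [subst; exfalso; apply Hmn; reflexivity|].
    specialize (Hz n En). lra.
  - specialize (Hz m Em). lra.
Qed.

Lemma separated_weaken (tau z : C) (D : Z -> Z -> Prop) :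
  separated tau all_index z -> separated tau D z.
Proof. intros [c [Hc H]]. exists c. split; [exact Hc|]. intros m n _. apply H. exact I. Qed.

Lemma in_lattice_zero (tau : C) : in_lattice tau 0.
Proof. exists 0%Z, 0%Z. unfold lattice_pt. ring. Qed.

Lemma in_lattice_one (tau : C) : in_lattice tau 1.
Proof. exists 1%Z, 0%Z. unfold lattice_pt. ring. Qed.

Lemma in_lattice_tau (tau : C) : in_lattice tau tau.
Proof. exists 0%Z, 1%Z. unfold lattice_pt. ring. Qed.

Lemma in_lattice_plus (tau a b : C) : in_lattice tau a -> in_lattice tau b -> in_lattice tau (a + b).
Proof.
  intros [m [n E]] [m' [n' E']]. exists (m + m')%Z, (n + n')%Z. subst.
  unfold lattice_pt. rewrite !plus_IZR, !RtoC_plus. ring.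
Qed.

Lemma in_lattice_opp (tau a : C) : in_lattice tau a -> in_lattice tau (- a).
Proof.
  intros [m [n E]]. exists (- m)%Z, (- n)%Z. subst.
  unfold lattice_pt. rewrite !opp_IZR, !RtoC_opp. ring.
Qed.

Lemma in_lattice_minus (tau a b : C) : in_lattice tau a -> in_lattice tau b -> in_lattice tau (a - b).
Proof. intros Ha Hb. apply in_lattice_plus; [exact Ha|apply in_lattice_opp, Hb]. Qed.

Lemma in_lattice_shift (tau a z : C) : in_lattice tau a -> in_lattice tau (z + a) <-> in_lattice tau z.
Proof.
  intros Ha. split; intros H.
  - replace z with (z + a - a) by ring. apply in_lattice_minus; assumption.
  - apply in_lattice_plus; assumption.
Qed.

(** * The regular part of the lattice sums *)

(** These are [(-1)^j (j+1)!], which makes [reg_term tau (S j)] the derivative of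
    [reg_term tau j]. *)
Fixpoint deriv_coeff (j : nat) : C :=
  match j with O => 1 | S i => - RtoC (INR (i + 2)) * deriv_coeff i end.

Definition reg_term (tau : C) (j : nat) (z : C) (m n : Z) : C :=
  if (Z.eqb m 0 && Z.eqb n 0)%bool then 0
  else deriv_coeff j * / ((z - lattice_pt tau m n) ^ (j + 2))
       - match j with O => / (lattice_pt tau m n * lattice_pt tau m n) | S _ => 0 end.

(** The [j]-th derivative of [wp - 1/z^2], regular at 0 since the term of index (0,0) is
    left out. *)
Definition wp_reg (tau : C) (j : nat) (z : C) : C :=
  iota (T := C_CompleteNormedModule)
    (fun l : C => filterlim (fun N => boxC N (reg_term tau j z)) eventually
                            (locally (T := C_UniformSpace) l)).

Lemma index_cases (m n : Z) :
  ((Z.eqb m 0 && Z.eqb n 0)%bool = true /\ m = 0%Z /\ n = 0%Z) \/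
  ((Z.eqb m 0 && Z.eqb n 0)%bool = false /\ nonzero_index m n).
Proof.
  destruct (Z.eqb_spec m 0), (Z.eqb_spec n 0); simpl; subst; auto; right; split; auto; intros E;
    injection E; auto.
Qed.

Lemma C_is_derive_inv_pow (a : C) (k : nat) (z : C) : z - a <> 0 ->
  C_is_derive (fun y => / ((y - a) ^ (S k))) z (- RtoC (INR (S k)) * / ((z - a) ^ (S (S k)))).
Proof.
  intros Hz.
  assert (Hid : C_is_derive (fun y => y - a) z 1).
  { eapply C_is_derive_val; [|apply C_is_derive_minus; [apply C_is_derive_id|apply C_is_derive_const]]. ring. }
  assert (Hp : C_is_derive (fun y => (y - a) ^ (S k)) z (RtoC (INR (S k)) * (z - a) ^ k)).
  { clear Hz. induction k as [|k IH].
    - simpl. eapply C_is_derive_val; [|apply C_is_derive_mult; [exact Hid|apply C_is_derive_const]].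
      simpl. ring.
    - rewrite S_INR, RtoC_plus.
      eapply C_is_derive_val; [|apply (C_is_derive_mult _ (fun y => (y - a) ^ S k)); [exact Hid|exact IH]].
      cbv beta. simpl Cpow. ring. }
  eapply C_is_derive_val; [|apply (C_is_derive_inv (fun y => (y - a) ^ (S k))); [apply Cpow_nz, Hz|exact Hp]].
  pose proof (Cpow_nz (z - a) k Hz). simpl Cpow. field. split; assumption.
Qed.

Section Regular.
Variable tau : C.
Hypothesis Htau : (0 < Im tau)%R.

Lemma reg_term_derive (j : nat) (z : C) (m n : Z) :
  (nonzero_index m n -> z - lattice_pt tau m n <> 0) ->
  C_is_derive (fun y => reg_term tau j y m n) z (reg_term tau (S j) z m n).
Proof.
  intros Hz. unfold reg_term. destruct (index_cases m n) as [[E _]|[E Hn]]; rewrite E.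
  - apply C_is_derive_const.
  - specialize (Hz Hn). apply C_is_derive_minus; [|apply C_is_derive_const].
    replace (j + 2)%nat with (S (S j)) by lia. replace (S j + 2)%nat with (S (S (S j))) by lia.
    eapply C_is_derive_val; [|apply C_is_derive_mult; [apply C_is_derive_const|apply C_is_derive_inv_pow, Hz]].
    cbv beta. cbn [deriv_coeff]. replace (j + 2)%nat with (S (S j)) by lia. ring.
Qed.

Lemma reg_term_bound (j : nat) (c : R) : (0 < c)%R ->
  exists K : R, (0 <= K)%R /\ forall z m n,
    (nonzero_index m n -> c * (1 + Rabs (IZR m) + Rabs (IZR n)) <= Cmod (z - lattice_pt tau m n))%R ->
    (Cmod (reg_term tau (S j) z m n) <= K * weight m n)%R.
Proof.
  intros Hc. set (A := Cmod (deriv_coeff (S j))). exists (A * / c ^ (S j + 2))%R.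
  assert (HA : (0 <= A)%R) by apply Cmod_ge_0.
  assert (Hck : (0 < c ^ (S j + 2))%R) by (apply pow_lt, Hc).
  split; [apply Rmult_le_pos; [exact HA|apply Rlt_le, Rinv_0_lt_compat, Hck]|].
  intros z m n Hz. unfold reg_term. destruct (index_cases m n) as [[E _]|[E Hn]]; rewrite E.
  - rewrite Cmod_0. apply Rmult_le_pos; [|apply Rlt_le, weight_pos].
    apply Rmult_le_pos; [exact HA|apply Rlt_le, Rinv_0_lt_compat, Hck].
  - specialize (Hz Hn). set (s := (1 + Rabs (IZR m) + Rabs (IZR n))%R) in *.
    assert (Hs : (1 <= s)%R) by (unfold s; pose proof (Rabs_pos (IZR m)); pose proof (Rabs_pos (IZR n)); lra).
    assert (Hcs : (0 < c * s)%R) by (apply Rmult_lt_0_compat; lra).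
    assert (Hnz : z - lattice_pt tau m n <> 0) by (apply Cmod_gt_0; lra).
    match goal with |- (Cmod (?x - ?y) <= _)%R => replace (x - y) with x by ring end.
    rewrite Cmod_mult, Cmod_inv, Cmod_pow by (apply Cpow_nz, Hnz). fold A.
    rewrite Rmult_assoc. apply Rmult_le_compat_l; [exact HA|].
    apply Rle_trans with (/ (c * s) ^ (S j + 2))%R.
    + apply Rinv_le_contravar; [apply pow_lt, Hcs|]. apply pow_incr. lra.
    + rewrite Rpow_mult_distr, Rinv_mult. apply Rmult_le_compat_l; [apply Rlt_le, Rinv_0_lt_compat, Hck|].
      eapply Rle_trans; [|apply (weight_ge_cube m n s); reflexivity].
      apply Rinv_le_contravar; [repeat apply Rmult_lt_0_compat; lra|].
      replace (s * s * s)%R with (s ^ 3)%R by ring. apply Rle_pow; [exact Hs|lia].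
Qed.

(** Only the subtraction of [1/l^2] makes the terms decay like the cube:
    [1/(z-l)^2 - 1/l^2 = z (2l - z) / (l^2 (z-l)^2)]. *)
Lemma reg_term0_bound (z : C) : separated tau nonzero_index z ->
  exists K : R, forall m n, (Cmod (reg_term tau 0 z m n) <= K * weight m n)%R.
Proof.
  intros [c [Hc Hz]]. destruct (separated_zero tau Htau) as [c0 [Hc0 H0]].
  pose proof (Cmod_ge_0 z) as Hz0. pose proof (Cmod_ge_0 tau) as Ht0.
  set (B := (2 * (1 + Cmod tau) + Cmod z)%R).
  set (K := (Cmod z * B * / (c0 * c0 * (c * c)))%R).
  assert (Hcc : (0 < c0 * c0 * (c * c))%R) by (repeat apply Rmult_lt_0_compat; assumption).
  assert (HK : (0 <= K)%R).
  { apply Rmult_le_pos; [|apply Rlt_le, Rinv_0_lt_compat, Hcc]. apply Rmult_le_pos; unfold B; lra. }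
  exists K. intros m n. unfold reg_term.
  destruct (index_cases m n) as [[E _]|[E Hn]]; rewrite E.
  { rewrite Cmod_0. apply Rmult_le_pos; [exact HK|apply Rlt_le, weight_pos]. }
  specialize (Hz m n Hn). specialize (H0 m n Hn).
  set (s := (1 + Rabs (IZR m) + Rabs (IZR n))%R) in *. set (l := lattice_pt tau m n) in *.
  pose proof (Rabs_pos (IZR m)) as Hm. pose proof (Rabs_pos (IZR n)) as Hn'.
  assert (Hs : (1 <= s)%R) by (unfold s; lra).
  replace (Cmod (0 - l)) with (Cmod l) in H0 by (rewrite <- (Cmod_opp l); f_equal; ring).
  assert (Hl : l <> 0) by (apply Cmod_gt_0; nra).
  assert (Hzl : z - l <> 0) by (apply Cmod_gt_0; nra).
  simpl Cpow. cbn [deriv_coeff].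
  replace (1 * / ((z - l) * ((z - l) * 1)) - / (l * l))
    with ((z * (2 * l - z)) * / (l * l * ((z - l) * (z - l)))) by (field; split; assumption).
  rewrite Cmod_mult, Cmod_inv by (repeat apply Cmult_neq_0; assumption). rewrite !Cmod_mult.
  assert (Hup : (Cmod (2 * l - z) <= B * s)%R).
  { eapply Rle_trans; [apply Cmod_triangle|]. rewrite Cmod_opp, Cmod_mult, Cmod_R.
    rewrite (Rabs_pos_eq 2) by lra.
    assert (Cmod l <= s * (1 + Cmod tau))%R.
    { unfold l, lattice_pt. eapply Rle_trans; [apply Cmod_triangle|]. rewrite Cmod_mult, !Cmod_R.
      unfold s. nra. }
    unfold B. nra. }
  assert (Hden : (c0 * c0 * (c * c) * (s * s * s * s) <= Cmod l * Cmod l * (Cmod (z - l) * Cmod (z - l)))%R).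
  { replace (c0 * c0 * (c * c) * (s * s * s * s))%R with ((c0 * s) * (c0 * s) * ((c * s) * (c * s)))%R by ring.
    assert (0 <= c0 * s)%R by nra. assert (0 <= c * s)%R by nra.
    repeat first [assumption | apply Rmult_le_compat | apply Rmult_le_pos]. }
  assert (Hsss : (0 < s * s * s * s)%R) by (repeat apply Rmult_lt_0_compat; lra).
  apply Rle_trans with (Cmod z * (B * s) * / (c0 * c0 * (c * c) * (s * s * s * s)))%R.
  - apply Rmult_le_compat.
    + apply Rmult_le_pos; apply Cmod_ge_0.
    + apply Rlt_le, Rinv_0_lt_compat. eapply Rlt_le_trans; [|exact Hden]. apply Rmult_lt_0_compat; assumption.
    + apply Rmult_le_compat_l; assumption.
    + apply Rinv_le_contravar; [apply Rmult_lt_0_compat; assumption|exact Hden].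
  - replace (Cmod z * (B * s) * / (c0 * c0 * (c * c) * (s * s * s * s)))%R
      with (K * / (s * s * s))%R by (unfold K; field; repeat split; lra).
    apply Rmult_le_compat_l; [exact HK|]. apply weight_ge_cube. reflexivity.
Qed.

Lemma wp_reg_lim (j : nat) (z : C) : separated tau nonzero_index z ->
  tends eventually (fun N => boxC N (reg_term tau j z)) (wp_reg tau j z).
Proof.
  intros Hz.
  assert (H : exists K : R, forall m n, (Cmod (reg_term tau j z m n) <= K * weight m n)%R).
  { destruct j as [|j]; [apply reg_term0_bound, Hz|]. destruct Hz as [c [Hc Hz]].
    destruct (reg_term_bound j c Hc) as [K [_ HK]]. exists K. intros m n. apply HK. apply Hz. }
  destruct H as [K HK]. destruct (boxC_dominated_cv _ K HK) as [l Hl].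
  replace (wp_reg tau j z) with l; [exact Hl|]. symmetry. unfold wp_reg.
  apply (iota_filterlim_locally (V := C_CompleteNormedModule) (F := eventually)).
  apply (tends_filterlim eventually). exact Hl.
Qed.

(** Termwise differentiation: the second order remainder of each term is at most a constant
    times [|h|^2] times its weight, and this bound is summed before letting [N] grow. *)
Lemma wp_reg_derive (j : nat) (z : C) : separated tau nonzero_index z ->
  C_is_derive (wp_reg tau j) z (wp_reg tau (S j) z).
Proof.
  intros [c [Hc Hz]].
  pose proof (separated_open tau nonzero_index z c Hc Hz) as Hball.
  assert (Hsep : forall y, (Cmod (y - z) <= c / 2)%R -> separated tau nonzero_index y).
  { intros y Hy. exists (c / 2)%R. split; [lra|]. apply Hball, Hy. }
  destruct (reg_term_bound (S j) (c / 2)) as [K [HK Hb]]; [lra|].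
  assert (Hterm : forall h m n, (Cmod h <= c / 2)%R ->
    (Cmod (reg_term tau j (z + h)%C m n - reg_term tau j z m n - h * reg_term tau (S j) z m n)
      <= 4 * K * Cmod h * Cmod h * weight m n)%R).
  { intros h m n Hh.
    assert (Hnz : forall y, (Cmod (y - z) <= c / 2)%R -> nonzero_index m n -> y - lattice_pt tau m n <> 0).
    { intros y Hy Hmn. apply Cmod_gt_0. specialize (Hball y Hy m n Hmn).
      pose proof (Rabs_pos (IZR m)). pose proof (Rabs_pos (IZR n)). nra. }
    assert (Hseg : forall k t, (Cmod k <= c / 2)%R -> (0 <= t <= 1)%R -> (Cmod (RtoC t * k) <= Cmod k)%R).
    { intros k t _ Ht. rewrite Cmod_mult, Cmod_R, Rabs_pos_eq by lra.
      pose proof (Cmod_ge_0 k). nra. }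
    assert (H1 : forall k, (Cmod k <= c / 2)%R ->
      (Cmod (reg_term tau (S j) (z + k)%C m n - reg_term tau (S j) z m n) <= 2 * (K * weight m n) * Cmod k)%R).
    { intros k Hk. replace k with (z + k - z) at 2 by ring.
      apply (Cmod_increment_le (fun y => reg_term tau (S j) y m n) (fun y => reg_term tau (S (S j)) y m n)).
      intros t Ht. replace (z + RtoC t * (z + k - z)) with (z + RtoC t * k) by ring.
      assert (Hy : (Cmod (z + RtoC t * k - z) <= c / 2)%R).
      { replace (z + RtoC t * k - z) with (RtoC t * k) by ring. eapply Rle_trans; [apply Hseg; assumption|exact Hk]. }
      split; [apply reg_term_derive, Hnz, Hy|]. apply Hb. intros Hmn. apply Hball; assumption. }
    pose (F := fun y => reg_term tau j y m n - reg_term tau (S j) z m n * (y - z)).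
    assert (H2 : (Cmod (F (z + h)%C - F z) <= 2 * (2 * (K * weight m n) * Cmod h) * Cmod (z + h - z))%R).
    { apply (Cmod_increment_le F (fun y => reg_term tau (S j) y m n - reg_term tau (S j) z m n)).
      intros t Ht. replace (z + RtoC t * (z + h - z)) with (z + RtoC t * h) by ring.
      assert (Hs := Hseg h t Hh Ht).
      assert (Hy : (Cmod (z + RtoC t * h - z) <= c / 2)%R).
      { replace (z + RtoC t * h - z) with (RtoC t * h) by ring. lra. }
      split.
      - unfold F. apply C_is_derive_minus; [apply reg_term_derive, Hnz, Hy|].
        eapply C_is_derive_val; [|apply C_is_derive_mult; [apply C_is_derive_const|apply C_is_derive_minus;
          [apply C_is_derive_id|apply C_is_derive_const]]]. cbv beta. ring.
      - eapply Rle_trans; [apply H1; lra|]. apply Rmult_le_compat_l; [|exact Hs].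
        pose proof (weight_pos m n). nra. }
    unfold F in H2. replace (z + h - z) with h in H2 by ring.
    replace (reg_term tau j (z + h) m n - reg_term tau (S j) z m n * h -
         (reg_term tau j z m n - reg_term tau (S j) z m n * (z - z)))
      with (reg_term tau j (z + h) m n - reg_term tau j z m n - h * reg_term tau (S j) z m n) in H2 by ring.
    eapply Rle_trans; [exact H2|]. right. ring. }
  apply C_is_derive_quadratic with (K := (25 * (4 * K))%R) (d := (c / 2)%R); [lra|lra|].
  intros h Hh.
  apply (tends_Cmod_le eventually (fun N => boxC N (reg_term tau j (z + h)) - boxC N (reg_term tau j z)
     - h * boxC N (reg_term tau (S j) z))).
  - intros N. rewrite <- boxC_scal, <- !boxC_minus.
    replace (25 * (4 * K) * Cmod h * Cmod h)%R with (25 * (4 * K * Cmod h * Cmod h))%R by ring.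
    apply boxC_dominated_le. intros m n. apply Hterm, Hh.
  - apply tends_minus; [apply tends_minus|apply tends_mult; [apply tends_const|]];
      apply wp_reg_lim; apply Hsep.
    + replace (z + h - z) with h by ring. exact Hh.
    + replace (z - z) with (RtoC 0) by ring. rewrite Cmod_0. lra.
    + replace (z - z) with (RtoC 0) by ring. rewrite Cmod_0. lra.
Qed.

End Regular.


(** With this convention the term of index (0,0) of the series of wp has the same form as
    the others, which is what makes the partial sums telescope under a translation. *)
Lemma Cinv_0 : / (RtoC 0) = 0.
Proof. unfold Cinv, RtoC; simpl. f_equal; unfold Rdiv; ring. Qed.

Lemma tends_eventually_0 (u : nat -> C) (K : R) :
  (forall N, (Cmod (u N) <= K * / (INR N + 1))%R) -> tends eventually u 0.
Proof.
  intros H e He.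
  assert (HK : (0 <= K)%R).
  { specialize (H 0%nat). simpl INR in H. pose proof (Cmod_ge_0 (u 0%nat)). lra. }
  destruct (INR_unbounded (K / e)) as [N0 HN0]. exists N0. intros N HN.
  replace (u N - 0) with (u N) by ring. eapply Rle_lt_trans; [apply H|].
  apply le_INR in HN. pose proof (pos_INR N0).
  apply Rmult_lt_reg_r with (INR N + 1)%R; [lra|]. rewrite Rmult_assoc, Rinv_l, Rmult_1_r by lra.
  apply Rle_lt_trans with (e * (K / e))%R; [right; field; lra|]. apply Rmult_lt_compat_l; lra.
Qed.

Lemma zsumR_const (N : nat) (k : R) : zsumR N (fun _ => k) = ((2 * INR N + 1) * k)%R.
Proof.
  induction N as [|N IH]; [rewrite zsum_0; simpl; ring|].
  rewrite zsum_S, IH, S_INR. change (@plus R_AbelianMonoid) with Rplus. simpl. ring.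
Qed.

(** * The Weierstrass function *)

Section Wp.
Variable tau : C.
Hypothesis Htau : (0 < Im tau)%R.

Notation L := (in_lattice tau).

Lemma wp_partial_split (z : C) (N : nat) :
  wp_partial tau z N = / (z * z) + boxC N (reg_term tau 0 z).
Proof.
  change (wp_partial tau z N) with (boxC N (wp_term tau z)).
  rewrite <- (box_delta (G := C_AbelianMonoid) N (/ (z * z))).
  rewrite <- boxC_plus. apply box_ext. intros m n. unfold wp_term, reg_term.
  destruct (Z.eqb m 0 && Z.eqb n 0)%bool.
  - change (/ (z * z) = / (z * z) + 0). ring.
  - change (@zero C_AbelianMonoid) with (RtoC 0). simpl Cpow. cbn [deriv_coeff].
    rewrite !Cmult_1_r, Cmult_1_l. match goal with |- ?x = ?y => change (@eq C x y) end. ring.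
Qed.

Lemma wp_lim (z : C) : ~ L z -> tends eventually (wp_partial tau z) (/ (z * z) + wp_reg tau 0 z).
Proof.
  intros Hz. apply tends_ext with (f := fun N => / (z * z) + boxC N (reg_term tau 0 z)).
  - apply filter_forall. intros N. symmetry. apply wp_partial_split.
  - apply tends_plus; [apply tends_const|]. apply wp_reg_lim; [exact Htau|].
    apply separated_weaken, separated_off_lattice; assumption.
Qed.

Lemma wp_eq (z : C) : ~ L z -> wp tau z = / (z * z) + wp_reg tau 0 z.
Proof.
  intros Hz. unfold wp.
  apply (iota_filterlim_locally (V := C_CompleteNormedModule) (F := eventually)).
  apply (tends_filterlim eventually). apply wp_lim, Hz.
Qed.

Lemma lattice_pt_opp (m n : Z) : lattice_pt tau (- m) (- n) = - lattice_pt tau m n.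
Proof. unfold lattice_pt. rewrite !opp_IZR, !RtoC_opp. ring. Qed.

Lemma separated_opp (z : C) : separated tau nonzero_index z -> separated tau nonzero_index (- z).
Proof.
  intros [c [Hc H]]. exists c. split; [exact Hc|]. intros m n Hmn.
  specialize (H (- m)%Z (- n)%Z). rewrite lattice_pt_opp, !opp_IZR, !Rabs_Ropp in H.
  replace (- z - lattice_pt tau m n) with (- (z - - lattice_pt tau m n)) by ring.
  rewrite Cmod_opp. apply H. intros E. apply Hmn. injection E. intros. f_equal; lia.
Qed.

Lemma wp_reg_even (z : C) : separated tau nonzero_index z -> wp_reg tau 0 (- z) = wp_reg tau 0 z.
Proof.
  intros Hz. apply (tends_unique eventually (fun N => boxC N (reg_term tau 0 z))).
  - apply tends_ext with (f := fun N => boxC N (reg_term tau 0 (- z))).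
    + apply filter_forall. intros N. rewrite <- box_opp_index. apply box_ext. intros m n.
      unfold reg_term. rewrite lattice_pt_opp.
      replace (Z.eqb (- m) 0) with (Z.eqb m 0) by (destruct (Z.eqb_spec m 0), (Z.eqb_spec (-m) 0); lia).
      replace (Z.eqb (- n) 0) with (Z.eqb n 0) by (destruct (Z.eqb_spec n 0), (Z.eqb_spec (-n) 0); lia).
      destruct (Z.eqb m 0 && Z.eqb n 0)%bool; [reflexivity|].
      match goal with |- ?x = ?y => change (@eq C x y) end.
      f_equal; [|f_equal; ring]. f_equal. f_equal. simpl Cpow. ring.
    + apply wp_reg_lim; [exact Htau|apply separated_opp, Hz].
  - apply wp_reg_lim; assumption.
Qed.

Lemma wp_reg_at_0 : wp_reg tau 0 0 = 0.
Proof.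
  apply (tends_unique eventually (fun N => boxC N (reg_term tau 0 0))).
  - apply wp_reg_lim; [exact Htau|apply separated_zero, Htau].
  - apply tends_ext with (f := fun _ => 0); [|apply tends_const].
    apply filter_forall. intros N.
    transitivity (boxC N (fun m n => if (Z.eqb m 0 && Z.eqb n 0)%bool then RtoC 0 else @zero C_AbelianMonoid));
      [symmetry; apply (box_delta (G := C_AbelianMonoid))|].
    apply box_ext. intros m n. unfold reg_term.
    destruct (Z.eqb m 0 && Z.eqb n 0)%bool; [reflexivity|]. change (@zero C_AbelianMonoid) with (RtoC 0).
    match goal with |- ?x = ?y => change (@eq C x y) end. cbn [deriv_coeff].
    replace ((0 - lattice_pt tau m n) ^ (0 + 2)) with (lattice_pt tau m n * lattice_pt tau m n)
      by (simpl Cpow; ring). ring.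
Qed.

(** The derivative of an even function. *)
Lemma wp_reg1_at_0 : wp_reg tau 1 0 = 0.
Proof.
  assert (H0 := separated_zero tau Htau).
  assert (E : - wp_reg tau 1 0 = wp_reg tau 1 0).
  { apply (C_is_derive_unique (wp_reg tau 0) 0); [|apply wp_reg_derive; assumption].
    apply C_is_derive_ext_loc with (f := fun z => wp_reg tau 0 (- z)).
    - generalize (separated_nbhd tau _ 0 H0). apply filter_imp. intros y Hy. apply wp_reg_even, Hy.
    - eapply C_is_derive_val; [|apply (C_is_derive_comp (wp_reg tau 0) (fun z => - z));
        [|apply C_is_derive_opp, C_is_derive_id]].
      2: replace (- (0)) with (RtoC 0) by ring; apply wp_reg_derive; assumption.
      ring. }
  replace (wp_reg tau 1 0) with ((wp_reg tau 1 0 - - wp_reg tau 1 0) / 2) by field.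
  rewrite E. field.
Qed.

Definition wp1 (z : C) : C := - (2) * / (z * z * z) + wp_reg tau 1 z.
Definition wp2 (z : C) : C := 6 * / (z * z * z * z) + wp_reg tau 2 z.
Definition wp3 (z : C) : C := - (24) * / (z * z * z * z * z) + wp_reg tau 3 z.

Lemma off_lattice_nonzero (z : C) : ~ L z -> z <> 0.
Proof. intros H E. apply H. rewrite E. apply in_lattice_zero. Qed.

Lemma off_lattice_nbhd (z : C) : ~ L z -> nbhd z (fun y => ~ L y).
Proof.
  intros H. generalize (separated_nbhd tau _ z (separated_off_lattice tau z Htau H)).
  apply filter_imp. intros y. apply separated_off_not_in.
Qed.

Lemma off_lattice_shift_nbhd (z w : C) : ~ L (z + w) -> nbhd z (fun y => ~ L (y + w)).
Proof.
  intros H. apply (nbhd_cont (fun y => y + w) z (fun y => ~ L y)).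
  - apply tends_plus; [apply cont_id|apply tends_const].
  - apply off_lattice_nbhd, H.
Qed.

Lemma off_lattice_sep (z : C) : ~ L z -> separated tau nonzero_index z.
Proof. intros H. apply separated_weaken, separated_off_lattice; assumption. Qed.

Lemma wp_derive (z : C) : ~ L z -> C_is_derive (wp tau) z (wp1 z).
Proof.
  intros H. pose proof (off_lattice_nonzero z H) as Hz. pose proof (off_lattice_sep z H) as Hs.
  apply C_is_derive_ext_loc with (f := fun y => / (y * y) + wp_reg tau 0 y).
  - generalize (off_lattice_nbhd z H). apply filter_imp. intros y Hy. symmetry. apply wp_eq, Hy.
  - eapply C_is_derive_val; [|cder; apply wp_reg_derive; assumption]. unfold wp1. field. exact Hz.
Qed.

Lemma wp1_derive (z : C) : ~ L z -> C_is_derive wp1 z (wp2 z).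
Proof.
  intros H. pose proof (off_lattice_nonzero z H) as Hz. pose proof (off_lattice_sep z H) as Hs.
  unfold wp1. eapply C_is_derive_val; [|cder; apply wp_reg_derive; assumption]. unfold wp2. field. exact Hz.
Qed.

Lemma wp2_derive (z : C) : ~ L z -> C_is_derive wp2 z (wp3 z).
Proof.
  intros H. pose proof (off_lattice_nonzero z H) as Hz. pose proof (off_lattice_sep z H) as Hs.
  unfold wp2. eapply C_is_derive_val; [|cder; apply wp_reg_derive; assumption]. unfold wp3. field. exact Hz.
Qed.

Lemma wp3_cont (z : C) : ~ L z -> cont wp3 z.
Proof.
  intros H. pose proof (off_lattice_nonzero z H) as Hz. pose proof (off_lattice_sep z H) as Hs.
  unfold wp3. eapply C_is_derive_cont. cder; apply wp_reg_derive; assumption.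
Qed.

Lemma wp_even (z : C) : ~ L z -> wp tau (- z) = wp tau z.
Proof.
  intros H. assert (H' : ~ L (- z)).
  { intros H1. apply H. replace z with (- - z) by ring. apply in_lattice_opp, H1. }
  rewrite !wp_eq by assumption. rewrite wp_reg_even by (apply off_lattice_sep, H).
  f_equal. f_equal. ring.
Qed.

Lemma inv_square_edge_bound (z : C) : ~ L z -> exists K : R, forall N : nat, forall m n : Z,
  (Z.abs m >= Z.of_nat N \/ Z.abs n >= Z.of_nat N)%Z ->
  (Cmod (/ ((z - lattice_pt tau m n) * (z - lattice_pt tau m n)))
    <= K * / ((INR N + 1) * (INR N + 1)))%R.
Proof.
  intros H. destruct (separated_off_lattice tau z Htau H) as [c [Hc Hz]].
  exists (/ (c * c))%R. intros N m n Hmn. specialize (Hz m n I).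
  pose proof (pos_INR N) as HN.
  assert (Hs : (INR N + 1 <= 1 + Rabs (IZR m) + Rabs (IZR n))%R).
  { pose proof (Rabs_pos (IZR m)). pose proof (Rabs_pos (IZR n)).
    rewrite INR_IZR_INZ. rewrite <- !abs_IZR in *.
    destruct Hmn as [Hm|Hn]; [apply Z.ge_le, IZR_le in Hm|apply Z.ge_le, IZR_le in Hn]; lra. }
  assert (Hlow : (c * (INR N + 1) <= Cmod (z - lattice_pt tau m n))%R) by nra.
  assert (Hpos : (0 < c * (INR N + 1))%R) by (apply Rmult_lt_0_compat; lra).
  rewrite Cmod_inv, Cmod_mult by (apply Cmult_neq_0; apply Cmod_gt_0; lra).
  rewrite <- Rinv_mult.
  apply Rinv_le_contravar.
  - repeat apply Rmult_lt_0_compat; lra.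
  - replace (c * c * ((INR N + 1) * (INR N + 1)))%R with ((c * (INR N + 1)) * (c * (INR N + 1)))%R by ring.
    apply Rmult_le_compat; lra.
Qed.

(** Translating the summation square by a period changes the sum by two of its edges: about
    [2 N] terms each, of size [N^-2]. *)
Lemma edge_sum_tends_0 (z : C) (p q : nat -> Z -> C) : ~ L z ->
  (forall N k, exists m n, (Z.abs m >= Z.of_nat N \/ Z.abs n >= Z.of_nat N)%Z /\
     p N k = / ((z - lattice_pt tau m n) * (z - lattice_pt tau m n))) ->
  (forall N k, exists m n, (Z.abs m >= Z.of_nat N \/ Z.abs n >= Z.of_nat N)%Z /\
     q N k = / ((z - lattice_pt tau m n) * (z - lattice_pt tau m n))) ->
  tends eventually (fun N => zsumC N (fun k => p N k - q N k)) 0.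
Proof.
  intros Hz Hp Hq. destruct (inv_square_edge_bound z Hz) as [K HK].
  apply tends_eventually_0 with (4 * K)%R. intros N. pose proof (pos_INR N) as HN.
  eapply Rle_trans; [apply Cmod_zsum_le|].
  set (b := (K * / ((INR N + 1) * (INR N + 1)))%R).
  apply Rle_trans with (zsumR N (fun _ => (2 * b)%R)).
  - apply zsumR_le. intros k. eapply Rle_trans; [apply Cmod_triangle|]. rewrite Cmod_opp.
    destruct (Hp N k) as [m [n [Hmn E]]]. destruct (Hq N k) as [m' [n' [Hmn' E']]].
    rewrite E, E'. pose proof (HK N m n Hmn). pose proof (HK N m' n' Hmn'). unfold b. lra.
  - rewrite zsumR_const.
    assert (Hb : (0 <= b)%R).
    { eapply Rle_trans; [apply Cmod_ge_0|]. apply (HK N (Z.of_nat N) 0%Z). left. lia. }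
    replace (4 * K * / (INR N + 1))%R with (4 * b * (INR N + 1))%R by (unfold b; field; lra).
    nra.
Qed.

Lemma wp_term_all (z : C) (m n : Z) : wp_term tau z m n =
  / ((z - lattice_pt tau m n) * (z - lattice_pt tau m n))
       - / (lattice_pt tau m n * lattice_pt tau m n).
Proof.
  unfold wp_term. destruct (index_cases m n) as [[E [Em En]]|[E _]]; rewrite E; [|reflexivity].
  subst. unfold lattice_pt. replace (0 + 0 * tau) with (RtoC 0) by ring.
  replace (RtoC 0 * 0) with (RtoC 0) by ring. rewrite Cinv_0.
  replace (z - 0) with z by ring. ring.
Qed.

(** The terms [1/l^2] cancel in the difference of the partial sums, and only the edges of the
    square remain. *)
Lemma wp_periodic_of (w z : C) : L w -> ~ L z ->
  tends eventually (fun N => boxC N (wp_term tau (z + w)) - boxC N (wp_term tau z)) 0 ->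
  wp tau (z + w) = wp tau z.
Proof.
  intros Hw Hz H0.
  assert (Hz' : ~ L (z + w)) by (rewrite in_lattice_shift; assumption).
  rewrite !wp_eq by assumption.
  apply (tends_unique eventually (wp_partial tau (z + w))); [apply wp_lim, Hz'|].
  apply tends_ext with (f := fun N => (boxC N (wp_term tau (z + w)) - boxC N (wp_term tau z)) + wp_partial tau z N).
  - apply filter_forall. intros N. change (wp_partial tau z N) with (boxC N (wp_term tau z)).
    change (wp_partial tau (z + w) N) with (boxC N (wp_term tau (z + w))). ring.
  - apply tends_val with (0 + (/ (z * z) + wp_reg tau 0 z)); [ring|].
    apply tends_plus; [exact H0|apply wp_lim, Hz].
Qed.

Lemma wp_periodic_1 (z : C) : ~ L z -> wp tau (z + 1) = wp tau z.
Proof.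
  intros Hz. apply wp_periodic_of; [apply in_lattice_one|exact Hz|].
  pose (g := fun m n => / ((z - lattice_pt tau m n) * (z - lattice_pt tau m n))).
  apply tends_ext with (f := fun N => zsumC N (fun n => g (- Z.of_nat N - 1)%Z n - g (Z.of_nat N) n)).
  - apply filter_forall. intros N. rewrite <- boxC_minus.
    transitivity (zsumC N (fun m => zsumC N (g (m - 1)%Z) - zsumC N (g m))).
    + rewrite (zsumC_telescope N (fun m => zsumC N (g m))). apply zsumC_minus.
    + unfold box. apply zsum_ext. intros m. rewrite <- zsumC_minus. apply zsum_ext. intros n.
      change (g (m - 1)%Z n - g m n = wp_term tau (z + 1) m n - wp_term tau z m n).
      rewrite !wp_term_all. unfold g.
      replace (z + 1 - lattice_pt tau m n) with (z - lattice_pt tau (m - 1) n)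
        by (unfold lattice_pt; rewrite minus_IZR, RtoC_minus; ring). ring.
  - apply edge_sum_tends_0 with (z := z) (p := fun N n => g (- Z.of_nat N - 1)%Z n) (q := fun N n => g (Z.of_nat N) n);
      [exact Hz| |]; intros N k.
    + exists (- Z.of_nat N - 1)%Z, k. split; [lia|reflexivity].
    + exists (Z.of_nat N), k. split; [lia|reflexivity].
Qed.

Lemma wp_periodic_tau (z : C) : ~ L z -> wp tau (z + tau) = wp tau z.
Proof.
  intros Hz. apply wp_periodic_of; [apply in_lattice_tau|exact Hz|].
  pose (g := fun m n => / ((z - lattice_pt tau m n) * (z - lattice_pt tau m n))).
  apply tends_ext with (f := fun N => zsumC N (fun m => g m (- Z.of_nat N - 1)%Z - g m (Z.of_nat N))).
  - apply filter_forall. intros N. rewrite <- boxC_minus. unfold box. apply zsum_ext. intros m.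
    rewrite <- (zsumC_telescope N (g m)). apply zsum_ext. intros n.
    match goal with |- ?x = ?y => change (@eq C x y) end.
    rewrite !wp_term_all. unfold g.
    replace (z + tau - lattice_pt tau m n) with (z - lattice_pt tau m (n - 1))
      by (unfold lattice_pt; rewrite minus_IZR, RtoC_minus; ring). ring.
  - apply edge_sum_tends_0 with (z := z) (p := fun N m => g m (- Z.of_nat N - 1)%Z) (q := fun N m => g m (Z.of_nat N));
      [exact Hz| |]; intros N k.
    + exists k, (- Z.of_nat N - 1)%Z. split; [lia|reflexivity].
    + exists k, (Z.of_nat N). split; [lia|reflexivity].
Qed.

Lemma lattice_periods (f : C -> C) :
  (forall z, ~ L z -> f (z + 1) = f z) -> (forall z, ~ L z -> f (z + tau) = f z) ->
  forall w z, L w -> ~ L z -> f (z + w) = f z.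
Proof.
  intros H1 Ht.
  assert (Hstep : forall a, L a -> (forall z, ~ L z -> f (z + a) = f z) ->
    forall (k : Z) z, ~ L z -> f (z + RtoC (IZR k) * a) = f z /\ ~ L (z + RtoC (IZR k) * a)).
  { intros a La Ha.
    assert (Hn : forall (k : nat) z, ~ L z -> f (z + RtoC (INR k) * a) = f z /\ ~ L (z + RtoC (INR k) * a)).
    { induction k as [|k IH]; intros z Hz.
      - simpl INR. replace (z + 0 * a) with z by ring. tauto.
      - destruct (IH z Hz) as [E N]. rewrite S_INR, RtoC_plus.
        replace (z + (INR k + 1) * a) with (z + INR k * a + a) by ring.
        rewrite Ha by exact N. rewrite in_lattice_shift by exact La. tauto. }
    intros k z Hz. destruct (Z_le_gt_dec 0 k) as [Hk|Hk].
    - replace (IZR k) with (INR (Z.to_nat k)) by (rewrite INR_IZR_INZ, Z2Nat.id by lia; reflexivity).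
      apply Hn, Hz.
    - set (j := Z.to_nat (- k)).
      assert (Ej : IZR k = (- INR j)%R).
      { unfold j. rewrite INR_IZR_INZ, Z2Nat.id, opp_IZR by lia. ring. }
      rewrite Ej, RtoC_opp.
      assert (Hz' : ~ L (z + - INR j * a)).
      { intros [m [n E]]. apply Hz.
        destruct La as [m' [n' E']].
        exists (m + Z.of_nat j * m')%Z, (n + Z.of_nat j * n')%Z.
        replace z with (z + - INR j * a + INR j * a) by ring. rewrite E, E'. unfold lattice_pt.
        rewrite !plus_IZR, !mult_IZR, !RtoC_plus, !RtoC_mult, <- !INR_IZR_INZ. ring. }
      split; [|exact Hz']. destruct (Hn j _ Hz') as [E _]. rewrite <- E.
      f_equal. ring. }
  intros w z [m [n Ew]] Hz. subst w. unfold lattice_pt.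
  destruct (Hstep 1 (in_lattice_one tau) H1 m z Hz) as [E N].
  destruct (Hstep tau (in_lattice_tau tau) Ht n _ N) as [E' _].
  rewrite <- E, <- E'. f_equal. ring.
Qed.

Lemma wp_periodic (w z : C) : L w -> ~ L z -> wp tau (z + w) = wp tau z.
Proof. apply lattice_periods; [apply wp_periodic_1|apply wp_periodic_tau]. Qed.

Lemma derive_periodic (f f1 : C -> C) (w : C) : L w ->
  (forall z, ~ L z -> C_is_derive f z (f1 z)) ->
  (forall z, ~ L z -> f (z + w) = f z) -> forall z, ~ L z -> f1 (z + w) = f1 z.
Proof.
  intros Hw Hd Hp z Hz. apply (C_is_derive_unique f z); [|apply Hd, Hz].
  apply C_is_derive_ext_loc with (f := fun y => f (y + w)).
  - generalize (off_lattice_nbhd z Hz). apply filter_imp. intros y Hy. apply Hp, Hy.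
  - apply C_is_derive_shift, Hd. rewrite in_lattice_shift; assumption.
Qed.

Lemma wp1_periodic (w z : C) : L w -> ~ L z -> wp1 (z + w) = wp1 z.
Proof.
  intros Hw. apply (derive_periodic (wp tau)); [exact Hw|apply wp_derive|]. intros; apply wp_periodic; assumption.
Qed.

Lemma wp2_periodic (w z : C) : L w -> ~ L z -> wp2 (z + w) = wp2 z.
Proof.
  intros Hw. apply (derive_periodic wp1); [exact Hw|apply wp1_derive|]. intros; apply wp1_periodic; assumption.
Qed.

Lemma wp1_odd (z : C) : ~ L z -> wp1 (- z) = - wp1 z.
Proof.
  intros Hz. assert (Hz' : ~ L (- z)).
  { intros H1. apply Hz. replace z with (- - z) by ring. apply in_lattice_opp, H1. }
  assert (E : wp1 (- z) * (- (1)) = wp1 z).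
  { apply (C_is_derive_unique (wp tau) z); [|apply wp_derive, Hz].
    apply C_is_derive_ext_loc with (f := fun y => wp tau (- y)).
    - generalize (off_lattice_nbhd z Hz). apply filter_imp. apply wp_even.
    - apply (C_is_derive_comp (wp tau) (fun y => - y)); [apply wp_derive, Hz'|].
      apply C_is_derive_opp, C_is_derive_id. }
  rewrite <- E. ring.
Qed.

(** [wp'] is odd and [-w] is congruent to [w]. *)
Lemma wp1_half_period (w : C) : L (w + w) -> ~ L w -> wp1 w = 0.
Proof.
  intros H2 Hw.
  assert (Hw' : ~ L (- w)).
  { intros H1. apply Hw. replace w with (- - w) by ring. apply in_lattice_opp, H1. }
  assert (E : wp1 w = - wp1 w).
  { rewrite <- wp1_odd by exact Hw. rewrite <- (wp1_periodic (w + w) (- w)) by assumption.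
    f_equal. ring. }
  replace (wp1 w) with ((wp1 w - - wp1 w) / 2) by field. rewrite <- E. field.
Qed.

End Wp.


(** * Liouville's theorem for doubly periodic functions *)

(** The form in which compactness of the square is used: a local property that persists when
    [d] decreases holds with one [d] on the whole square. *)
Lemma compact_uniform (Q : R -> R -> R -> Prop) :
  (forall d d' x y, (0 < d' <= d)%R -> Q d x y -> Q d' x y) ->
  (forall x y, exists d : R, (0 < d)%R /\
     forall x' y', (Rabs (x' - x) < d)%R -> (Rabs (y' - y) < d)%R -> Q d x' y') ->
  exists d : R, (0 < d)%R /\ forall x y, (0 <= x <= 1)%R -> (0 <= y <= 1)%R -> Q d x y.
Proof.
  intros Hmono Hloc.
  assert (Hd : forall x y, {d : posreal |
     forall x' y', (Rabs (x' - x) < d)%R -> (Rabs (y' - y) < d)%R -> Q d x' y'}).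
  { intros x y. apply constructive_indefinite_description. destruct (Hloc x y) as [d [Hd H]].
    exists (mkposreal d Hd). exact H. }
  destruct (compactness_value_2d 0 1 0 1 (fun x y => proj1_sig (Hd x y))) as [d H].
  exists d. split; [apply cond_pos|]. intros x y Hx Hy. specialize (H x y Hx Hy).
  apply NNPP in H. destruct H as [u [v [_ [_ [H1 [H2 H3]]]]]].
  pose proof (proj2_sig (Hd u v) x y H1 H2) as HQ. cbv beta in HQ.
  apply Hmono with (2 := HQ). split; [apply cond_pos|exact H3].
Qed.

Lemma square_max (u : R -> R -> R) : (forall x y, continuity_2d_pt u x y) ->
  exists a b, forall x y, (0 <= x <= 1)%R -> (0 <= y <= 1)%R -> (u x y <= u a b)%R.
Proof.
  intros Hu.
  destruct (compact_uniform (fun d x y => u x y <= / d)%R) as [d [Hd Hb]].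
  { intros d d' x y Hd H. eapply Rle_trans; [exact H|]. apply Rinv_le_contravar; lra. }
  { intros x y. destruct (Hu x y (mkposreal 1 Rlt_0_1)) as [e He]. simpl in He.
    pose proof (Rabs_pos (u x y)) as Hp. pose proof (Rle_abs (u x y)) as Hle.
    exists (Rmin e (/ (Rabs (u x y) + 1))).
    assert (H0 : (0 < Rmin e (/ (Rabs (u x y) + 1)))%R).
    { apply Rmin_pos; [apply cond_pos|]. apply Rinv_0_lt_compat. lra. }
    split; [exact H0|]. intros x' y' Hx Hy.
    specialize (He x' y' (Rlt_le_trans _ _ _ Hx (Rmin_l _ _)) (Rlt_le_trans _ _ _ Hy (Rmin_l _ _))).
    apply Rabs_lt_between in He. apply Rle_trans with (/ / (Rabs (u x y) + 1))%R.
    - rewrite Rinv_inv. lra.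
    - apply Rinv_le_contravar; [exact H0|apply Rmin_r]. }
  destruct (completeness (fun v => exists x y, (0 <= x <= 1)%R /\ (0 <= y <= 1)%R /\ v = u x y))
    as [M [HM1 HM2]].
  { exists (/ d)%R. intros v [x [y [Hx [Hy ->]]]]. apply Hb; assumption. }
  { exists (u 0 0)%R, 0%R, 0%R. repeat split; lra. }
  apply NNPP. intros Hno.
  assert (Hlt : forall x y, (u x y < M)%R).
  { intros x y. apply Rnot_le_lt. intros HMle. apply Hno. exists x, y. intros x' y' Hx Hy.
    eapply Rle_trans; [|exact HMle]. apply HM1. exists x', y'. auto. }
  destruct (compact_uniform (fun d x y => u x y <= M - d)%R) as [d' [Hd' Hb']].
  { intros e e' x y He H. lra. }
  { intros x y. specialize (Hlt x y). assert (Hpos : (0 < (M - u x y) / 2)%R) by lra.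
    destruct (Hu x y (mkposreal _ Hpos)) as [e He]. simpl in He.
    exists (Rmin e ((M - u x y) / 2)). split; [apply Rmin_pos; [apply cond_pos|exact Hpos]|].
    intros x' y' Hx Hy.
    specialize (He x' y' (Rlt_le_trans _ _ _ Hx (Rmin_l _ _)) (Rlt_le_trans _ _ _ Hy (Rmin_l _ _))).
    apply Rabs_lt_between in He. pose proof (Rmin_r e ((M - u x y) / 2)). lra. }
  assert (M <= M - d')%R; [|lra]. apply HM2. intros v [x [y [Hx [Hy ->]]]]. apply Hb'; assumption.
Qed.

Lemma tends_continuous_Re {T : UniformSpace} (f : T -> C) (x : T) :
  tends (locally x) f (f x) -> filterlim (fun y => Re (f y)) (locally x) (locally (Re (f x))).
Proof. intros H. apply (tends_Re_Im (locally x)) in H. apply H. Qed.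

Lemma tends_RtoC {T : Type} (F : (T -> Prop) -> Prop) {FF : Filter F} (f : T -> R) (l : R) :
  filterlim f F (locally l) -> tends F (fun x => RtoC (f x)) (RtoC l).
Proof.
  intros H. apply (tends_Re_Im F). split; [exact H|]. apply filterlim_const.
Qed.

Definition cis (t : R) : C := (cos t, sin t).

Lemma cis_rder (t : R) : rder cis t (Ci * cis t).
Proof.
  apply rder_Re_Im. unfold cis, Ci, Cmult, Re, Im; simpl. split; auto_derive; auto; ring.
Qed.

Lemma rder_tends (g : R -> C) (t : R) (v : C) : rder g t v -> tends (locally t) g (g t).
Proof.
  intros [r [Er [Cr Hr]]]. apply tends_ext with (f := fun s => g t + r s * RtoC (s - t)).
  - apply filter_forall. intros s. rewrite <- Hr. ring.
  - apply tends_val with (g t + v * RtoC (t - t)); [rewrite RtoC_minus; ring|].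
    apply tends_plus; [apply tends_const|]. apply tends_mult; [exact Cr|].
    apply (tends_RtoC (locally t) (fun s => (s - t)%R)).
    apply (continuous_minus (fun s : R => s) (fun _ => t) t); [apply continuous_id|apply continuous_const].
Qed.

Lemma rder_const_mult (c : C) (g : R -> C) (t : R) (v : C) :
  rder g t v -> rder (fun s => c * g s) t (c * v).
Proof.
  intros H. apply (rder_comp (fun z => c * z) g t c v); [|exact H].
  eapply C_is_derive_val; [|cder]. ring.
Qed.

Lemma rder_plus_const (c : C) (g : R -> C) (t : R) (v : C) :
  rder g t v -> rder (fun s => c + g s) t v.
Proof.
  intros H. replace v with (1 * v) by ring. apply (rder_comp (fun z => c + z) g t 1 v); [|exact H].
  eapply C_is_derive_val; [|cder]. ring.
Qed.

Lemma rder_val (g : R -> C) (t : R) (v w : C) : v = w -> rder g t v -> rder g t w.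
Proof. intros <-. auto. Qed.

Lemma cis_norm (t : R) : Cmod (cis t) = 1%R.
Proof.
  unfold Cmod, cis; simpl. transitivity (sqrt 1); [|apply sqrt_1]. f_equal.
  pose proof (sin2_cos2 t) as H. unfold Rsqr in H. lra.
Qed.

Section MeanValue.
Variables (f f1 : C -> C) (p : C) (r0 : R).
Hypothesis Hf : forall z, (Cmod (z - p) < r0)%R -> C_is_derive f z (f1 z).
Hypothesis Hf1 : forall z, (Cmod (z - p) < r0)%R -> cont f1 z.

Let pt (d : C) (r t : R) : C := p + RtoC r * d * cis t.

Lemma pt_norm (d : C) (r t : R) : (Cmod (pt d r t - p) = Rabs r * Cmod d)%R.
Proof.
  unfold pt. replace (p + RtoC r * d * cis t - p) with (RtoC r * d * cis t) by ring.
  rewrite !Cmod_mult, cis_norm, Cmod_R. ring.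
Qed.

Lemma pt_rder_radius (d : C) (t r : R) : rder (fun s => pt d s t) r (d * cis t).
Proof.
  pose proof (rder_line p (d * cis t) r) as H.
  destruct H as [phi [E [Hc H]]]. exists phi. split; [exact E|]. split; [exact Hc|].
  intros s. rewrite <- H. unfold pt. ring.
Qed.

Lemma pt_rder_angle (d : C) (r t : R) : rder (pt d r) t (RtoC r * d * (Ci * cis t)).
Proof. apply rder_plus_const, rder_const_mult, cis_rder. Qed.

(** The radial derivative of [f] on a circle is, up to a constant factor, its angular
    derivative, whose integral over a full turn vanishes. *)
Lemma circle_derivative_integral_0 (d : C) (r : R) : (Rabs r * Cmod d < r0)%R ->
  RInt (fun t => Re (f1 (pt d r t) * (d * cis t))) 0 (2 * PI) = 0%R.
Proof.
  intros Hr.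
  assert (Hin : forall t, (Cmod (pt d r t - p) < r0)%R) by (intros t; rewrite pt_norm; exact Hr).
  assert (Hc : forall t, continuous (fun t => Re (f1 (pt d r t) * (d * cis t))) t).
  { intros t. apply (tends_continuous_Re (fun t => f1 (pt d r t) * (d * cis t))).
    apply tends_mult.
    - apply (tends_comp (locally t) (pt d r) f1); [|apply Hf1, Hin].
      apply (rder_tends _ _ _ (pt_rder_angle d r t)).
    - apply tends_mult; [apply tends_const|]. apply (rder_tends _ _ _ (cis_rder t)). }
  assert (Hprim : exists G : R -> C, G 0%R = G (2 * PI)%R /\
     forall t, rder G t (f1 (pt d r t) * (d * cis t))).
  { assert (Hcis : cis (2 * PI) = cis 0).
    { unfold cis. rewrite cos_2PI, sin_2PI, cos_0, sin_0. reflexivity. }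
    assert (HCi : Ci * Ci = - (1)) by (unfold Ci, Cmult, Copp, RtoC; simpl; f_equal; ring).
    destruct (Req_EM_T r 0) as [E|E].
    (* radius 0: the integrand is a constant multiple of [cis] *)
    - exists (fun t => (f1 p * d * - Ci) * cis t). split; [rewrite Hcis; reflexivity|].
      intros t. apply rder_val with (f1 p * d * - Ci * (Ci * cis t)); [|apply rder_const_mult, cis_rder].
      unfold pt. rewrite E. replace (p + 0 * d * cis t) with p by ring.
      replace (f1 p * d * - Ci * (Ci * cis t)) with (f1 p * d * - (Ci * Ci) * cis t) by ring.
      rewrite HCi. ring.
    - exists (fun t => (- Ci * / RtoC r) * f (pt d r t)).
      split; [unfold pt; rewrite Hcis; reflexivity|]. intros t.
      apply rder_val with ((- Ci * / RtoC r) * (f1 (pt d r t) * (RtoC r * d * (Ci * cis t)))).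
      + assert (RtoC r <> 0) by (intros H; apply E; apply RtoC_inj, H).
        replace (- Ci * / RtoC r * (f1 (pt d r t) * (RtoC r * d * (Ci * cis t))))
          with (- (Ci * Ci) * (f1 (pt d r t) * (d * cis t))) by (field; assumption).
        rewrite HCi. ring.
      + apply rder_const_mult. apply rder_comp; [apply Hf, Hin|apply pt_rder_angle]. }
  destruct Hprim as [G [HG Hd]].
  apply is_RInt_unique.
  assert (E0 : minus (Re (G (2 * PI)%R)) (Re (G 0%R)) = 0%R)
    by (rewrite HG; unfold minus, plus, opp; simpl; ring).
  rewrite <- E0 at 2.
  apply (is_RInt_derive (V := R_CompleteNormedModule) (fun t => Re (G t))).
  - intros t _. apply (proj1 (rder_Re_Im G t _)), Hd.
  - intros t _. apply Hc.
Qed.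

(** The mean over the circle of radius [r |d|] does not depend on [r] in [0,1]. *)
Lemma mean_value_circle (d : C) : (Cmod d < r0)%R ->
  RInt (fun t => Re (f (p + d * cis t))) 0 (2 * PI) = (2 * PI * Re (f p))%R.
Proof.
  intros Hd.
  pose (J := fun r : R => RInt (fun t => Re (f (pt d r t))) 0 (2 * PI)).
  assert (Hd0 := Cmod_ge_0 d).
  assert (Hex : forall r, (Rabs r * Cmod d < r0)%R -> ex_RInt (fun t => Re (f (pt d r t))) 0 (2 * PI)).
  { intros r Hr. apply (ex_RInt_continuous (V := R_CompleteNormedModule)). intros t _.
    apply (ex_derive_continuous (fun t => Re (f (pt d r t)))).
    exists (Re (f1 (pt d r t) * (RtoC r * d * (Ci * cis t)))).
    apply rder_Re_Im. apply rder_comp; [|apply pt_rder_angle]. apply Hf. rewrite pt_norm. exact Hr. }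
  assert (Hder : forall r t, (Rabs r * Cmod d < r0)%R ->
     is_derive (fun s => Re (f (pt d s t))) r (Re (f1 (pt d r t) * (d * cis t)))).
  { intros r t Hr. apply rder_Re_Im. apply (rder_comp f (fun s => pt d s t)); [|apply pt_rder_radius].
    apply Hf. rewrite pt_norm. exact Hr. }
  assert (Hopen : forall r, (0 <= r <= 1)%R -> locally r (fun s => (Rabs s * Cmod d < r0)%R)).
  { intros r Hr. assert (Hpos : (0 < (r0 - Cmod d) / (1 + Cmod d))%R) by (apply Rdiv_lt_0_compat; lra).
    enough (Hk : forall s, (Rabs (s - r) < (r0 - Cmod d) / (1 + Cmod d))%R -> (Rabs s * Cmod d < r0)%R)
      by (exists (mkposreal _ Hpos); exact Hk).
    intros s Hs.
    assert (Hs1 : (Rabs s <= 1 + Rabs (s - r))%R).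
    { pose proof (Rabs_triang r (s - r)) as Ht. replace (r + (s - r))%R with s in Ht by ring.
      rewrite (Rabs_pos_eq r) in Ht; lra. }
    assert (Rabs (s - r) * (1 + Cmod d) < r0 - Cmod d)%R.
    { replace (r0 - Cmod d)%R with ((r0 - Cmod d) / (1 + Cmod d) * (1 + Cmod d))%R by (field; lra).
      apply Rmult_lt_compat_r; lra. }
    pose proof (Rabs_pos (s - r)). nra. }
  assert (HJ : forall r, (0 <= r <= 1)%R -> is_derive J r zero).
  { intros r Hr. pose proof (Hopen r Hr) as Ho.
    assert (Hr1 : (Rabs r * Cmod d < r0)%R) by (apply locally_singleton in Ho; exact Ho).
    assert (H := is_derive_RInt_param (fun s t => Re (f (pt d s t))) 0 (2 * PI) r).
    cbv beta in H.
    replace (RInt (fun t => Derive (fun u => Re (f (pt d u t))) r) 0 (2 * PI)) with (@zero R_NormedModule) in H.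
    - apply H.
      + generalize Ho. apply filter_imp. intros s Hs t _. eexists. apply Hder, Hs.
      + intros t _. apply continuity_2d_pt_ext_loc with (f := fun u v => Re (f1 (pt d u v) * (d * cis v))).
        * destruct Ho as [e He]. exists e. intros u v Hu _. symmetry. apply is_derive_unique. apply Hder, He, Hu.
        * apply continuity_2d_pt_filterlim.
          assert (Hfst : filterlim (fun z : R * R => fst z) (locally (r, t)) (locally r)) by apply continuous_fst.
          assert (Hsnd : filterlim (fun z : R * R => snd z) (locally (r, t)) (locally t)) by apply continuous_snd.
          assert (Hcs : tends (locally ((r, t) : prod_UniformSpace R_UniformSpace R_UniformSpace)) (fun z => cis (snd z)) (cis t)).
          { intros e He. exact (Hsnd _ (rder_tends _ _ _ (cis_rder t) e He)). }
          apply (tends_continuous_Re (T := prod_UniformSpace R_UniformSpace R_UniformSpace)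
            (fun z => f1 (pt d (fst z) (snd z)) * (d * cis (snd z))) (r, t)).
          apply tends_mult; [|apply tends_mult; [apply tends_const|exact Hcs]].
          apply (tends_comp _ (fun z : R * R => pt d (fst z) (snd z)) f1).
          -- apply tends_plus; [apply tends_const|]. apply tends_mult; [|exact Hcs].
             apply tends_mult; [|apply tends_const]. apply tends_RtoC; [apply filter_filter|exact Hfst].
          -- apply Hf1. simpl. rewrite pt_norm. exact Hr1.
      + generalize Ho. apply filter_imp. intros s Hs. apply Hex, Hs.
    - symmetry. etransitivity; [|exact (circle_derivative_integral_0 d r Hr1)]. apply RInt_ext.
      intros t _. apply is_derive_unique, Hder, Hr1. }
  assert (E := eq_is_derive J 0 1 HJ Rlt_0_1). unfold J in E.
  transitivity (RInt (fun t => Re (f (pt d 1 t))) 0 (2 * PI)).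
  - apply RInt_ext. intros t _. f_equal. f_equal. unfold pt. ring.
  - rewrite <- E. transitivity (RInt (fun _ => Re (f p)) 0 (2 * PI)).
    + apply RInt_ext. intros t _. f_equal. f_equal. unfold pt. ring.
    + rewrite RInt_const. unfold scal; simpl. unfold mult; simpl. ring.
Qed.

(** The mean of the nonnegative function [M - Re f] over the circle is 0, so it vanishes on the
    circle.  The point [p - d] corresponds to the angle [PI], interior to the interval of
    integration. *)
Lemma mean_value_maximum (M : R) (d : C) : (Cmod d < r0)%R ->
  (forall z, (Re (f z) <= M)%R) -> Re (f p) = M -> Re (f (p - d)) = M.
Proof.
  intros Hd Hle Hp.
  pose (v := fun t => (M - Re (f (p + d * cis t)))%R).
  assert (Hin : forall t, (Cmod (p + d * cis t - p) < r0)%R).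
  { intros t. replace (p + d * cis t - p) with (d * cis t) by ring. rewrite Cmod_mult, cis_norm. lra. }
  assert (Hu : forall t, continuous (fun t => Re (f (p + d * cis t))) t).
  { intros t. apply (ex_derive_continuous (fun t => Re (f (p + d * cis t)))).
    exists (Re (f1 (p + d * cis t) * (d * (Ci * cis t)))).
    apply (rder_Re_Im (fun t => f (p + d * cis t)) t).
    apply (rder_comp f (fun t => p + d * cis t)); [apply Hf, Hin|].
    apply rder_plus_const, rder_const_mult, cis_rder. }
  assert (Hv : forall t, continuous v t).
  { intros t. apply (continuous_minus (fun _ => M)); [apply continuous_const|apply Hu]. }
  assert (Hex : forall a b, ex_RInt v a b).
  { intros a b. apply (ex_RInt_continuous (V := R_CompleteNormedModule)). intros; apply Hv. }
  assert (Hpos : forall t, (0 <= v t)%R) by (intros t; unfold v; specialize (Hle (p + d * cis t)); lra).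
  assert (HPI := PI_RGT_0).
  assert (H0 : RInt v 0 (2 * PI) = 0%R).
  { unfold v. rewrite (RInt_minus (V := R_CompleteNormedModule)).
    - rewrite RInt_const, mean_value_circle by exact Hd. rewrite Hp.
      unfold minus, plus, opp, scal; simpl. unfold mult; simpl. ring.
    - apply ex_RInt_const.
    - apply (ex_RInt_continuous (V := R_CompleteNormedModule)). intros; apply Hu. }
  assert (Hz : forall x, (0 <= x <= 2 * PI)%R -> RInt v 0 x = 0%R).
  { intros x Hx. pose proof (RInt_Chasles v 0 x (2 * PI) (Hex _ _) (Hex _ _)) as Ec.
    rewrite H0 in Ec. change (@plus R_CompleteNormedModule) with Rplus in Ec.
    assert (0 <= RInt v 0 x)%R by (apply RInt_ge_0; [lra|apply Hex|intros; apply Hpos]).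
    assert (0 <= RInt v x (2 * PI))%R by (apply RInt_ge_0; [lra|apply Hex|intros; apply Hpos]).
    change (RInt v 0 x + RInt v x (2 * PI) = 0)%R in Ec. lra. }
  assert (Hvpi : v PI = 0%R).
  { assert (D1 : is_derive (fun x => RInt v 0 x) PI (v PI)).
    { apply (is_derive_RInt v (fun x => RInt v 0 x) 0 PI); [|apply Hv].
      apply filter_forall. intros b. apply (RInt_correct (V := R_CompleteNormedModule)), Hex. }
    assert (D2 : is_derive (fun x => RInt v 0 x) PI 0%R).
    { apply is_derive_ext_loc with (f := fun _ => 0%R); [|apply (is_derive_const (V := R_NormedModule))].
      exists (mkposreal PI HPI). intros x Hx. change (Rabs (x - PI) < PI)%R in Hx.
      apply Rabs_lt_between in Hx. symmetry. apply Hz. lra. }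
    rewrite <- (is_derive_unique _ _ _ D1). apply is_derive_unique, D2. }
  unfold v in Hvpi. replace (p - d) with (p + d * cis PI); [lra|].
  unfold cis. rewrite cos_PI, sin_PI.
  replace (((-1)%R, 0%R) : C) with (- (1)); [ring|]. unfold Copp, RtoC; simpl. f_equal; ring.
Qed.

End MeanValue.

(** [P] is a closed group of periods that contains the lattice and all the points where the
    function is not yet known to be differentiable.  It may be larger than the lattice: in the
    half shift relation a half period belongs to it. *)
Section Liouville.
Variable tau : C.
Hypothesis Htau : (0 < Im tau)%R.
Variable P : C -> Prop.
Hypothesis P_lattice : forall w, in_lattice tau w -> P w.
Hypothesis P_opp : forall w, P w -> P (- w).
Hypothesis P_plus : forall v w, P v -> P w -> P (v + w).
Hypothesis P_closed : forall z, ~ P z -> nbhd z (fun y => ~ P y).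

(** Let [p] be a maximum point of the real part and [d] its distance to [P].  The maximum
    spreads over the open disc of radius [d] about [p], which comes arbitrarily close to a point
    of [P]; by periodicity and continuity it is the value at 0. *)
Lemma Re_periodic_le (F F1 : C -> C) :
  (forall z, cont F z) ->
  (forall z w, P w -> F (z + w) = F z) ->
  (forall z, ~ P z -> C_is_derive F z (F1 z)) ->
  (forall z, ~ P z -> cont F1 z) ->
  forall z, (Re (F z) <= Re (F 0))%R.
Proof.
  intros HF Hper Hd Hd1.
  assert (Hc2 : forall x y, continuity_2d_pt (fun x y => Re (F (RtoC x + RtoC y * tau))) x y).
  { intros x y. apply continuity_2d_pt_filterlim.
    apply (tends_continuous_Re (T := prod_UniformSpace R_UniformSpace R_UniformSpace)
            (fun z => F (RtoC (fst z) + RtoC (snd z) * tau)) (x, y)).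
    apply (tends_comp _ (fun z : R * R => RtoC (fst z) + RtoC (snd z) * tau) F); [|apply HF].
    apply tends_plus; [|apply tends_mult; [|apply tends_const]];
      (apply tends_RtoC; [apply filter_filter|]); [apply continuous_fst|apply continuous_snd]. }
  destruct (square_max _ Hc2) as [a [b Hmax]].
  set (p := RtoC a + RtoC b * tau) in *. set (M := Re (F p)) in *.
  assert (HM : forall z, (Re (F z) <= M)%R).
  { intros z. destruct (tau_coordinates tau z Htau) as [x [y E]].
    assert (E' : F z = F (RtoC (frac_part x) + RtoC (frac_part y) * tau)).
    { rewrite <- (Hper (RtoC (frac_part x) + RtoC (frac_part y) * tau) (lattice_pt tau (Int_part x) (Int_part y))).
      - f_equal. rewrite E. unfold lattice_pt, frac_part. rewrite !RtoC_minus. ring.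
      - apply P_lattice. do 2 eexists. reflexivity. }
    rewrite E'. destruct (base_fp x), (base_fp y). apply Hmax; lra. }
  enough (HM0 : M = Re (F 0)) by (intros z; rewrite <- HM0; apply HM).
  destruct (classic (P p)) as [Pp|Pp].
  { unfold M. replace p with (0 + p) by ring. rewrite Hper by exact Pp. reflexivity. }
  destruct (completeness (fun x => exists w, P w /\ x = (- Cmod (p - w))%R)) as [l [Hub Hlub]].
  { exists 0%R. intros x [w [_ ->]]. pose proof (Cmod_ge_0 (p - w)). lra. }
  { exists (- Cmod (p - 0))%R, 0. split; [apply P_lattice, in_lattice_zero|reflexivity]. }
  set (d := (- l)%R).
  assert (Hd0 : (0 < d)%R).
  { destruct (proj1 (nbhd_Cmod _ _) (P_closed p Pp)) as [r [Hr H]].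
    assert (l <= - r)%R; [|unfold d; lra]. apply Hlub. intros x [w [Pw ->]].
    apply Ropp_le_contravar, Rnot_lt_le. intros Hlt. apply (H w); [|exact Pw].
    replace (w - p) with (- (p - w)) by ring. rewrite Cmod_opp. exact Hlt. }
  assert (Hin : forall z, (Cmod (z - p) < d)%R -> ~ P z).
  { intros z Hz Pz. assert (- Cmod (p - z) <= l)%R by (apply Hub; exists z; auto).
    replace (p - z) with (- (z - p)) in H by ring. rewrite Cmod_opp in H. unfold d in Hz. lra. }
  assert (Hclose : forall eta, (0 < eta)%R -> (Rabs (M - Re (F 0)) < eta)%R).
  { intros eta Heta. destruct (proj1 (nbhd_Cmod _ _) (HF 0 eta Heta)) as [k [Hk H0]].
    set (eps := Rmin (d / 2) (k / 2)).
    assert (He : (0 < eps)%R) by (apply Rmin_pos; lra).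
    assert (He1 : (eps <= d / 2)%R) by apply Rmin_l.
    assert (He2 : (eps <= k / 2)%R) by apply Rmin_r.
    assert (Hw : exists w, P w /\ (Cmod (p - w) < d + eps)%R).
    { apply NNPP. intros Hno. assert (l <= l - eps)%R; [|lra]. apply Hlub. intros x [w [Pw ->]].
      apply Rnot_lt_le. intros Hlt. apply Hno. exists w. split; [exact Pw|]. unfold d. lra. }
    destruct Hw as [w [Pw Hw]].
    assert (Hdw : (d <= Cmod (p - w))%R).
    { apply Rnot_lt_le. intros Hlt. apply (Hin w); [|exact Pw].
      replace (w - p) with (- (p - w)) by ring. rewrite Cmod_opp. exact Hlt. }
    set (q := Cmod (p - w)) in *.
    assert (Hpw : p - w <> 0) by (apply Cmod_gt_0; fold q; lra).
    set (delta := RtoC ((d - eps) / q) * (p - w)).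
    assert (Hfrac : (0 < (d - eps) / q)%R) by (apply Rdiv_lt_0_compat; lra).
    assert (Hdelta : Cmod delta = (d - eps)%R).
    { unfold delta. rewrite Cmod_mult, Cmod_R, Rabs_pos_eq by lra. fold q. field. lra. }
    assert (HMs : Re (F (p - delta)) = M).
    { apply (mean_value_maximum F F1 p d); try assumption; [| |lra|reflexivity].
      - intros z Hz. apply Hd, Hin, Hz.
      - intros z Hz. apply Hd1, Hin, Hz. }
    rewrite <- HMs. rewrite <- (Hper (p - delta) (- w)) by (apply P_opp, Pw).
    assert (Hs : (Cmod (p - delta + - w - 0) < k)%R).
    { replace (p - delta + - w - 0) with (RtoC (1 - (d - eps) / q) * (p - w))
        by (unfold delta; rewrite RtoC_minus; ring).
      rewrite Cmod_mult, Cmod_R. fold q.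
      assert (E : ((1 - (d - eps) / q) * q = q - (d - eps))%R) by (field; lra).
      replace (Rabs (1 - (d - eps) / q) * q)%R with (Rabs ((1 - (d - eps) / q) * q))
        by (rewrite Rabs_mult, (Rabs_pos_eq q) by lra; reflexivity).
      rewrite E, Rabs_pos_eq; lra. }
    specialize (H0 _ Hs). eapply Rle_lt_trans; [|exact H0].
    apply (re_le_Cmod (F (p - delta + - w) - F 0)). }
  apply Rminus_diag_uniq. apply NNPP. intros Hne.
  pose proof (Hclose _ (Rabs_pos_lt _ Hne)). lra.
Qed.

(** Bounding the real part of all the multiples of [F] by 1, -1, i and -i leaves no room. *)
Lemma periodic_const (F F1 : C -> C) :
  (forall z, cont F z) ->
  (forall z w, P w -> F (z + w) = F z) ->
  (forall z, ~ P z -> C_is_derive F z (F1 z)) ->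
  (forall z, ~ P z -> cont F1 z) ->
  forall z, F z = F 0.
Proof.
  intros HF Hper Hd Hd1 z.
  assert (H : forall c, (Re (c * F z) <= Re (c * F 0))%R).
  { intros c. apply (Re_periodic_le (fun y => c * F y) (fun y => c * F1 y)).
    - intros y. apply tends_mult; [apply tends_const|apply HF].
    - intros y w Pw. rewrite Hper by exact Pw. reflexivity.
    - intros y Hy. eapply C_is_derive_val; [|apply C_is_derive_mult; [apply C_is_derive_const|apply Hd, Hy]]. cbv beta. ring.
    - intros y Hy. apply tends_mult; [apply tends_const|apply Hd1, Hy]. }
  pose proof (H 1) as H1. pose proof (H (- (1))) as H2. pose proof (H Ci) as H3. pose proof (H (- Ci)) as H4.
  destruct (F z) as [x y], (F 0) as [x0 y0].
  unfold Cmult, Copp, Ci, RtoC, Re in *; simpl in *. f_equal; lra.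
Qed.

(** [phi] is the continuous extension of [f] to 0, and by periodicity to [P]. *)
Lemma liouville (f f1 phi : C -> C) :
  (forall z, ~ P z -> C_is_derive f z (f1 z)) ->
  (forall z, ~ P z -> cont f1 z) ->
  (forall z w, P w -> ~ P z -> f (z + w) = f z) ->
  cont phi 0 -> nbhd 0 (fun z => ~ P z -> f z = phi z) ->
  forall z, ~ P z -> f z = phi 0.
Proof.
  intros Hd Hd1 Hper Hphi H0.
  pose (F := fun z => if excluded_middle_informative (P z) then phi 0 else f z).
  assert (FP : forall z, P z -> F z = phi 0).
  { intros z Pz. unfold F. destruct (excluded_middle_informative (P z)); tauto. }
  assert (FN : forall z, ~ P z -> F z = f z).
  { intros z Pz. unfold F. destruct (excluded_middle_informative (P z)); tauto. }
  assert (P0 : P 0) by apply P_lattice, in_lattice_zero.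
  assert (Pshift : forall z w, P w -> (P (z + w) <-> P z)).
  { intros z w Pw. split; intros H; [|apply P_plus; assumption].
    replace z with (z + w + - w) by ring. apply P_plus; [exact H|apply P_opp, Pw]. }
  assert (Fper : forall z w, P w -> F (z + w) = F z).
  { intros z w Pw. destruct (classic (P z)) as [Pz|Pz].
    - rewrite !FP; [reflexivity|exact Pz|]. apply Pshift; assumption.
    - rewrite !FN; [apply Hper; assumption|exact Pz|]. rewrite Pshift; assumption. }
  assert (Floc : forall z, ~ P z -> nbhd z (fun y => f y = F y)).
  { intros z Pz. generalize (P_closed z Pz). apply filter_imp. intros y Hy. symmetry. apply FN, Hy. }
  assert (Fd : forall z, ~ P z -> C_is_derive F z (f1 z)).
  { intros z Pz. apply C_is_derive_ext_loc with (1 := Floc z Pz). apply Hd, Pz. }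
  assert (F0 : cont F 0).
  { intros e He. rewrite FP by exact P0. generalize (filter_and _ _ H0 (Hphi e He)). apply filter_imp.
    intros y [Hy1 Hy2]. destruct (classic (P y)) as [Py|Py].
    - rewrite FP by exact Py. replace (phi 0 - phi 0) with (RtoC 0) by ring. rewrite Cmod_0. exact He.
    - rewrite FN, Hy1 by exact Py. exact Hy2. }
  assert (Fc : forall z, cont F z).
  { intros z. destruct (classic (P z)) as [Pz|Pz].
    - apply cont_ext with (f := fun y => F (y + - z)).
      + apply filter_forall. intros y. apply Fper, P_opp, Pz.
      + apply cont_shift. replace (z + - z) with (RtoC 0) by ring. exact F0.
    - eapply C_is_derive_cont. apply Fd, Pz. }
  intros z Pz. rewrite <- (FN z Pz), <- (FP 0 P0).
  apply (periodic_const F f1); assumption.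
Qed.

End Liouville.


(** * Algebraic relations between values of wp *)

Section Relations.
Variable tau : C.
Hypothesis Htau : (0 < Im tau)%R.

Notation L := (in_lattice tau).
Notation p := (wp tau).
Notation p1 := (wp1 tau).
Notation p2 := (wp2 tau).
Notation p3 := (wp3 tau).

Lemma wp_reg_cont_0 (j : nat) : cont (wp_reg tau j) 0.
Proof. eapply C_is_derive_cont. apply wp_reg_derive, separated_zero; exact Htau. Qed.

(** With [wp = 1/z^2 + z^2 psi] near 0, the poles of order 4 cancel in [wp'' - 6 wp^2] and
    no pole of lower order arises; what is left is [phi]. *)
Lemma wp_ode : exists c0 : C, forall z, ~ L z -> p2 z = 6 * (p z * p z) + c0.
Proof.
  destruct (taylor_critical_zero (wp_reg tau 0) (wp_reg tau 1) 0 (wp_reg tau 2 0)) as [psi [Hc [_ Hpsi]]].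
  { apply wp_reg_at_0, Htau. }
  { apply wp_reg1_at_0, Htau. }
  { generalize (separated_nbhd tau _ 0 (separated_zero tau Htau)). apply filter_imp.
    intros z Hz. apply wp_reg_derive; assumption. }
  { apply wp_reg_derive, separated_zero; exact Htau. }
  set (phi := fun z => wp_reg tau 2 z - 12 * psi z - 6 * (z * z * psi z * (z * z * psi z))).
  exists (phi 0). intros z Hz.
  assert (H : p2 z - 6 * (p z * p z) = phi 0); [|rewrite <- H; ring].
  revert z Hz. apply (liouville tau Htau L) with (f := fun z => p2 z - 6 * (p z * p z)) (phi := phi) (f1 := fun z => p3 z - 6 * (p1 z * p z + p z * p1 z)).
  - auto.
  - apply in_lattice_opp.
  - apply in_lattice_plus.
  - apply off_lattice_nbhd, Htau.
  - intros z Hz. eapply C_is_derive_val; [|apply C_is_derive_minus; [apply wp2_derive; assumption|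
      apply C_is_derive_mult; [apply C_is_derive_const|apply C_is_derive_mult; apply wp_derive; assumption]]].
    cbv beta. ring.
  - intros z Hz.
    assert (H0 : cont p z) by (eapply C_is_derive_cont; apply wp_derive; assumption).
    assert (H1 : cont p1 z) by (eapply C_is_derive_cont; apply wp1_derive; assumption).
    apply tends_minus; [apply wp3_cont; assumption|].
    apply tends_mult; [apply tends_const|]. apply tends_plus; apply tends_mult; assumption.
  - intros z w Hw Hz. rewrite wp2_periodic, wp_periodic by assumption. reflexivity.
  - assert (Hzz : cont (fun z => z * z) 0) by (apply tends_mult; apply cont_id).
    unfold phi. apply tends_minus; [apply tends_minus; [apply wp_reg_cont_0|]|].
    + apply tends_mult; [apply tends_const|exact Hc].
    + apply tends_mult; [apply tends_const|]. apply tends_mult; (apply tends_mult; [exact Hzz|exact Hc]).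
  - apply filter_forall. intros z Hz. unfold phi. rewrite wp_eq by assumption.
    specialize (Hpsi z). replace (0 + z) with z in Hpsi by ring. rewrite Hpsi. unfold wp2.
    pose proof (off_lattice_nonzero tau z Hz). field. assumption.
Qed.

Section HalfPeriod.
Variable w : C.
Hypothesis Hw2 : L (w + w).
Hypothesis Hw : ~ L w.

Let e := p w.
Let c := p2 w / 2.

(** At 0 the double pole of the first factor meets the double zero of the second, since [w] is
    a critical point of wp; at [w] the roles are exchanged, so that the product is invariant under
    translation by [w] too. *)
Lemma wp_half_shift (z : C) : ~ L z -> ~ L (z + w) -> (p z - e) * (p (z + w) - e) = c.
Proof.
  intros Hz1 Hz2.
  destruct (taylor_critical_zero (fun z => p z - e) p1 w (p2 w)) as [psi [Hc [E0 Hpsi]]].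
  { unfold e. ring. }
  { apply wp1_half_period; assumption. }
  { generalize (off_lattice_nbhd tau Htau w Hw). apply filter_imp. intros y Hy.
    eapply C_is_derive_val; [|apply C_is_derive_minus; [apply wp_derive; assumption|apply C_is_derive_const]]. ring. }
  { apply wp1_derive; assumption. }
  set (phi := fun z => (1 + z * z * (wp_reg tau 0 z - e)) * psi z).
  assert (Ephi : phi 0 = c) by (unfold phi; rewrite E0; unfold c; ring).
  rewrite <- Ephi.
  assert (Hz : ~ (L z \/ L (z + w))) by tauto. clear Hz1 Hz2. revert z Hz.
  apply (liouville tau Htau (fun z => L z \/ L (z + w))) with
    (f := fun z => (p z - e) * (p (z + w) - e))
    (f1 := fun z => p1 z * (p (z + w) - e) + (p z - e) * p1 (z + w)) (phi := phi).
  - auto.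
  - intros v [H|H]; [left; apply in_lattice_opp, H|right].
    replace (- v + w) with (w + w - (v + w)) by ring. apply in_lattice_minus; assumption.
  - intros u v [Hu|Hu] [Hv|Hv].
    + left. apply in_lattice_plus; assumption.
    + right. replace (u + v + w) with (u + (v + w)) by ring. apply in_lattice_plus; assumption.
    + right. replace (u + v + w) with ((u + w) + v) by ring. apply in_lattice_plus; assumption.
    + left. replace (u + v) with ((u + w) + (v + w) - (w + w)) by ring.
      apply in_lattice_minus; [apply in_lattice_plus|]; assumption.
  - intros z Hz.
    assert (Hz1 : ~ L z) by tauto. assert (Hz2 : ~ L (z + w)) by tauto.
    pose proof (off_lattice_shift_nbhd tau Htau z w Hz2) as Hs.
    generalize (filter_and _ _ (off_lattice_nbhd tau Htau z Hz1) Hs). apply filter_imp. tauto.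
  - intros z Hz. assert (Hz1 : ~ L z) by tauto. assert (Hz2 : ~ L (z + w)) by tauto.
    eapply C_is_derive_val; [|apply C_is_derive_mult; (apply C_is_derive_minus; [|apply C_is_derive_const]);
      [apply wp_derive; assumption|apply C_is_derive_shift, wp_derive; assumption]].
    cbv beta. ring.
  - intros z Hz. assert (Hz1 : ~ L z) by tauto. assert (Hz2 : ~ L (z + w)) by tauto.
    assert (forall y, ~ L y -> cont p y) by (intros; eapply C_is_derive_cont; apply wp_derive; assumption).
    assert (forall y, ~ L y -> cont p1 y) by (intros; eapply C_is_derive_cont; apply wp1_derive; assumption).
    assert (Ha : cont (fun y => p (y + w) - e) z).
    { apply tends_minus; [|apply tends_const]. apply (cont_shift p). auto. }
    assert (Hb : cont (fun y => p y - e) z).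
    { apply tends_minus; [|apply tends_const]. apply H, Hz1. }
    assert (Hd : cont (fun y => p1 (y + w)) z) by (apply (cont_shift p1); auto).
    apply tends_plus; apply tends_mult; try assumption. apply H0, Hz1.
  - intros z v Hv Hz. assert (Hz1 : ~ L z) by tauto. assert (Hz2 : ~ L (z + w)) by tauto.
    destruct Hv as [Hv|Hv].
    + rewrite wp_periodic by assumption. replace (z + v + w) with (z + w + v) by ring.
      rewrite wp_periodic by assumption. reflexivity.
    + replace (z + v + w) with (z + (v + w)) by ring. rewrite (wp_periodic tau Htau (v + w)) by assumption.
      replace (z + v) with (z + w + ((v + w) - (w + w))) by ring.
      rewrite wp_periodic by (try assumption; apply in_lattice_minus; assumption). ring.
  - unfold phi. apply tends_mult; [|exact Hc]. apply tends_plus; [apply tends_const|].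
    apply tends_mult; [apply tends_mult; apply cont_id|].
    apply tends_minus; [apply wp_reg_cont_0|apply tends_const].
  - apply filter_forall. intros z Hz. assert (Hz1 : ~ L z) by tauto.
    unfold phi. specialize (Hpsi z). cbv beta in Hpsi.
    replace (w + z) with (z + w) in Hpsi by ring. rewrite Hpsi.
    rewrite wp_eq by assumption. pose proof (off_lattice_nonzero tau z Hz1). field. assumption.
Qed.

Hypothesis Hseg : forall t : R, (0 < t <= 1)%R -> ~ L (RtoC t * w).

(** If [wp''(w) = 0], then [v = wp - e] satisfies [v'' = 6 (wp + e) v] with
    [v = v' = 0] at [w].  By Gronwall's inequality for the energy [|v|^2 + |v'|^2] along the segment
    from [w] to 0, [v] vanishes on that segment, against the pole at 0. *)
Lemma wp2_half_period_nonzero : p2 w <> 0.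
Proof.
  intros H0. destruct wp_ode as [c0 Hode].
  assert (Ec0 : c0 = - (6 * (e * e))).
  { pose proof (Hode w Hw) as E. rewrite H0 in E. fold e in E.
    replace c0 with (6 * (e * e) + c0 - 6 * (e * e)) by ring. rewrite <- E. ring. }
  (* [Hzero] below is Gronwall's inequality: [K] bounds the growth rate of [E] between [d] and
     1, and [E t * exp (K t)] increases to its value 0 at 1 *)
  pose (g := fun t : R => RtoC t * w).
  assert (Hg : forall t, rder g t w).
  { intros t. destruct (rder_line 0 w t) as [phi [E [Hc Hp]]]. exists phi. split; [exact E|].
    split; [exact Hc|]. intros s. rewrite <- Hp. unfold g. ring. }
  pose (v := fun t => p (g t) - e). pose (u := fun t => p1 (g t)).
  pose (Q := fun t => 6 * (p (g t) + e)).
  assert (Dv : forall t, (0 < t <= 1)%R -> rder v t (u t * w)).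
  { intros t Ht. apply (rder_comp (fun z => p z - e) g t (u t) w); [|apply Hg].
    eapply C_is_derive_val; [|apply C_is_derive_minus; [apply wp_derive; [exact Htau|apply Hseg, Ht]|apply C_is_derive_const]].
    unfold u. ring. }
  assert (Du : forall t, (0 < t <= 1)%R -> rder u t (Q t * v t * w)).
  { intros t Ht. apply (rder_comp p1 g t (Q t * v t) w); [|apply Hg].
    eapply C_is_derive_val; [|apply wp1_derive; [exact Htau|apply Hseg, Ht]].
    rewrite Hode by (apply Hseg, Ht). rewrite Ec0. unfold Q, v. ring. }
  assert (Hzero : forall d, (0 < d <= 1)%R -> v d = 0).
  { intros d Hd.
    destruct (continuity_ab_maj (fun t => Cmod w * (1 + Cmod (Q t)))%R d 1) as [tm [Hmax _]]; [lra| |].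
    { intros t Ht. apply continuity_pt_filterlim.
      apply (continuous_scal_r (K := R_AbsRing) (V := R_NormedModule) (Cmod w) (fun t => 1 + Cmod (Q t))%R t).
      apply (continuous_plus (fun _ : R => 1%R) (fun t => Cmod (Q t)) t); [apply continuous_const|].
      assert (HQ : tends (locally t) Q (Q t)).
      { apply tends_mult; [apply tends_const|]. apply tends_plus; [|apply tends_const].
        apply (rder_tends (fun s => p (g s)) t (p1 (g t) * w)). apply (rder_comp p g t (p1 (g t)) w); [|apply Hg].
        apply wp_derive; [exact Htau|apply Hseg; lra]. }
      apply (tends_Cmod (locally t) Q), HQ. }
    set (K := (Cmod w * (1 + Cmod (Q tm)))%R) in *.
    pose (E := fun t => (Re (v t) * Re (v t) + Im (v t) * Im (v t) + (Re (u t) * Re (u t) + Im (u t) * Im (u t)))%R).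
    pose (E1 := fun t => (2 * (Re (v t) * Re (u t * w)%C + Im (v t) * Im (u t * w)%C
        + (Re (u t) * Re (Q t * v t * w)%C + Im (u t) * Im (Q t * v t * w)%C)))%R).
    assert (DE : forall t, (0 < t <= 1)%R -> is_derive E t (E1 t)).
    { intros t Ht. destruct (proj1 (rder_Re_Im _ _ _) (Dv t Ht)) as [V1 V2].
      destruct (proj1 (rder_Re_Im _ _ _) (Du t Ht)) as [U1 U2].
      assert (Hsq : forall (h : R -> R) l, is_derive h t l -> is_derive (fun s => h s * h s)%R t (2 * (h t * l))%R).
      { intros h l Hh. replace (2 * (h t * l))%R with (l * h t + h t * l)%R by ring.
        apply (is_derive_mult h h t l l Hh Hh). intros; apply Rmult_comm. }
      unfold E. apply Hsq in V1, V2, U1, U2.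
      pose proof (is_derive_plus _ _ _ _ _ (is_derive_plus _ _ _ _ _ V1 V2) (is_derive_plus _ _ _ _ _ U1 U2)) as HH.
      replace (E1 t) with (plus (plus (2 * (Re (v t) * Re (u t * w)%C))%R (2 * (Im (v t) * Im (u t * w)%C))%R)
        (plus (2 * (Re (u t) * Re (Q t * v t * w)%C))%R (2 * (Im (u t) * Im (Q t * v t * w)%C))%R)); [exact HH|].
      unfold E1, plus; simpl. ring. }
    assert (HE : forall t, E t = (Cmod (v t) * Cmod (v t) + Cmod (u t) * Cmod (u t))%R).
    { intros t. assert (Hm : forall y : C, (Cmod y * Cmod y = Re y * Re y + Im y * Im y)%R).
      { intros y. replace (Cmod y * Cmod y)%R with (Cmod y ^ 2)%R by ring. rewrite Cmod2_alt. ring. }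
      unfold E. rewrite !Hm. reflexivity. }
    assert (Hcs : forall a b : C, (- (Cmod a * Cmod b) <= Re a * Re b + Im a * Im b)%R).
    { intros a b. replace (Re a * Re b + Im a * Im b)%R with (Re (Cconj a * b)).
      - pose proof (re_le_Cmod (Cconj a * b)) as Hr. rewrite Cmod_mult, Cmod_conj in Hr.
        apply Rabs_le_between in Hr. lra.
      - destruct a, b. unfold Cconj, Cmult, Re, Im; simpl. ring. }
    assert (HE1 : forall t, (d <= t <= 1)%R -> (0 <= E1 t + K * E t)%R).
    { intros t Ht. unfold E1. pose proof (Hcs (v t) (u t * w)) as C1.
      pose proof (Hcs (u t) (Q t * v t * w)) as C2. rewrite Cmod_mult in C1. rewrite (Cmod_mult _ w), (Cmod_mult (Q t)) in C2.
      rewrite HE.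
      pose proof (Hmax t Ht) as HK.
      set (a := Cmod (v t)) in *. set (b := Cmod (u t)) in *. set (k := Cmod w) in *. set (m := Cmod (Q t)) in *.
      assert (0 <= a)%R by apply Cmod_ge_0. assert (0 <= b)%R by apply Cmod_ge_0.
      assert (0 <= k)%R by apply Cmod_ge_0. assert (0 <= m)%R by apply Cmod_ge_0.
      assert (k * (1 + m) * (a * a + b * b) <= K * (a * a + b * b))%R by (apply Rmult_le_compat_r; nra).
      assert (k * (1 + m) * (2 * (a * b)) <= k * (1 + m) * (a * a + b * b))%R.
      { apply Rmult_le_compat_l; [apply Rmult_le_pos; lra|].
        pose proof (Rle_0_sqr (a - b)) as Hsq. unfold Rsqr in Hsq. lra. }
      lra. }
    destruct (MVT_gen (fun t => E t * exp (K * t))%R d 1 (fun t => (E1 t + K * E t) * exp (K * t))%R) as [s [Hs Es]].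
    - intros t Ht. rewrite Rmin_left, Rmax_right in Ht by lra.
      replace ((E1 t + K * E t) * exp (K * t))%R with (E1 t * exp (K * t) + E t * (K * exp (K * t)))%R by ring.
      apply (is_derive_mult E (fun t => exp (K * t))%R t).
      + apply DE. lra.
      + auto_derive; [trivial|ring].
      + intros; apply Rmult_comm.
    - intros t Ht. rewrite Rmin_left, Rmax_right in Ht by lra. apply continuity_pt_filterlim.
      apply (ex_derive_continuous (fun t => E t * exp (K * t))%R). eexists.
      apply (is_derive_mult E (fun t => exp (K * t))%R t).
      + apply DE. lra.
      + instantiate (1 := (K * exp (K * t))%R). auto_derive; [trivial|ring].
      + intros; apply Rmult_comm.
    - rewrite Rmin_left, Rmax_right in Hs by lra.
      assert (Ev1 : v 1%R = 0) by (unfold v, g; rewrite Cmult_1_l; unfold e; ring).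
      assert (Eu1 : u 1%R = 0) by (unfold u, g; rewrite Cmult_1_l; apply wp1_half_period; assumption).
      assert (E1z : E 1%R = 0%R) by (rewrite HE, Ev1, Eu1, Cmod_0; ring).
      rewrite E1z, Rmult_0_l in Es.
      pose proof (exp_pos (K * s)) as X1. pose proof (exp_pos (K * d)) as X2. pose proof (HE1 s Hs) as X3.
      assert (X4 : (0 <= (E1 s + K * E s) * exp (K * s) * (1 - d))%R).
      { apply Rmult_le_pos; [apply Rmult_le_pos; lra|lra]. }
      assert (X5 : (E d * exp (K * d) <= 0)%R) by lra.
      assert (X6 : (E d <= 0)%R) by (apply Rnot_lt_le; intros X; pose proof (Rmult_lt_0_compat _ _ X X2); lra).
      rewrite HE in X6. pose proof (Cmod_ge_0 (v d)). apply Cmod_eq_0. nra. }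
  (* [phi z = z^2 (wp z - e)] does not vanish near 0 *)
  pose (phi := fun z => 1 + z * z * (wp_reg tau 0 z - e)).
  assert (Hphi : cont phi 0).
  { apply tends_plus; [apply tends_const|]. apply tends_mult; [apply tends_mult; apply cont_id|].
    apply tends_minus; [apply wp_reg_cont_0|apply tends_const]. }
  assert (Hphi0 : phi 0 <> 0).
  { unfold phi. replace (1 + 0 * 0 * (wp_reg tau 0 0 - e)) with (RtoC 1) by ring. intros X. apply RtoC_inj in X. lra. }
  destruct (proj1 (nbhd_Cmod _ _) (tends_nonzero phi (phi 0) Hphi0 Hphi)) as [r [Hr Hn]].
  pose proof (Cmod_ge_0 w) as Hcw.
  set (d := Rmin 1 (r / (2 * (1 + Cmod w)))).
  assert (Hd : (0 < d <= 1)%R).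
  { split; [apply Rmin_pos; [lra|apply Rdiv_lt_0_compat; lra]|apply Rmin_l]. }
  apply (Hn (RtoC d * w)).
  - replace (RtoC d * w - 0) with (RtoC d * w) by ring. rewrite Cmod_mult, Cmod_R, Rabs_pos_eq by lra.
    apply Rle_lt_trans with (r / (2 * (1 + Cmod w)) * (1 + Cmod w))%R.
    + apply Rmult_le_compat; [lra|exact Hcw|apply Rmin_r|lra].
    + replace (r / (2 * (1 + Cmod w)) * (1 + Cmod w))%R with (r / 2)%R by (field; lra). lra.
  - specialize (Hzero d Hd). unfold v, g in Hzero.
    pose proof (Hseg d Hd) as Hl. rewrite wp_eq in Hzero by assumption.
    pose proof (off_lattice_nonzero tau _ Hl) as Hnz.
    unfold phi. set (z := RtoC d * w) in *.
    replace (1 + z * z * (wp_reg tau 0 z - e)) with (z * z * (/ (z * z) + wp_reg tau 0 z - e)) by (field; exact Hnz).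
    rewrite Hzero. ring.
Qed.

Lemma wp_ne_half_value (z : C) : ~ L z -> ~ L (z + w) -> p z - e <> 0.
Proof.
  intros H1 H2 E. pose proof (wp_half_shift z H1 H2) as H. rewrite E in H.
  apply wp2_half_period_nonzero. replace (p2 w) with (2 * c) by (unfold c; field).
  rewrite <- H. ring.
Qed.

Lemma wp1_half_shift (z : C) : ~ L z -> ~ L (z + w) ->
  p1 z * (p (z + w) - e) + (p z - e) * p1 (z + w) = 0.
Proof.
  intros H1 H2. apply (C_is_derive_unique (fun z => (p z - e) * (p (z + w) - e)) z).
  - eapply C_is_derive_val; [|apply C_is_derive_mult; (apply C_is_derive_minus; [|apply C_is_derive_const]);
      [apply wp_derive; assumption|apply C_is_derive_shift, wp_derive; assumption]].
    cbv beta. ring.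
  - apply C_is_derive_ext_loc with (f := fun _ => c); [|apply C_is_derive_const].
    pose proof (off_lattice_shift_nbhd tau Htau z w H2) as Hs.
    generalize (filter_and _ _ (off_lattice_nbhd tau Htau z H1) Hs). apply filter_imp.
    intros y [Y1 Y2]. symmetry. apply wp_half_shift; assumption.
Qed.

Lemma wp2_half_shift (z : C) : ~ L z -> ~ L (z + w) ->
  p2 z * (p (z + w) - e) + 2 * (p1 z * p1 (z + w)) + (p z - e) * p2 (z + w) = 0.
Proof.
  intros H1 H2. apply (C_is_derive_unique (fun z => p1 z * (p (z + w) - e) + (p z - e) * p1 (z + w)) z).
  - eapply C_is_derive_val; [|apply C_is_derive_plus; apply C_is_derive_mult;
      [apply wp1_derive; assumption|
       apply C_is_derive_minus; [apply C_is_derive_shift, wp_derive; assumption|apply C_is_derive_const]|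
       apply C_is_derive_minus; [apply wp_derive; assumption|apply C_is_derive_const]|
       apply (C_is_derive_shift p1), wp1_derive; assumption]].
    cbv beta. ring.
  - apply C_is_derive_ext_loc with (f := fun _ => 0); [|apply C_is_derive_const].
    pose proof (off_lattice_shift_nbhd tau Htau z w H2) as Hs.
    generalize (filter_and _ _ (off_lattice_nbhd tau Htau z H1) Hs). apply filter_imp.
    intros y [Y1 Y2]. symmetry. apply wp1_half_shift; assumption.
Qed.

(** Substitute [wp(z+w) = e + c/v], where [v = wp z - e], and the differential equation at [z] and
    at [z+w] into the second derivative of the half shift relation: [wp'^2] comes out as a cubic
    polynomial in [v], without integrating the differential equation. *)
Lemma wp1_square_half (z : C) : ~ L z -> ~ L (z + w) ->
  p1 z * p1 z = 4 * (p z - e) * ((p z - e) * (p z - e) + 3 * e * (p z - e) + c).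
Proof.
  intros H1 H2. destruct wp_ode as [c0 Hode].
  assert (Ec0 : c0 = 2 * c - 6 * (e * e)).
  { unfold c. rewrite (Hode w Hw). fold e. field. }
  assert (Hc : c <> 0).
  { intros E. apply wp2_half_period_nonzero. replace (p2 w) with (2 * c) by (unfold c; field). rewrite E. ring. }
  pose proof (wp_ne_half_value z H1 H2) as Hv.
  pose proof (wp_half_shift z H1 H2) as R0. pose proof (wp1_half_shift z H1 H2) as R1.
  pose proof (wp2_half_shift z H1 H2) as R2.
  rewrite (Hode z H1), (Hode _ H2), Ec0 in R2.
  set (v := p z - e) in *.
  assert (Es : p (z + w) = e + c / v) by (rewrite <- R0; field; exact Hv).
  rewrite Es in R1, R2. replace (p z) with (v + e) in R2 by (unfold v; ring).
  set (y := p1 z) in *. set (y' := p1 (z + w)) in *.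
  assert (Ey : y' = - (y * c) / (v * v)).
  { replace y' with ((y * (e + c / v - e) + v * y') / v - y * c / (v * v)) by (field; exact Hv).
    rewrite R1. field. exact Hv. }
  rewrite Ey in R2.
  assert (E : y * y - 4 * v * (v * v + 3 * e * v + c) = - (v * v / (2 * c)) *
    ((6 * ((v + e) * (v + e)) + (2 * c - 6 * (e * e))) * (e + c / v - e) +
     2 * (y * (- (y * c) / (v * v))) + v * (6 * ((e + c / v) * (e + c / v)) + (2 * c - 6 * (e * e))))).
  { field. split; assumption. }
  rewrite R2 in E. replace (y * y) with (y * y - 4 * v * (v * v + 3 * e * v + c) + 4 * v * (v * v + 3 * e * v + c)) by ring.
  rewrite E. ring.
Qed.

End HalfPeriod.
End Relations.


(** * The potential *)

Section Potential.
Variable tau : C.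
Hypothesis Htau : (0 < Im tau)%R.

Notation L := (in_lattice tau).
Notation p := (wp tau).
Notation p1 := (wp1 tau).
Notation p2 := (wp2 tau).
Notation p3 := (wp3 tau).

Definition half_lattice (z : C) : Prop := L (z + z).
Notation H := half_lattice.

Lemma lattice_coordinates (a b : R) : L (RtoC a + RtoC b * tau) ->
  exists m n : Z, a = IZR m /\ b = IZR n.
Proof.
  intros [m [n E]]. exists m, n. unfold lattice_pt in E.
  destruct tau as [x y]. unfold Im in Htau. simpl in Htau.
  unfold RtoC, Cplus, Cmult in E; simpl in E. injection E as E1 E2.
  assert (Eb : b = IZR n).
  { apply Rmult_eq_reg_r with y; lra. }
  split; [subst b; lra|exact Eb].
Qed.

Lemma not_IZR_unit (x : R) (k : Z) : (0 < x < 1)%R -> x <> IZR k.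
Proof.
  intros Hx E. subst x. destruct Hx as [H1 H2]. apply (lt_IZR 0) in H1. apply (lt_IZR k 1) in H2. lia.
Qed.

(** The second clause asks for the whole half-open segment from [w] to 0, along which the
    uniqueness argument travels; it makes [w] a half period outside the lattice. *)
Definition half_period (w : C) : Prop :=
  L (w + w) /\ forall t : R, (0 < t <= 1)%R -> ~ L (RtoC t * w).

Lemma half_period_off (w : C) : half_period w -> ~ L w.
Proof. intros [_ Hs] Hw. apply (Hs 1%R); [lra|]. rewrite Cmult_1_l. exact Hw. Qed.

Lemma half_period_1 : half_period (1 / 2).
Proof.
  split.
  - replace (1 / 2 + 1 / 2) with (RtoC 1) by field. apply in_lattice_one.
  - intros t Ht Hl. replace (RtoC t * (1 / 2)) with (RtoC (t / 2) + RtoC 0 * tau) in Hl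
      by (rewrite RtoC_div by lra; field).
    apply lattice_coordinates in Hl. destruct Hl as [m [n [E _]]]. apply (not_IZR_unit (t / 2) m); lra.
Qed.

Lemma half_period_tau : half_period (tau / 2).
Proof.
  split.
  - replace (tau / 2 + tau / 2) with tau by field. apply in_lattice_tau.
  - intros t Ht Hl. replace (RtoC t * (tau / 2)) with (RtoC 0 + RtoC (t / 2) * tau) in Hl
      by (rewrite RtoC_div by lra; field).
    apply lattice_coordinates in Hl. destruct Hl as [m [n [_ E]]]. apply (not_IZR_unit (t / 2) n); lra.
Qed.

Lemma half_period_sum : half_period ((1 + tau) / 2).
Proof.
  split.
  - replace ((1 + tau) / 2 + (1 + tau) / 2) with (1 + tau) by field.
    apply in_lattice_plus; [apply in_lattice_one|apply in_lattice_tau].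
  - intros t Ht Hl. replace (RtoC t * ((1 + tau) / 2)) with (RtoC (t / 2) + RtoC (t / 2) * tau) in Hl
      by (rewrite RtoC_div by lra; field).
    apply lattice_coordinates in Hl. destruct Hl as [m [n [_ E]]]. apply (not_IZR_unit (t / 2) n); lra.
Qed.

Lemma half_lattice_shift (z w : C) : L (w + w) -> (H (z + w) <-> H z).
Proof.
  intros Hw. unfold half_lattice. replace (z + w + (z + w)) with (z + z + (w + w)) by ring.
  apply in_lattice_shift, Hw.
Qed.

Lemma off_half_off (z : C) : ~ H z -> ~ L z.
Proof. intros Hz Hl. apply Hz. apply in_lattice_plus; exact Hl. Qed.

Lemma off_half_off_shift (z w : C) : L (w + w) -> ~ H z -> ~ L (z + w).
Proof. intros Hw Hz. apply off_half_off. rewrite half_lattice_shift; assumption. Qed.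

Lemma off_half_nbhd (z : C) : ~ H z -> nbhd z (fun y => ~ H y).
Proof.
  intros Hz. apply (nbhd_cont (fun y => y + y) z (fun y => ~ L y)).
  - apply tends_plus; apply cont_id.
  - apply off_lattice_nbhd; [exact Htau|exact Hz].
Qed.

Lemma wp_half_neg (z w : C) : L (w + w) -> ~ H z -> p (z - w) = p (z + w).
Proof.
  intros Hw Hz. rewrite <- (wp_periodic tau Htau (w + w) (z - w)).
  - f_equal. ring.
  - exact Hw.
  - replace (z - w) with (z + - w) by ring. apply off_half_off_shift; [|exact Hz].
    replace (- w + - w) with (- (w + w)) by ring. apply in_lattice_opp, Hw.
Qed.

Notation w1 := (1 / 2).
Notation w2 := (tau / 2).
Notation w3 := ((1 + tau) / 2).
Notation e1 := (p w1).
Notation e2 := (p w2).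
Notation e3 := (p w3).

Lemma qL0_eq (z : C) :
  qL0 tau z = 3 / 4 * (p z + p (z - w1) + p (z - w2) + p (z - w3)).
Proof.
  unfold qL0. rewrite !sum_Sn, sum_O. simpl omega.
  replace (z - 0 / 2) with z by field. reflexivity.
Qed.

(** The half shift relation evaluated at another half period, which translation by [w] sends to the
    third one. *)
Lemma half_shift_constant (w a b : C) : half_period w -> half_period a -> half_period b ->
  L (a + w - b) -> p2 w / 2 = (p a - p w) * (p b - p w).
Proof.
  intros Hw Ha Hb Hl. pose proof (half_period_off _ Ha) as Ha'. pose proof (half_period_off _ Hb) as Hb'.
  assert (Haw : ~ L (a + w)).
  { replace (a + w) with (b + (a + w - b)) by ring. rewrite in_lattice_shift; assumption. }
  rewrite <- (wp_half_shift tau Htau w (proj1 Hw) (half_period_off _ Hw) a Ha' Haw).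
  f_equal. f_equal. replace (a + w) with (b + (a + w - b)) by ring. apply wp_periodic; assumption.
Qed.

(** The sum of the three values vanishes because [e2] is a root of the cubic that expresses [wp'^2],
    and that cubic has [e1] as a root and [(e2 - e1) (e3 - e1)] as linear coefficient in [wp - e1]. *)
Lemma half_values :
  p2 w1 / 2 = (e2 - e1) * (e3 - e1) /\
  p2 w2 / 2 = (e1 - e2) * (e3 - e2) /\
  p2 w3 / 2 = (e1 - e3) * (e2 - e3) /\
  e1 <> e2 /\ e1 <> e3 /\ e2 <> e3 /\ e1 + e2 + e3 = 0.
Proof.
  pose proof half_period_1 as H1. pose proof half_period_tau as H2. pose proof half_period_sum as H3.
  assert (C1 : p2 w1 / 2 = (e2 - e1) * (e3 - e1)).
  { apply half_shift_constant; try assumption.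
    replace (w2 + w1 - w3) with (RtoC 0) by field. apply in_lattice_zero. }
  assert (C2 : p2 w2 / 2 = (e1 - e2) * (e3 - e2)).
  { apply half_shift_constant; try assumption.
    replace (w1 + w2 - w3) with (RtoC 0) by field. apply in_lattice_zero. }
  assert (C3 : p2 w3 / 2 = (e1 - e3) * (e2 - e3)).
  { apply half_shift_constant; try assumption.
    replace (w1 + w3 - w2) with (RtoC 1) by field. apply in_lattice_one. }
  assert (Hn : forall w, half_period w -> p2 w / 2 <> 0).
  { intros w Hw E. apply (wp2_half_period_nonzero tau Htau w (proj1 Hw) (half_period_off _ Hw) (proj2 Hw)).
    replace (p2 w) with (2 * (p2 w / 2)) by field. rewrite E. ring. }
  pose proof (Hn _ H1) as N1. pose proof (Hn _ H2) as N2. pose proof (Hn _ H3) as N3.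
  assert (N12 : e1 <> e2) by (intros E; apply N1; rewrite C1, E; ring).
  assert (N13 : e1 <> e3) by (intros E; apply N1; rewrite C1, E; ring).
  assert (N23 : e2 <> e3) by (intros E; apply N2; rewrite C2, E; ring).
  repeat (split; [assumption|]).
  assert (Hw12 : ~ L (w2 + w1)).
  { replace (w2 + w1) with w3 by field. apply half_period_off, H3. }
  pose proof (wp1_square_half tau Htau w1 (proj1 H1) (half_period_off _ H1) (proj2 H1) w2
    (half_period_off _ H2) Hw12) as E.
  rewrite (wp1_half_period tau Htau w2 (proj1 H2) (half_period_off _ H2)), C1 in E.
  assert (Hv : e2 - e1 <> 0).
  { intros X. apply N12. replace e2 with (e2 - e1 + e1) by ring. rewrite X. ring. }
  replace (e1 + e2 + e3) with
    ((4 * (e2 - e1) * ((e2 - e1) * (e2 - e1) + 3 * e1 * (e2 - e1) + (e2 - e1) * (e3 - e1)))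
      / (4 * (e2 - e1) * (e2 - e1))) by (field; exact Hv).
  rewrite <- E. field. exact Hv.
Qed.

Lemma wp_ne_half_values (z w : C) : half_period w -> ~ H z -> p z - p w <> 0.
Proof.
  intros Hw Hz. apply (wp_ne_half_value tau Htau w (proj1 Hw) (half_period_off _ Hw) (proj2 Hw)).
  - apply off_half_off, Hz.
  - apply off_half_off_shift; [exact (proj1 Hw)|exact Hz].
Qed.

Lemma wp1_square (z : C) : ~ H z -> p1 z * p1 z = 4 * ((p z - e1) * (p z - e2) * (p z - e3)).
Proof.
  intros Hz. pose proof half_period_1 as H1.
  rewrite (wp1_square_half tau Htau w1 (proj1 H1) (half_period_off _ H1) (proj2 H1) z (off_half_off z Hz)
    (off_half_off_shift z w1 (proj1 H1) Hz)).
  destruct half_values as [C1 [_ [_ [_ [_ [_ Es]]]]]]. rewrite C1.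
  replace e3 with (- e1 - e2) by (replace e3 with (e1 + e2 + e3 - e1 - e2) by ring; rewrite Es; ring).
  ring.
Qed.

Lemma wp1_nonzero (z : C) : ~ H z -> p1 z <> 0.
Proof.
  intros Hz E. pose proof (wp1_square z Hz) as S. rewrite E in S.
  apply (Cmult_neq_0 4 ((p z - e1) * (p z - e2) * (p z - e3))).
  - intros X. apply RtoC_inj in X. lra.
  - repeat apply Cmult_neq_0; apply wp_ne_half_values;
      first [exact half_period_1|exact half_period_tau|exact half_period_sum|exact Hz].
  - rewrite <- S. ring.
Qed.

Lemma wp2_cubic (z : C) : ~ L z -> p2 z = 6 * (p z * p z) - 2 * (e1 * e1 + e1 * e2 + e2 * e2).
Proof.
  intros Hz. destruct (wp_ode tau Htau) as [c0 Hode].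
  destruct half_values as [C1 [_ [_ [_ [_ [_ Es]]]]]].
  pose proof (Hode w1 (half_period_off _ half_period_1)) as E1.
  assert (Ec : c0 = 2 * ((e2 - e1) * (e3 - e1)) - 6 * (e1 * e1)).
  { rewrite <- C1, E1. field. }
  rewrite (Hode z Hz), Ec.
  replace e3 with (- e1 - e2) by (replace e3 with (e1 + e2 + e3 - e1 - e2) by ring; rewrite Es; ring).
  ring.
Qed.

Lemma wp3_eq (z : C) : ~ L z -> p3 z = 12 * p z * p1 z.
Proof.
  intros Hz. destruct (wp_ode tau Htau) as [c0 Hode].
  apply (C_is_derive_unique p2 z); [apply wp2_derive; assumption|].
  apply C_is_derive_ext_loc with (f := fun y => 6 * (p y * p y) + c0).
  - generalize (off_lattice_nbhd tau Htau z Hz). apply filter_imp. intros y Hy. symmetry. apply Hode, Hy.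
  - eapply C_is_derive_val; [|apply C_is_derive_plus; [apply C_is_derive_mult; [apply C_is_derive_const|
      apply C_is_derive_mult; apply wp_derive; assumption]|apply C_is_derive_const]].
    cbv beta. ring.
Qed.

Lemma wp_shift_value (z w : C) : half_period w -> ~ H z ->
  p (z - w) = p w + (p2 w / 2) / (p z - p w).
Proof.
  intros Hw Hz. rewrite wp_half_neg by (try exact (proj1 Hw); exact Hz).
  pose proof (wp_ne_half_values z w Hw Hz) as Hv.
  rewrite <- (wp_half_shift tau Htau w (proj1 Hw) (half_period_off _ Hw) z (off_half_off z Hz)
    (off_half_off_shift z w (proj1 Hw) Hz)).
  field. exact Hv.
Qed.

(** By the half shift relations the potential is [3/4 (x + sum_k (e_k + c_k / (x - e_k)))] with
    [x = wp z], a partial fraction expansion of the right-hand side, which is minus half the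
    Schwarzian derivative of wp. *)
Lemma qL0_schwarzian (z : C) : ~ H z ->
  qL0 tau z = 3 / 4 * (p2 z * p2 z) / (p1 z * p1 z) - 6 * p z.
Proof.
  intros Hz. rewrite qL0_eq.
  rewrite (wp_shift_value z w1 half_period_1 Hz), (wp_shift_value z w2 half_period_tau Hz),
    (wp_shift_value z w3 half_period_sum Hz).
  destruct half_values as [C1 [C2 [C3 [_ [_ [_ Es]]]]]]. rewrite C1, C2, C3.
  rewrite (wp2_cubic z (off_half_off z Hz)), (wp1_square z Hz).
  pose proof (wp_ne_half_values z w1 half_period_1 Hz) as N1.
  pose proof (wp_ne_half_values z w2 half_period_tau Hz) as N2.
  pose proof (wp_ne_half_values z w3 half_period_sum Hz) as N3.
  assert (E3 : e3 = - e1 - e2) by (replace e3 with (e1 + e2 + e3 - e1 - e2) by ring; rewrite Es; ring).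
  rewrite E3 in *. field. repeat split; assumption.
Qed.

(** Translation by a half period permutes the four terms of the potential.  Periodicity under the
    whole half lattice is periodicity of [q (u / 2)] under the lattice. *)
Lemma qL0_half_periodic (a z : C) : H a -> ~ H z -> qL0 tau (z + a) = qL0 tau z.
Proof.
  intros Ha Hz.
  assert (Hper : forall u v, ~ L (u + u) -> L v -> p (u + v) = p u).
  { intros u v Hu Hv. apply wp_periodic; [exact Htau|exact Hv|apply off_half_off, Hu]. }
  assert (Hsub : forall u w, ~ H u -> L (w + w) -> ~ H (u - w)).
  { intros u w Hu Hw. replace (u - w) with (u + - w) by ring. rewrite half_lattice_shift; [exact Hu|].
    replace (- w + - w) with (- (w + w)) by ring. apply in_lattice_opp, Hw. }
  assert (L1 := proj1 half_period_1). assert (L2 := proj1 half_period_tau). assert (L3 := proj1 half_period_sum).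
  assert (Q1 : forall u, ~ H u -> qL0 tau (u + w1) = qL0 tau u).
  { intros u Hu. rewrite !qL0_eq.
    replace (u + w1) with (u - w1 + 1) at 1 by field.
    replace (u + w1 - w1) with u by ring.
    replace (u + w1 - w2) with (u - w3 + 1) by field.
    replace (u + w1 - w3) with (u - w2) by field.
    rewrite !Hper by (first [apply in_lattice_one|apply Hsub; assumption]). ring. }
  assert (Q2 : forall u, ~ H u -> qL0 tau (u + w2) = qL0 tau u).
  { intros u Hu. rewrite !qL0_eq.
    replace (u + w2) with (u - w2 + tau) at 1 by field.
    replace (u + w2 - w1) with (u - w3 + tau) by field.
    replace (u + w2 - w2) with u by ring.
    replace (u + w2 - w3) with (u - w1) by field.
    rewrite !Hper by (first [apply in_lattice_tau|apply Hsub; assumption]). ring. }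
  pose proof (lattice_periods tau (fun u => qL0 tau (u / 2))) as HP. cbv beta in HP.
  assert (Hh : forall u, ~ L u -> ~ H (u / 2)).
  { intros u Hu. unfold half_lattice. replace (u / 2 + u / 2) with u by field. exact Hu. }
  replace (z + a) with ((z + z + (a + a)) / 2) by field. replace z with ((z + z) / 2) at 3 by field.
  apply HP; [| |exact Ha|exact Hz].
  - intros u Hu. replace ((u + 1) / 2) with (u / 2 + w1) by field. apply Q1, Hh, Hu.
  - intros u Hu. replace ((u + tau) / 2) with (u / 2 + w2) by field. apply Q2, Hh, Hu.
Qed.

(** Translated to 0, [y^2 q] extends continuously with the value 3/4; continuity of [q] would force
    the value 0. *)
Lemma half_lattice_singular (a : C) : H a -> ~ cont (qL0 tau) a.
Proof.
  intros Ha Hc.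
  pose (chi := fun y => y * y * qL0 tau (y + a)).
  pose (phi := fun y => 3 / 4 * (1 + y * y * (wp_reg tau 0 y + p (y - w1) + p (y - w2) + p (y - w3)))).
  assert (Hyy : cont (fun y => y * y) 0) by (apply tends_mult; apply cont_id).
  assert (Hchi : cont chi 0).
  { apply tends_mult; [exact Hyy|]. apply (cont_shift (qL0 tau)).
    replace (0 + a) with a by ring. exact Hc. }
  assert (Hp : forall w, half_period w -> cont (fun y => p (y - w)) 0).
  { intros w Hw. apply (cont_shift p (- w)). eapply C_is_derive_cont. apply wp_derive; [exact Htau|].
    replace (0 + - w) with (- w) by ring. intros Hl. apply (half_period_off _ Hw).
    replace w with (- - w) by ring. apply in_lattice_opp, Hl. }
  assert (Hphi : cont phi 0).
  { apply tends_mult; [apply tends_const|]. apply tends_plus; [apply tends_const|].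
    apply tends_mult; [exact Hyy|]. repeat apply tends_plus;
      [apply wp_reg_cont_0, Htau|apply Hp, half_period_1|apply Hp, half_period_tau|apply Hp, half_period_sum]. }
  assert (He : (0 < 1 / 4)%R) by lra.
  destruct (proj1 (nbhd_Cmod _ _) (filter_and _ _ (Hchi _ He) (Hphi _ He))) as [d [Hd Hball]].
  set (t := Rmin (d / 2) (1 / 4)).
  assert (Ht : (0 < t)%R) by (apply Rmin_pos; lra).
  assert (Ht1 : (t <= d / 2)%R) by apply Rmin_l. assert (Ht2 : (t <= 1 / 4)%R) by apply Rmin_r.
  assert (HHt : ~ H (RtoC t)).
  { unfold half_lattice. intros Hl.
    replace (RtoC t + RtoC t) with (RtoC (t + t) + RtoC 0 * tau) in Hl by (rewrite RtoC_plus; ring).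
    apply lattice_coordinates in Hl. destruct Hl as [m [n [E _]]]. apply (not_IZR_unit (t + t) m); lra. }
  destruct (Hball (RtoC t)) as [B1 B2].
  { replace (RtoC t - 0) with (RtoC t) by ring. rewrite Cmod_R, Rabs_pos_eq by lra. lra. }
  assert (E : chi (RtoC t) = phi (RtoC t)).
  { unfold chi, phi. rewrite qL0_half_periodic by assumption. rewrite qL0_eq.
    rewrite (wp_eq tau Htau (RtoC t)) by (apply off_half_off, HHt).
    field. intros X. apply RtoC_inj in X. lra. }
  assert (E0 : chi 0 = 0) by (unfold chi; ring).
  assert (E1 : phi 0 = 3 / 4) by (unfold phi; field).
  rewrite E, E0 in B1. rewrite E1 in B2.
  pose proof (Cmod_triangle (phi (RtoC t) - 0) (- (phi (RtoC t) - 3 / 4))) as T. rewrite Cmod_opp in T.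
  replace (phi (RtoC t) - 0 + - (phi (RtoC t) - 3 / 4)) with (RtoC (3 / 4)) in T
    by (rewrite RtoC_div by lra; ring).
  rewrite Cmod_R, Rabs_pos_eq in T by lra. lra.
Qed.

Lemma nonsingular_off_half (z : C) : ~ singularity (qL0 tau) z -> ~ H z.
Proof.
  intros Hs Hz. apply (half_lattice_singular z Hz).
  apply NNPP in Hs. apply nbhd_self in Hs. destruct Hs as [l Hl].
  eapply C_is_derive_cont, Hl.
Qed.

End Potential.


(** * Square roots along a line *)

Lemma rder_mult (f g : R -> C) (t : R) (u v : C) :
  rder f t u -> rder g t v -> rder (fun s => f s * g s) t (u * g t + f t * v).
Proof.
  intros Hf Hg. pose proof (rder_tends _ _ _ Hg) as Cg.
  destruct Hf as [a [Ea [Ca Ha]]], Hg as [b [Eb [Cb Hb]]].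
  exists (fun s => a s * g s + f t * b s). split; [rewrite Ea, Eb; reflexivity|]. split.
  - apply tends_plus; apply tends_mult; try assumption. apply tends_const.
  - intros s. replace (f s * g s - f t * g t) with ((f s - f t) * g s + f t * (g s - g t)) by ring.
    rewrite Ha, Hb. ring.
Qed.

Lemma rder_zero_const (f : R -> C) : (forall t, rder f t 0) -> forall a b, f a = f b.
Proof.
  intros H.
  assert (Hlt : forall a b, (a < b)%R -> f a = f b).
  { intros a b Hab.
    assert (E1 : Re (f a) = Re (f b)).
    { apply (eq_is_derive (V := R_NormedModule) (fun t => Re (f t))); [|exact Hab].
      intros t _. apply (rder_Re_Im f t 0), H. }
    assert (E2 : Im (f a) = Im (f b)).
    { apply (eq_is_derive (V := R_NormedModule) (fun t => Im (f t))); [|exact Hab].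
      intros t _. apply (rder_Re_Im f t 0), H. }
    destruct (f a), (f b). unfold Re, Im in *; simpl in *. f_equal; assumption. }
  intros a b. destruct (Rtotal_order a b) as [X|[X|X]]; [auto|subst; reflexivity|symmetry; auto].
Qed.

Lemma path_primitive (l : R -> C) : (forall t, tends (locally t) l (l t)) ->
  exists A : R -> C, forall t, rder A t (l t).
Proof.
  intros H.
  assert (Hp : forall h : R -> R, (forall t, continuous h t) -> forall t, is_derive (fun x => RInt h 0 x) t (h t)).
  { intros h Hh t. apply (is_derive_RInt h (fun x => RInt h 0 x) 0 t); [|apply Hh].
    apply filter_forall. intros b. apply (RInt_correct (V := R_CompleteNormedModule)).
    apply (ex_RInt_continuous (V := R_CompleteNormedModule)). intros; apply Hh. }
  exists (fun t => (RInt (fun s => Re (l s)) 0 t, RInt (fun s => Im (l s)) 0 t)).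
  intros t. apply rder_Re_Im. split.
  - apply (Hp (fun s => Re (l s))). intros s. apply (tends_Re_Im (locally s)), H.
  - apply (Hp (fun s => Im (l s))). intros s. apply (tends_Re_Im (locally s)), H.
Qed.

Lemma rder_cexp (A : R -> C) (t : R) (l : C) : rder A t l ->
  rder (fun s => RtoC (exp (Re (A s))) * cis (Im (A s))) t (l * (RtoC (exp (Re (A t))) * cis (Im (A t)))).
Proof.
  intros H. apply rder_Re_Im in H. destruct H as [Ha Hb].
  assert (Hreal : forall (a b : R -> R) (la lb : R), is_derive a t la -> is_derive b t lb ->
    is_derive (fun s => exp (a s) * cos (b s))%R t (la * (exp (a t) * cos (b t)) - lb * (exp (a t) * sin (b t)))%R /\
    is_derive (fun s => exp (a s) * sin (b s))%R t (la * (exp (a t) * sin (b t)) + lb * (exp (a t) * cos (b t)))%R).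
  { intros a b la lb Da Db.
    assert (Xa : ex_derive a t) by (eexists; exact Da).
    assert (Xb : ex_derive b t) by (eexists; exact Db).
    apply is_derive_unique in Da, Db.
    split; (auto_derive; [repeat split; assumption|]); change (fun x => a x) with a; change (fun x => b x) with b;
      rewrite Da, Db; ring. }
  destruct (Hreal _ _ _ _ Ha Hb) as [D1 D2]. apply rder_Re_Im. split.
  - replace (Re (l * (RtoC (exp (Re (A t))) * cis (Im (A t))))) with
      (Re l * (exp (Re (A t)) * cos (Im (A t))) - Im l * (exp (Re (A t)) * sin (Im (A t))))%R
      by (unfold cis, RtoC, Cmult, Re, Im; simpl; ring).
    revert D1. apply is_derive_ext. intros s. unfold cis, RtoC, Cmult, Re, Im; simpl. ring.
  - replace (Im (l * (RtoC (exp (Re (A t))) * cis (Im (A t))))) with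
      (Re l * (exp (Re (A t)) * sin (Im (A t))) + Im l * (exp (Re (A t)) * cos (Im (A t))))%R
      by (unfold cis, RtoC, Cmult, Re, Im; simpl; ring).
    revert D2. apply is_derive_ext. intros s. unfold cis, RtoC, Cmult, Re, Im; simpl. ring.
Qed.

(** The principal square root, without arguments: [x + |x|] bisects the angle between [x] and the
    positive real axis. *)
Definition csqrt (x : C) : C := (x + RtoC (Cmod x)) * / RtoC (sqrt (2 * (Re x + Cmod x))).

Lemma csqrt_square (x : C) : (0 < Re x + Cmod x)%R -> csqrt x * csqrt x = x.
Proof.
  intros Hx. unfold csqrt. set (s := sqrt (2 * (Re x + Cmod x))).
  assert (Hs : (s * s = 2 * (Re x + Cmod x))%R) by (apply sqrt_sqrt; lra).
  assert (Hs0 : (0 < s)%R) by (apply sqrt_lt_R0; lra).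
  assert (Hsn : RtoC s <> 0) by (intros X; apply RtoC_inj in X; lra).
  assert (E : (x + RtoC (Cmod x)) * (x + RtoC (Cmod x)) = x * (RtoC s * RtoC s)).
  { rewrite <- RtoC_mult, Hs. pose proof (Cmod2_alt x) as Hm.
    destruct x as [a b]. set (m := Cmod (a, b)) in *. unfold Re, Im in Hm; simpl in Hm.
    unfold RtoC, Cplus, Cmult, Re; simpl. f_equal; nra. }
  replace ((x + RtoC (Cmod x)) * / RtoC s * ((x + RtoC (Cmod x)) * / RtoC s))
    with ((x + RtoC (Cmod x)) * (x + RtoC (Cmod x)) / (RtoC s * RtoC s)) by (field; exact Hsn).
  rewrite E. field. exact Hsn.
Qed.

Lemma csqrt_cont (x : C) : (0 < Re x)%R -> cont csqrt x.
Proof.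
  intros Hx. pose proof (Cmod_ge_0 x) as Hm.
  assert (HRe : filterlim Re (nbhd x) (locally (Re x))).
  { apply (tends_Re_Im (nbhd x) (fun y => y) x). apply cont_id. }
  assert (HCm : filterlim Cmod (nbhd x) (locally (Cmod x))).
  { apply (tends_Cmod (nbhd x) (fun y => y)), cont_id. }
  unfold cont, csqrt. apply tends_mult.
  - apply tends_plus; [apply cont_id|]. apply tends_RtoC; [apply filter_filter|exact HCm].
  - apply tends_inv.
    + intros X. apply RtoC_inj in X. pose proof (sqrt_lt_R0 (2 * (Re x + Cmod x))) as Y. lra.
    + apply tends_RtoC; [apply filter_filter|].
      apply (filterlim_comp _ _ _ (fun y => 2 * (Re y + Cmod y))%R sqrt) with (G := locally (2 * (Re x + Cmod x))%R).
      * apply (filterlim_comp_2 (G := locally 2%R) (H := locally (Re x + Cmod x)%R)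
          (fun _ : C => 2%R) (fun y => Re y + Cmod y)%R Rmult).
        -- apply filterlim_const.
        -- apply (filterlim_comp_2 (G := locally (Re x)) (H := locally (Cmod x)) Re Cmod Rplus HRe HCm).
           apply (filterlim_plus (K := R_AbsRing) (V := R_NormedModule)).
        -- apply (filterlim_mult (K := R_AbsRing)).
      * apply continuity_pt_filterlim. apply continuity_pt_sqrt. lra.
Qed.

(** The formula of [csqrt] fails on the negative real axis only. *)
Lemma C_sqrt_exists (x : C) : exists s, s * s = x.
Proof.
  pose proof (re_le_Cmod x) as Hr. apply Rabs_le_between in Hr.
  destruct (Rle_lt_dec (Re x + Cmod x) 0) as [H|H].
  - assert (E : Re x = (- Cmod x)%R) by lra.
    pose proof (Cmod2_alt x) as Hm. rewrite E in Hm.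
    assert (Im x = 0%R) by nra.
    exists (Ci * RtoC (sqrt (Cmod x))).
    replace (Ci * RtoC (sqrt (Cmod x)) * (Ci * RtoC (sqrt (Cmod x))))
      with (Ci * Ci * (RtoC (sqrt (Cmod x)) * RtoC (sqrt (Cmod x)))) by ring.
    rewrite <- RtoC_mult, sqrt_sqrt by apply Cmod_ge_0.
    transitivity (RtoC (Re x)).
    + rewrite E. unfold Ci, Cmult, RtoC; simpl. f_equal; ring.
    + destruct x. unfold RtoC, Re, Im in *; simpl in *. congruence.
  - exists (csqrt x). apply csqrt_square. exact H.
Qed.

(** With [A] a primitive of [h'/(2h)], the quotient [exp(A)^2 / h] is constant. *)
Lemma path_sqrt (h h1 : R -> C) : (forall t, h t <> 0) -> (forall t, rder h t (h1 t)) ->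
  (forall t, tends (locally t) h1 (h1 t)) ->
  exists G : R -> C, (forall t, tends (locally t) G (G t)) /\ forall t, G t * G t = h t.
Proof.
  intros Hn Hd Hc.
  assert (Hch : forall t, tends (locally t) h (h t)) by (intros t; eapply rder_tends, Hd).
  destruct (path_primitive (fun t => h1 t * / h t / 2)) as [A HA].
  { intros t. apply tends_mult; [|apply tends_const]. apply tends_mult; [apply Hc|].
    apply tends_inv; [apply Hn|apply Hch]. }
  pose (E := fun s => RtoC (exp (Re (A s))) * cis (Im (A s))).
  assert (HE : forall t, rder E t (h1 t * / h t / 2 * E t)) by (intros t; apply rder_cexp, HA).
  assert (Hinv : forall t, rder (fun s => / h s) t (- (1) / (h t * h t) * h1 t)).
  { intros t. apply (rder_comp (fun z => / z) h t (- (1) / (h t * h t)) (h1 t)); [|apply Hd].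
    apply (C_is_derive_inv (fun z => z)); [apply Hn|apply C_is_derive_id]. }
  assert (Hconst : forall a b, E a * E a * / h a = E b * E b * / h b).
  { apply (rder_zero_const (fun s => E s * E s * / h s)). intros t.
    eapply rder_val; [|apply rder_mult; [apply rder_mult; apply HE|apply Hinv]].
    cbv beta. field. apply Hn. }
  assert (HE0 : E 0%R <> 0).
  { unfold E. apply Cmult_neq_0.
    - intros X. apply RtoC_inj in X. pose proof (exp_pos (Re (A 0%R))). lra.
    - apply Cmod_gt_0. rewrite cis_norm. lra. }
  destruct (C_sqrt_exists (h 0%R / (E 0%R * E 0%R))) as [s Hs].
  exists (fun t => s * E t). split.
  - intros t. apply tends_mult; [apply tends_const|]. eapply rder_tends, HE.
  - intros t. replace (s * E t * (s * E t)) with (s * s * (E t * E t * / h t) * h t) by (field; apply Hn).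
    rewrite Hs, (Hconst t 0%R). field. split; [apply Hn|exact HE0].
Qed.

(** The quotient by the value at one point is real, continuous, and equal to 1 or -1
    everywhere. *)
Lemma path_square_const (r : R -> C) (k : C) : k <> 0 -> (forall t, tends (locally t) r (r t)) ->
  (forall t, r t * r t = k) -> forall a b, r a = r b.
Proof.
  intros Hk Hc Hsq a b.
  assert (Hn : r a <> 0) by (intros X; apply Hk; rewrite <- (Hsq a), X; ring).
  pose (f := fun t => r t / r a).
  assert (Hf1 : forall t, f t * f t = 1).
  { intros t. unfold f. replace (r t / r a * (r t / r a)) with (r t * r t / (r a * r a)) by (field; exact Hn).
    rewrite !Hsq. field. exact Hk. }
  assert (Hpm : forall t, f t = 1 \/ f t = - (1)).
  { intros t. assert (E : (f t - 1) * (f t + 1) = 0).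
    { replace ((f t - 1) * (f t + 1)) with (f t * f t - 1) by ring. rewrite Hf1. ring. }
    destruct (classic (f t - 1 = 0)) as [X|X].
    - left. replace (f t) with (f t - 1 + 1) by ring. rewrite X. ring.
    - right. assert (Y : f t + 1 = 0).
      { apply NNPP. intros Y. exact (Cmult_neq_0 _ _ X Y E). }
      replace (f t) with (f t + 1 - 1) by ring. rewrite Y. ring. }
  assert (Hcf : continuity (fun t => Re (f t))).
  { intros t. apply continuity_pt_filterlim.
    apply (tends_Re_Im (locally t) f (f t)). apply tends_mult; [apply Hc|apply tends_const]. }
  assert (Ea : f a = 1) by (unfold f; field; exact Hn).
  destruct (Hpm b) as [Eb|Eb].
  - replace (r b) with (f b * r a) by (unfold f; field; exact Hn). rewrite Eb. ring.
  - exfalso. destruct (IVT_gen (fun t => Re (f t)) a b 0 Hcf) as [s [_ Hs]].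
    + rewrite Ea, Eb. unfold Re, Copp, RtoC; simpl.
      rewrite Rmin_right, Rmax_left by lra. lra.
    + destruct (Hpm s) as [X|X]; rewrite X in Hs; unfold Re, Copp, RtoC in Hs; simpl in Hs; lra.
Qed.

Lemma C_is_derive_sqrt (f g : C -> C) (z l : C) :
  cont g z -> g z <> 0 -> nbhd z (fun y => g y * g y = f y) -> C_is_derive f z l ->
  C_is_derive g z (l / (2 * g z)).
Proof.
  intros Hg Hn Hsq Hf. apply C_is_derive_caratheodory in Hf. destruct Hf as [phi [E [Hc Hf]]].
  pose (psi := fun y => phi y * / (g y + g z)).
  assert (H2 : g z + g z <> 0).
  { replace (g z + g z) with (2 * g z) by ring. apply Cmult_neq_0; [|exact Hn].
    intros X. apply RtoC_inj in X. lra. }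
  assert (Hsum : tends (nbhd z) (fun y => g y + g z) (g z + g z)).
  { apply tends_plus; [exact Hg|apply tends_const]. }
  apply C_is_derive_ext_loc with (f := fun y => g z + psi y * (y - z)).
  - generalize (filter_and _ _ Hsq (tends_nonzero _ _ H2 Hsum)). apply filter_imp.
    intros y [Hy Hny]. unfold psi.
    replace (phi y * / (g y + g z) * (y - z)) with ((phi y * (y - z)) * / (g y + g z)) by ring.
    rewrite <- Hf, <- Hy, <- (nbhd_self _ _ Hsq). field. exact Hny.
  - apply C_is_derive_caratheodory. exists psi. split; [unfold psi; rewrite E; field; split; [exact Hn|exact H2]|].
    split; [|intros y; ring].
    apply tends_mult; [exact Hc|apply tends_inv; assumption].
Qed.


(** * Antiperiodic solutions along a line *)

Section Line.
Variable tau : C.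
Hypothesis Htau : (0 < Im tau)%R.
Variables z0 w : C.
Hypothesis Lw : in_lattice tau w.
Hypothesis Hh : half_period tau (w / 2).
Hypothesis Hline : forall t : R, ~ half_lattice tau (z0 + RtoC t * w).

Notation L := (in_lattice tau).
Notation H := (half_lattice tau).
Notation p := (wp tau).
Notation p1 := (wp1 tau).
Notation p2 := (wp2 tau).
Notation p3 := (wp3 tau).
Notation q := (qL0 tau).

Let pt (t : R) : C := z0 + RtoC t * w.

Lemma w_nonzero : w <> 0.
Proof.
  intros E. apply (half_period_off tau _ Hh). rewrite E.
  replace (0 / 2) with (RtoC 0) by field. apply in_lattice_zero.
Qed.

(** The sign.  With [h = w/2] and [v = wp - e] on the line, [r t = G (t + 1/2) v t / G t] has constant
    square [-c], hence is constant; going on by another half period multiplies [G] by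
    [r^2 / (v t * v (t + 1/2)) = -c / c]. *)
Lemma line_sqrt_antiperiodic : exists G : R -> C,
  (forall t, tends (locally t) G (G t)) /\ (forall t, G t * G t = p1 (pt t)) /\
  forall t, G (t + 1)%R = - G t.
Proof.
  assert (Hrd : forall t, rder pt t w) by (intros t; apply rder_line).
  assert (Hoff : forall t, ~ L (pt t)) by (intros t; apply off_half_off, Hline).
  assert (Hpn : forall t, p1 (pt t) <> 0) by (intros t; apply wp1_nonzero; [exact Htau|apply Hline]).
  assert (Hd1 : forall t, rder (fun s => p1 (pt s)) t (p2 (pt t) * w)).
  { intros t. apply (rder_comp p1 pt t (p2 (pt t)) w); [|apply Hrd]. apply wp1_derive; [exact Htau|apply Hoff]. }
  assert (Hc2 : forall t, tends (locally t) (fun s => p2 (pt s) * w) (p2 (pt t) * w)).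
  { intros t. apply tends_mult; [|apply tends_const].
    apply (tends_comp (locally t) pt p2 (pt t)); [eapply rder_tends, Hrd|].
    eapply C_is_derive_cont. apply wp2_derive; [exact Htau|apply Hoff]. }
  destruct (path_sqrt (fun s => p1 (pt s)) (fun s => p2 (pt s) * w) Hpn Hd1 Hc2) as [G [HGc HG]].
  exists G. split; [exact HGc|]. split; [exact HG|].
  set (h := w / 2) in *. set (e := p h). set (c := p2 h / 2).
  pose proof (proj1 Hh) as Hh2. pose proof (half_period_off tau _ Hh) as Hh1. pose proof (proj2 Hh) as Hh3.
  assert (Epth : forall t, pt (t + 1 / 2)%R = pt t + h).
  { intros t. unfold pt, h. rewrite RtoC_plus, RtoC_div by lra. field. }
  assert (Hoffh : forall t, ~ L (pt t + h)) by (intros t; rewrite <- Epth; apply Hoff).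
  assert (Hc0 : c <> 0).
  { intros X. apply (wp2_half_period_nonzero tau Htau h Hh2 Hh1 Hh3).
    replace (p2 h) with (2 * c) by (unfold c; field). rewrite X. ring. }
  pose (v := fun t => p (pt t) - e).
  assert (Hv : forall t, v t <> 0).
  { intros t. exact (wp_ne_half_value tau Htau h Hh2 Hh1 Hh3 (pt t) (Hoff t) (Hoffh t)). }
  assert (Hvv : forall t, v t * v (t + 1 / 2)%R = c).
  { intros t. unfold v. rewrite Epth. exact (wp_half_shift tau Htau h Hh2 Hh1 (pt t) (Hoff t) (Hoffh t)). }
  assert (Hp1h : forall t, p1 (pt (t + 1 / 2)%R) * (v t * v t) = - c * p1 (pt t)).
  { intros t. pose proof (wp1_half_shift tau Htau h Hh2 Hh1 (pt t) (Hoff t) (Hoffh t)) as E.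
    rewrite <- Epth in E. fold e in E. fold (v t) in E. fold (v (t + 1 / 2)%R) in E.
    replace (p1 (pt (t + 1 / 2)%R) * (v t * v t)) with
      (v t * (p1 (pt t) * v (t + 1 / 2)%R + v t * p1 (pt (t + 1 / 2)%R)) - (v t * v (t + 1 / 2)%R) * p1 (pt t)) by ring.
    rewrite E, Hvv. ring. }
  assert (HGn : forall t, G t <> 0).
  { intros t X. apply (Hpn t). rewrite <- HG, X. ring. }
  pose (r := fun t => G (t + 1 / 2)%R * v t / G t).
  assert (Hr2 : forall t, r t * r t = - c).
  { intros t. unfold r.
    replace (G (t + 1 / 2)%R * v t / G t * (G (t + 1 / 2)%R * v t / G t)) with
      (G (t + 1 / 2)%R * G (t + 1 / 2)%R * (v t * v t) / (G t * G t)) by (field; apply HGn).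
    rewrite !HG, Hp1h. field. apply Hpn. }
  assert (Hrc : forall t, tends (locally t) r (r t)).
  { intros t. apply tends_mult; [apply tends_mult|apply tends_inv; [apply HGn|apply HGc]].
    - intros eps Heps. specialize (HGc (t + 1 / 2)%R eps Heps).
      destruct HGc as [d Hd]. exists d. intros s Hs. apply Hd.
      change (Rabs (s + 1 / 2 - (t + 1 / 2)) < d)%R. change (Rabs (s - t) < d)%R in Hs.
      replace (s + 1 / 2 - (t + 1 / 2))%R with (s - t)%R by ring. exact Hs.
    - apply tends_minus; [|apply tends_const].
      apply (tends_comp (locally t) pt p (pt t)); [eapply rder_tends, Hrd|].
      eapply C_is_derive_cont. apply wp_derive; [exact Htau|apply Hoff]. }
  intros t.
  assert (Hnc : - c <> 0).
  { intros X. apply Hc0. replace c with (- - c) by ring. rewrite X. ring. }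
  pose proof (path_square_const r (- c) Hnc Hrc Hr2 (t + 1 / 2)%R t) as Er.
  assert (E1 : G (t + 1 / 2)%R = r t * G t / v t) by (unfold r; field; repeat split; first [apply Hv|apply HGn]).
  assert (E2 : G (t + 1)%R = r (t + 1 / 2)%R * G (t + 1 / 2)%R / v (t + 1 / 2)%R).
  { unfold r. replace (t + 1 / 2 + 1 / 2)%R with (t + 1)%R by field. field; repeat split; first [apply Hv|apply HGn]. }
  rewrite E2, Er, E1.
  replace (r t * (r t * G t / v t) / v (t + 1 / 2)%R) with (r t * r t * G t / (v t * v (t + 1 / 2)%R))
    by (field; split; apply Hv).
  rewrite Hr2, Hvv. field. exact Hc0.
Qed.

(** The parameter of the projection of [z] to the line along [i w]. *)
Let tc (z : C) : R := Re ((z - z0) / w).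

Lemma tc_pt (t : R) : tc (pt t) = t.
Proof.
  unfold tc, pt. replace ((z0 + RtoC t * w - z0) / w) with (RtoC t) by (field; exact w_nonzero). reflexivity.
Qed.

Lemma tc_shift (z : C) : tc (z + w) = (tc z + 1)%R.
Proof.
  unfold tc. replace ((z + w - z0) / w) with ((z - z0) / w + 1) by (field; exact w_nonzero). reflexivity.
Qed.

Lemma tc_cont (z : C) : filterlim tc (nbhd z) (locally (tc z)).
Proof.
  apply (tends_Re_Im (nbhd z) (fun y => (y - z0) / w) ((z - z0) / w)).
  apply tends_mult; [|apply tends_const]. apply tends_minus; [apply cont_id|apply tends_const].
Qed.

(** Off the line the root is continued by the principal root of [wp' z / wp' (projection of z)], which
    is near 1; this quotient has period [w], so the sign is that on the line. *)
Lemma near_line_sqrt_antiperiodic : exists g : C -> C,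
  near_line z0 w (fun z => ~ H z /\ cont g z /\ g z * g z = p1 z /\ g (z + w) = - g z).
Proof.
  destruct line_sqrt_antiperiodic as [G [HGc [HG HGa]]].
  pose (base := fun z => z0 + RtoC (tc z) * w).
  pose (ratio := fun z => p1 z / p1 (base z)).
  exists (fun z => G (tc z) * csqrt (ratio z)). intros t.
  change (nbhd (pt t) (fun z => ~ H z /\ cont (fun z => G (tc z) * csqrt (ratio z)) z /\
     G (tc z) * csqrt (ratio z) * (G (tc z) * csqrt (ratio z)) = p1 z /\
     G (tc (z + w)) * csqrt (ratio (z + w)) = - (G (tc z) * csqrt (ratio z)))).
  assert (Hp1c : forall z, ~ H z -> cont p1 z).
  { intros z Hz. eapply C_is_derive_cont. apply wp1_derive; [exact Htau|apply off_half_off, Hz]. }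
  assert (Hbase : forall z, ~ H (base z)) by (intros z; apply Hline).
  assert (Hn : forall z, p1 (base z) <> 0) by (intros z; apply wp1_nonzero; [exact Htau|apply Hbase]).
  assert (Hratio : forall z, ~ H z -> cont ratio z).
  { intros z Hz. apply tends_mult; [apply Hp1c, Hz|]. apply tends_inv; [apply Hn|].
    apply (cont_comp p1 base z); [|apply Hp1c, Hbase].
    apply tends_plus; [apply tends_const|]. apply tends_mult; [|apply tends_const].
    apply tends_RtoC; [apply filter_filter|apply tc_cont]. }
  assert (Hr1 : ratio (pt t) = 1).
  { unfold ratio. replace (base (pt t)) with (pt t) by (unfold base; rewrite tc_pt; reflexivity).
    field. apply wp1_nonzero; [exact Htau|apply Hline]. }
  assert (Hpos : nbhd (pt t) (fun z => (0 < Re (ratio z))%R)).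
  { apply (nbhd_cont ratio (pt t) (fun x => (0 < Re x)%R) (Hratio _ (Hline t))). rewrite Hr1.
    apply nbhd_Cmod. exists 1%R. split; [lra|]. intros y Hy.
    pose proof (re_le_Cmod (y - 1)) as X. apply Rabs_le_between in X.
    change (Re (y - 1)) with (Re y - 1)%R in X. lra. }
  generalize (filter_and _ _ (off_half_nbhd tau Htau (pt t) (Hline t)) Hpos). apply filter_imp.
  intros z [Hz Hre]. split; [exact Hz|]. split; [|split].
  - apply tends_mult.
    + intros eps Heps. exact (tc_cont z _ (HGc (tc z) eps Heps)).
    + apply (cont_comp csqrt ratio z); [apply Hratio, Hz|apply csqrt_cont, Hre].
  - replace (G (tc z) * csqrt (ratio z) * (G (tc z) * csqrt (ratio z)))
      with ((G (tc z) * G (tc z)) * (csqrt (ratio z) * csqrt (ratio z))) by ring.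
    rewrite HG, csqrt_square by (pose proof (Cmod_ge_0 (ratio z)); lra).
    unfold ratio. change (pt (tc z)) with (base z). field. apply Hn.
  - rewrite tc_shift, HGa.
    replace (ratio (z + w)) with (ratio z); [ring|]. unfold ratio.
    assert (Eb : base (z + w) = base z + w) by (unfold base; rewrite tc_shift, RtoC_plus; ring).
    rewrite Eb, !wp1_periodic; try assumption; try reflexivity; apply off_half_off; [apply Hbase|exact Hz].
Qed.

(** The basis [1/g], [wp/g] with its derivatives, where [g^2 = wp']. *)
Lemma line_basis : exists u1 u2 d1 d2 : C -> C,
  near_line z0 w (fun z => ode_at q u1 d1 z /\ ode_at q u2 d2 z /\ u1 z * d2 z - u2 z * d1 z = 1 /\
    u1 (z + w) = - u1 z /\ u2 (z + w) = - u2 z).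
Proof.
  destruct near_line_sqrt_antiperiodic as [g Hg].
  exists (fun z => / g z), (fun z => p z * / g z),
    (fun z => - (p2 z * / (2 * (g z * g z * g z)))),
    (fun z => g z - p z * p2 z * / (2 * (g z * g z * g z))).
  intros t. specialize (Hg t). apply nbhd_nbhd in Hg. unfold nbhd in Hg. revert Hg. apply filter_imp.
  intros z Hz. pose proof (nbhd_self _ _ Hz) as [HHz [Hgc [Hg2 Hga]]].
  pose proof (off_half_off tau z HHz) as Hoff.
  assert (Hgn : g z <> 0).
  { intros X. apply (wp1_nonzero tau Htau z HHz). rewrite <- Hg2, X. ring. }
  assert (H2 : RtoC 2 <> 0) by (intros X; apply RtoC_inj in X; lra).
  assert (Dg : C_is_derive g z (p2 z / (2 * g z))).
  { apply (C_is_derive_sqrt p1); [exact Hgc|exact Hgn| |apply wp1_derive; assumption].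
    revert Hz. apply filter_imp. tauto. }
  assert (Dp : C_is_derive p z (p1 z)) by (apply wp_derive; assumption).
  assert (Dp2 : C_is_derive p2 z (p3 z)) by (apply wp2_derive; assumption).
  assert (Hden : 2 * (g z * g z * g z) <> 0) by (repeat apply Cmult_neq_0; assumption).
  assert (Eq : q z = 3 / 4 * (p2 z * p2 z) / (g z * g z * (g z * g z)) - 6 * p z).
  { rewrite (qL0_schwarzian tau Htau z HHz), <- Hg2. reflexivity. }
  assert (E3 : p3 z = 12 * p z * (g z * g z)) by (rewrite Hg2; apply wp3_eq; assumption).
  assert (D1 : C_is_derive (fun z => / g z) z (- (p2 z * / (2 * (g z * g z * g z))))).
  { eapply C_is_derive_val; [|apply C_is_derive_inv; [exact Hgn|exact Dg]]. field. exact Hgn. }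
  assert (D3 : C_is_derive (fun z => / (2 * (g z * g z * g z))) z (- (3 * p2 z) / (4 * (g z * g z * g z * g z * g z)))).
  { eapply C_is_derive_val; [|apply (C_is_derive_inv (fun z => 2 * (g z * g z * g z))); [exact Hden|
      apply C_is_derive_mult; [apply C_is_derive_const|apply C_is_derive_mult; [apply C_is_derive_mult|]; exact Dg]]].
    cbv beta. field. exact Hgn. }
  split; [|split; [|split; [|split]]].
  - split; [exact D1|].
    eapply C_is_derive_val; [|apply C_is_derive_opp, C_is_derive_mult; [exact Dp2|exact D3]].
    rewrite Eq, E3. cbv beta. field. exact Hgn.
  - split.
    + eapply C_is_derive_val; [|apply C_is_derive_mult; [exact Dp|exact D1]].
      rewrite <- Hg2. cbv beta. field. exact Hgn.
    + eapply C_is_derive_val; [|apply C_is_derive_minus; [exact Dg|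
        apply C_is_derive_mult; [apply C_is_derive_mult; [exact Dp|exact Dp2]|exact D3]]].
      rewrite Eq, E3, <- Hg2. cbv beta. field. exact Hgn.
  - cbv beta. field. exact Hgn.
  - cbv beta. rewrite Hga. field. exact Hgn.
  - cbv beta. rewrite Hga, wp_periodic by assumption. field. exact Hgn.
Qed.

End Line.


(** * Monodromy *)

Lemma C_is_derive_zero_locally_const (f : C -> C) (z : C) :
  nbhd z (fun y => C_is_derive f y 0) -> nbhd z (fun y => f y = f z).
Proof.
  intros H. apply nbhd_Cmod in H. destruct H as [d [Hd H]]. apply nbhd_Cmod.
  exists d. split; [exact Hd|]. intros y Hy.
  assert (Hle : (Cmod (f y - f z) <= 2 * 0 * Cmod (y - z))%R).
  { apply (Cmod_increment_le f (fun _ => 0)). intros t Ht. split; [|rewrite Cmod_0; lra].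
    apply H. replace (z + RtoC t * (y - z) - z) with (RtoC t * (y - z)) by ring.
    rewrite Cmod_mult, Cmod_R, Rabs_pos_eq by lra. pose proof (Cmod_ge_0 (y - z)). nra. }
  replace (f y) with (f y - f z + f z) by ring. rewrite (Cmod_eq_0 (f y - f z)); [ring|].
  pose proof (Cmod_ge_0 (f y - f z)). lra.
Qed.

Lemma wronskian_derive (q y1 d1 y2 d2 : C -> C) (z : C) :
  ode_at q y1 d1 z -> ode_at q y2 d2 z ->
  C_is_derive (fun x => y1 x * d2 x - y2 x * d1 x) z 0.
Proof.
  intros [A1 B1] [A2 B2].
  eapply C_is_derive_val; [|apply C_is_derive_minus; apply C_is_derive_mult; eassumption]. cbv beta. ring.
Qed.

Lemma wronskian_coordinates (y dy u1 d1 u2 d2 : C) : u1 * d2 - u2 * d1 = 1 ->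
  y = (y * d2 - u2 * dy) * u1 + (u1 * dy - y * d1) * u2.
Proof. intros W. transitivity (y * (u1 * d2 - u2 * d1)); [rewrite W; ring|ring]. Qed.

Lemma ode_combination (q y1 d1 y2 d2 : C -> C) (a b z : C) :
  ode_at q y1 d1 z -> ode_at q y2 d2 z ->
  ode_at q (fun x => a * y1 x + b * y2 x) (fun x => a * d1 x + b * d2 x) z.
Proof.
  intros [A1 B1] [A2 B2]. split.
  - eapply C_is_derive_val; [|apply C_is_derive_plus; (apply C_is_derive_mult; [apply C_is_derive_const|eassumption])].
    cbv beta. ring.
  - eapply C_is_derive_val; [|apply C_is_derive_plus; (apply C_is_derive_mult; [apply C_is_derive_const|eassumption])].
    cbv beta. ring.
Qed.

Lemma near_line_imp (z0 w : C) (P Q : C -> Prop) :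
  (forall z, P z -> Q z) -> near_line z0 w P -> near_line z0 w Q.
Proof. intros H HP t. generalize (HP t). apply (filter_imp (F := nbhd _)). exact H. Qed.

Lemma near_line_and (z0 w : C) (P Q : C -> Prop) :
  near_line z0 w P -> near_line z0 w Q -> near_line z0 w (fun z => P z /\ Q z).
Proof. intros HP HQ t. exact (filter_and (F := nbhd _) _ _ (HP t) (HQ t)). Qed.

Lemma near_line_shift (z0 w : C) (P : C -> Prop) :
  near_line z0 w P -> near_line z0 w (fun z => P (z + w)).
Proof.
  intros HP t. apply (nbhd_cont (fun z => z + w) (z0 + RtoC t * w) P).
  - apply tends_plus; [apply cont_id|apply tends_const].
  - specialize (HP (t + 1)%R). rewrite RtoC_plus in HP.
    replace (z0 + RtoC t * w + w) with (z0 + (RtoC t + 1) * w) by ring. exact HP.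
Qed.

Lemma near_line_start (z0 w : C) (P : C -> Prop) : near_line z0 w P -> nbhd z0 P.
Proof. intros HP. specialize (HP 0%R). replace (z0 + RtoC 0 * w) with z0 in HP by ring. exact HP. Qed.

(** A neighbourhood of the line need not be connected, but it contains a connected one: move along
    the line first, then inside a disc. *)
Lemma near_line_derive_zero_const (z0 w : C) (f : C -> C) :
  near_line z0 w (fun z => C_is_derive f z 0) -> near_line z0 w (fun z => f z = f z0).
Proof.
  intros H.
  assert (E : forall t, f (z0 + RtoC t * w) = f z0).
  { intros t. replace (f z0) with (f (z0 + RtoC 0 * w)) by (f_equal; ring).
    apply (rder_zero_const (fun s => f (z0 + RtoC s * w))). intros s.
    apply rder_val with (0 * w); [ring|].
    apply (rder_comp f (fun s => z0 + RtoC s * w)); [|apply rder_line].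
    exact (nbhd_self _ _ (H s)). }
  intros t. rewrite <- (E t). apply C_is_derive_zero_locally_const. exact (H t).
Qed.

(** From here on only an antiperiodic basis with Wronskian 1 along the line matters, not the
    particular potential. *)
Section Monodromy.
Variables (q : C -> C) (z0 w : C) (u1 u2 d1 d2 : C -> C).
Hypothesis Hbasis : near_line z0 w (fun z => ode_at q u1 d1 z /\ ode_at q u2 d2 z /\
    u1 z * d2 z - u2 z * d1 z = 1 /\ u1 (z + w) = - u1 z /\ u2 (z + w) = - u2 z).

(** The coefficients are Wronskians with the basis, hence locally constant. *)
Lemma germ_combination (y dy : C -> C) : nbhd z0 (ode_at q y dy) ->
  exists a b, nbhd z0 (fun z => y z = a * u1 z + b * u2 z).
Proof.
  intros Hy. pose proof (near_line_start _ _ _ Hbasis) as Hb.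
  exists (y z0 * d2 z0 - u2 z0 * dy z0), (u1 z0 * dy z0 - y z0 * d1 z0).
  assert (HA : nbhd z0 (fun z => y z * d2 z - u2 z * dy z = y z0 * d2 z0 - u2 z0 * dy z0)).
  { apply (C_is_derive_zero_locally_const (fun z => y z * d2 z - u2 z * dy z)).
    generalize (filter_and _ _ Hy Hb). apply filter_imp. intros z [X [_ [Y _]]].
    apply (wronskian_derive q); assumption. }
  assert (HB : nbhd z0 (fun z => u1 z * dy z - y z * d1 z = u1 z0 * dy z0 - y z0 * d1 z0)).
  { apply (C_is_derive_zero_locally_const (fun z => u1 z * dy z - y z * d1 z)).
    generalize (filter_and _ _ Hy Hb). apply filter_imp. intros z [X [Y _]].
    apply (wronskian_derive q); assumption. }
  generalize (filter_and _ _ Hb (filter_and _ _ HA HB)). apply filter_imp.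
  intros z [[_ [_ [W _]]] [EA EB]]. rewrite <- EA, <- EB. apply wronskian_coordinates, W.
Qed.

Lemma line_solution_antiperiodic (Y dY : C -> C) : near_line z0 w (ode_at q Y dY) ->
  near_line z0 w (fun z => Y (z + w) = - Y z).
Proof.
  intros HY.
  set (a := Y z0 * d2 z0 - u2 z0 * dY z0). set (b := u1 z0 * dY z0 - Y z0 * d1 z0).
  assert (HA : near_line z0 w (fun z => Y z * d2 z - u2 z * dY z = a)).
  { apply (near_line_derive_zero_const z0 w (fun z => Y z * d2 z - u2 z * dY z)).
    generalize (near_line_and _ _ _ _ HY Hbasis). apply near_line_imp.
    intros z [X [_ [V _]]]. apply (wronskian_derive q); assumption. }
  assert (HB : near_line z0 w (fun z => u1 z * dY z - Y z * d1 z = b)).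
  { apply (near_line_derive_zero_const z0 w (fun z => u1 z * dY z - Y z * d1 z)).
    generalize (near_line_and _ _ _ _ HY Hbasis). apply near_line_imp.
    intros z [X [V _]]. apply (wronskian_derive q); assumption. }
  assert (HC : near_line z0 w (fun z => Y z = a * u1 z + b * u2 z)).
  { generalize (near_line_and _ _ _ _ Hbasis (near_line_and _ _ _ _ HA HB)). apply near_line_imp.
    intros z [[_ [_ [W _]]] [EA EB]]. rewrite <- EA, <- EB. apply wronskian_coordinates, W. }
  generalize (near_line_and _ _ _ _ Hbasis (near_line_and _ _ _ _ HC (near_line_shift _ _ _ HC))).
  apply near_line_imp. intros z [[_ [_ [_ [P1 P2]]]] [E E']]. rewrite E', E, P1, P2. ring.
Qed.

Lemma germ_continuation (y : C -> C) : solution_near q z0 y ->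
  exists Y, continuation_along q z0 w y Y /\ near_line z0 w (fun z => Y (z + w) = - Y z).
Proof.
  intros [dy Hy]. destruct (germ_combination y dy Hy) as [a [b E]].
  exists (fun z => a * u1 z + b * u2 z).
  assert (Hode : near_line z0 w (ode_at q (fun z => a * u1 z + b * u2 z) (fun z => a * d1 z + b * d2 z))).
  { generalize Hbasis. apply near_line_imp. intros z [X [V _]]. apply ode_combination; assumption. }
  split; [|apply (line_solution_antiperiodic _ _ Hode)].
  split; [|eexists; exact Hode]. revert E. apply (filter_imp (F := nbhd z0)). intros z Ez. symmetry. exact Ez.
Qed.

Lemma col2_inj (a b c d : C) : col2 a b = col2 c d -> a = c /\ b = d.
Proof. intros E. injection E. auto. Qed.

Lemma Mmult_col2 (M : @matrix C 2 2) (a b : C) :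
  @Mmult C_Ring 2 2 1 M (col2 a b) =
  col2 (coeff_mat (RtoC 0) M 0 0 * a + coeff_mat (RtoC 0) M 0 1 * b)
       (coeff_mat (RtoC 0) M 1 0 * a + coeff_mat (RtoC 0) M 1 1 * b).
Proof.
  destruct M as [[m00 [m01 []]] [[m10 [m11 []]] []]].
  unfold Mmult, col2, mk_matrix, coeff_mat; simpl. rewrite !sum_Sn, !sum_O. reflexivity.
Qed.

Lemma matrix_eq_opp_I2 (M : @matrix C 2 2) :
  M = opp I2 <->
  coeff_mat (RtoC 0) M 0 0 = - (1) /\ coeff_mat (RtoC 0) M 0 1 = 0 /\
  coeff_mat (RtoC 0) M 1 0 = 0 /\ coeff_mat (RtoC 0) M 1 1 = - (1).
Proof.
  assert (E0 : - (0) = RtoC 0) by ring.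
  assert (EI : opp I2 = ((- (1), (RtoC 0, tt)), ((RtoC 0, (- (1), tt)), tt)) :> @matrix C 2 2).
  { transitivity (((- (1), (- (0), tt)), ((- (0), (- (1), tt)), tt)) : @matrix C 2 2); [reflexivity|].
    rewrite E0. reflexivity. }
  rewrite EI. destruct M as [[m00 [m01 []]] [[m10 [m11 []]] []]]. unfold coeff_mat; simpl. split.
  - intros E. injection E. intros. subst. auto.
  - intros [-> [-> [-> ->]]]. reflexivity.
Qed.

(** Near [z0] the matrix [M + I] annihilates the column of [y1] and [y2], so linear independence
    makes it 0; conversely the basis provides the continuations. *)
Lemma monodromy_iff_opp_I2 (y1 y2 : C -> C) (M : @matrix C 2 2) :
  solution_near q z0 y1 -> solution_near q z0 y2 -> lin_indep_near z0 y1 y2 ->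
  (is_monodromy q z0 w y1 y2 M <-> M = opp I2).
Proof.
  intros Hy1 Hy2 Hind. rewrite matrix_eq_opp_I2. split.
  - intros [Y1 [Y2 [[E1 [dY1 O1]] [[E2 [dY2 O2]] HM]]]].
    set (a := coeff_mat (RtoC 0) M 0 0). set (b := coeff_mat (RtoC 0) M 0 1).
    set (c := coeff_mat (RtoC 0) M 1 0). set (d := coeff_mat (RtoC 0) M 1 1).
    assert (HE : nbhd z0 (fun z => (a + 1) * y1 z + b * y2 z = 0 /\ c * y1 z + (d + 1) * y2 z = 0)).
    { pose proof (near_line_start _ _ _ (near_line_and _ _ _ _ HM (near_line_and _ _ _ _
        (line_solution_antiperiodic Y1 dY1 O1) (line_solution_antiperiodic Y2 dY2 O2)))) as HS.
      generalize (filter_and _ _ HS (filter_and (F := nbhd z0) _ _ E1 E2)). apply filter_imp.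
      intros z [[Em [P1 P2]] [F1 F2]]. rewrite P1, P2, Mmult_col2 in Em. apply col2_inj in Em.
      fold a b c d in Em. destruct Em as [G1 G2]. rewrite <- F1, <- F2. split.
      - transitivity (a * Y1 z + b * Y2 z + Y1 z); [ring|]. rewrite <- G1. ring.
      - transitivity (c * Y1 z + d * Y2 z + Y2 z); [ring|]. rewrite <- G2. ring. }
    destruct (Hind (a + 1) b) as [Ha Hb].
    { revert HE. apply (filter_imp (F := nbhd z0)). tauto. }
    destruct (Hind c (d + 1)) as [Hc Hd].
    { revert HE. apply (filter_imp (F := nbhd z0)). tauto. }
    repeat split; try assumption.
    + replace a with (a + 1 - 1) by ring. rewrite Ha. ring.
    + replace d with (d + 1 - 1) by ring. rewrite Hd. ring.
  - intros [M00 [M01 [M10 M11]]].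
    destruct (germ_continuation y1 Hy1) as [Y1 [C1 A1]].
    destruct (germ_continuation y2 Hy2) as [Y2 [C2 A2]].
    exists Y1, Y2. split; [exact C1|]. split; [exact C2|].
    generalize (near_line_and _ _ _ _ A1 A2). apply near_line_imp.
    intros z [P1 P2]. rewrite P1, P2, Mmult_col2, M00, M01, M10, M11. f_equal; ring.
Qed.

End Monodromy.

Theorem corollary1p5 (tau z0 : C) (y1 y2 : C -> C) (M1 M2 : @matrix C 2 2)
  (Htau : (0 < Im tau)%R)
  (Hline1 : forall t : R, ~ singularity (qL0 tau) (z0 + RtoC t * 1))
  (Hline2 : forall t : R, ~ singularity (qL0 tau) (z0 + RtoC t * tau))
  (Hy1 : solution_near (qL0 tau) z0 y1)
  (Hy2 : solution_near (qL0 tau) z0 y2)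
  (Hind : lin_indep_near z0 y1 y2) :
  (is_monodromy (qL0 tau) z0 1 y1 y2 M1 <-> M1 = opp I2) /\
  (is_monodromy (qL0 tau) z0 tau y1 y2 M2 <-> M2 = opp I2).
Proof.
  assert (Hgen : forall w M, in_lattice tau w -> half_period tau (w / 2) ->
    (forall t : R, ~ singularity (qL0 tau) (z0 + RtoC t * w)) ->
    (is_monodromy (qL0 tau) z0 w y1 y2 M <-> M = opp I2)).
  { intros w M Hw Hh Hline.
    destruct (line_basis tau Htau z0 w Hw Hh) as [u1 [u2 [d1 [d2 Hb]]]].
    { intros t. apply nonsingular_off_half; [exact Htau|apply Hline]. }
    apply (monodromy_iff_opp_I2 _ _ _ _ _ _ _ Hb); assumption. }
  split; apply Hgen; try assumption.
  - apply in_lattice_one.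
  - apply half_period_1, Htau.
  - apply in_lattice_tau.
  - apply half_period_tau, Htau.
Qed.
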